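(* Let $B$ be a Banach space, let $A$ be the generator of a $C_0$-semigroup in $B$, and let the kernel function $a\in L^1_{\mathrm{loc}}(\mathbb{R}_+)$ be completely positive. Then the pair $(A,a)$ admits an exponentially bounded resolvent $S(t)$, $t\ge 0$. Moreover, there exist bounded linear operators $A_n$ on $B$ such that the pairs $(A_n,a)$ admit resolvent families $S_n(t)$, $t\ge 0$, satisfying, for some constants $M\ge 1$ and $w_0\ge 0$ independent of $n$ and $t$, $$\|S_n(t)\|\le M e^{w_0 t}\quad\text{for all } t\ge 0,$$ and $$S_n(t)x\to S(t)x\quad\text{as } n\to+\infty$$ for all $x\in B$, $t\ge 0$. Additionally, for each $x\in B$ the convergence is uniform in $t$ on every compact subset of $\mathbb{R}_+$.
   Context: $\mathbb{R}_+=[0,\infty)$ and $(a\star f)(t)=\int_0^t a(t-s)f(s)\,ds$. Resolvent. Let $A$ be a closed linear operator in $B$ with dense domain $D(A)$ and $a\in L^1_{\mathrm{loc}}(\mathbb{R}_+)$. A family $(S(t))_{t\ge 0}$ of bounded linear operators in $B$ is called a resolvent (resolvent family) for the Volterra equation $u(t)=\int_0^t a(t-\tau)Au(\tau)\,d\tau+f(t)$, and one says that the pair $(A,a)$ admits the resolvent $S(t)$, if: (1) $S(t)$ is strongly continuous on $\mathbb{R}_+$ and $S(0)=I$; (2) $S(t)(D(A))\subset D(A)$ and $AS(t)x=S(t)Ax$ for all $x\in D(A)$, $t\ge 0$; (3) $S(t)x=x+\int_0^t a(t-\tau)AS(\tau)x\,d\tau$ for all $x\in D(A)$, $t\ge 0$.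 $S(t)$ is exponentially bounded if there are constants $M\ge 1$, $\omega\in\mathbb{R}$ with $\|S(t)\|\le Me^{\omega t}$ for all $t\ge 0$. Complete positivity. $a\in L^1(0,T)$ is completely positive on $[0,T]$ if for every $\mu\ge 0$ the solutions $s,r$ of $s(t)+\mu(a\star s)(t)=1$ and $r(t)+\mu(a\star r)(t)=a(t)$ satisfy $s(t)\ge 0$ and $r(t)\ge 0$ on $[0,T]$. A kernel $a\in L^1_{\mathrm{loc}}(\mathbb{R}_+)$ is completely positive if it is completely positive on $[0,T]$ for every $T>0$. *)

(* Defs.v *)
From HB Require Import structures.
From mathcomp Require Import all_boot all_order all_algebra.
From mathcomp Require Import all_classical all_reals all_analysis.
From mathcomp Require Import complex.

Set Implicit Arguments.
Unset Strict Implicit.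
Unset Printing Implicit Defensive.

Import Order.TTheory GRing.Theory Num.Theory.
Import numFieldNormedType.Exports.

Local Open Scope classical_set_scope.
Local Open Scope ring_scope.

(* Banach spaces are taken over the reals or over the complex numbers; both   *)
(* cases are treated at once through [scalar_field R k].  Time, the kernel and the  *)
(* Lebesgue integrals of norms always live in [R].                            *)
Variant scalar_kind := RealScalars | ComplexScalars.

Definition scalar_field (R : realType) (k : scalar_kind) : numFieldType :=
  match k with
  | RealScalars => R
  | ComplexScalars => R[i]
  end.

Definition ofR (R : realType) (k : scalar_kind) : R -> scalar_field R k :=
  match k return R -> scalar_field R k with
  | RealScalars => fun c => c
  | ComplexScalars => fun c => real_complex R c
  end.
Arguments ofR {R} k c.

Definition toR (R : realType) (k : scalar_kind) : scalar_field R k -> R :=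
  match k return scalar_field R k -> R with
  | RealScalars => fun c => c
  | ComplexScalars => fun c => complex.Re c
  end.
Arguments toR {R} k c.

Section BanachOperators.
Context {R : realType} {k : scalar_kind}.
Variable B : completeNormedModType (scalar_field R k).
Local Notation mu := (@lebesgue_measure R).
Local Notation "c %:K" := (ofR k c) (at level 2, format "c %:K").

(* In mathcomp the norm of [B] takes its values in the scalar field; over     *)
(* [R[i]] it is a nonnegative real embedded in [R[i]].                        *)
Definition rnorm (x : B) : R := toR k `|x|.

Definition opnorm (L : {linear B -> B}) : \bar R :=
  ereal_sup [set (rnorm (L x))%:E | x in [set x | rnorm x <= 1]].

Definition bounded_op (L : {linear B -> B}) : Prop := (opnorm L < +oo)%E.

(* The values of [op_fun] outside [op_dom] carry no meaning.                  *)
Record operator := Operator {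
  op_dom : set B;
  op_fun :> B -> B;
  op_dom0 : op_dom 0;
  op_linear : forall (c : scalar_field R k) (x y : B), op_dom x -> op_dom y ->
    op_dom (c *: x + y) /\ op_fun (c *: x + y) = c *: op_fun x + op_fun y }.

Definition closed_op (A : operator) : Prop :=
  closed [set p : B * B | op_dom A p.1 /\ A p.1 = p.2].

Lemma everywhere_linear (L : {linear B -> B}) (c : scalar_field R k) (x y : B) :
  setT x -> setT y ->
  [set: B] (c *: x + y) /\ L (c *: x + y) = c *: L x + L y.
Proof. by move=> _ _; split=> //; rewrite linearP. Qed.

Definition everywhere_op (L : {linear B -> B}) : operator :=
  @Operator setT L I (everywhere_linear L).

Definition strongly_continuous (S : R -> {linear B -> B}) : Prop :=
  forall x : B, {within `[0, +oo[, continuous (fun t => S t x)}.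

Definition C0_semigroup (T : R -> {linear B -> B}) : Prop :=
  [/\ forall t, 0 <= t -> bounded_op (T t),
      forall x, T 0 x = x,
      forall s t, 0 <= s -> 0 <= t -> forall x, T (s + t) x = T s (T t x) &
      strongly_continuous T].

Definition generator_of (A : operator) (T : R -> {linear B -> B}) : Prop :=
  forall x y : B, (op_dom A x /\ A x = y) <->
    (h%:K)^-1 *: (T h x - x) @[h --> 0^'+] --> y.

Definition generates_C0_semigroup (A : operator) : Prop :=
  exists T : R -> {linear B -> B}, C0_semigroup T /\ generator_of A T.

(* [B]-valued simple functions: the sum of the \1_(sf_set i) sf_val i.         *)
Record simple_fun := SimpleFun {
  sf_size : nat;
  sf_set : 'I_sf_size -> set R;
  sf_val : 'I_sf_size -> B;
  sf_measurable : forall i, measurable (sf_set i);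
  sf_finite : forall i, (mu (sf_set i) < +oo)%E }.

Definition sf_eval (s : simple_fun) (t : R) : B :=
  \sum_(i < sf_size s) (\1_(sf_set i) t)%:K *: sf_val i.

Definition sf_integral (D : set R) (s : simple_fun) : B :=
  \sum_(i < sf_size s) (fine (mu (D `&` sf_set i)))%:K *: sf_val i.

(* [f] is Bochner integrable on [D] for Lebesgue measure, with integral [v].  *)
Definition is_bochner_integral (D : set R) (f : R -> B) (v : B) : Prop :=
  exists s : nat -> simple_fun,
    [/\ {ae mu, forall t, D t -> sf_eval (s n) t @[n --> \oo] --> f t},
        (\int[mu]_(t in D) (rnorm (f t - sf_eval (s n) t))%:E)%E
          @[n --> \oo] --> (0%E : \bar R) &
        sf_integral D (s n) @[n --> \oo] --> v].

Definition loc_integrable (a : R -> R) : Prop :=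
  forall T : R, 0 < T -> mu.-integrable `[0, T] (EFin \o a).

(* [(A, a)] admits the resolvent [S]; only the values [S t] with [0 <= t]     *)
(* matter.                                                                    *)
Definition resolvent (A : operator) (a : R -> R) (S : R -> {linear B -> B}) :
    Prop :=
  [/\ closed_op A, dense (op_dom A) & loc_integrable a] /\
  [/\ forall t, 0 <= t -> bounded_op (S t),
      strongly_continuous S /\ (forall x, S 0 x = x),
      forall t x, 0 <= t -> op_dom A x ->
        op_dom A (S t x) /\ A (S t x) = S t (A x) &
      forall t x, 0 <= t -> op_dom A x ->
        is_bochner_integral `[0, t]
          (fun tau => (a (t - tau))%:K *: A (S tau x)) (S t x - x)].

Definition exp_bounded (S : R -> {linear B -> B}) : Prop :=
  exists M w : R, 1 <= M /\
    forall t, 0 <= t -> (opnorm (S t) <= (M * expR (w * t))%:E)%E.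

End BanachOperators.

Section CompletePositivity.
Context {R : realType}.
Local Notation mu := (@lebesgue_measure R).

Definition convolution (a f : R -> R) (t : R) : R :=
  \int[mu]_(s in `[0, t]) (a (t - s) * f s).

(* The scalar Volterra equations below have exactly one solution: [s] among   *)
(* the continuous functions, [r] in L^1(0, T), hence up to a.e. equality.     *)
Definition completely_positive_on (T : R) (a : R -> R) : Prop :=
  mu.-integrable `[0, T] (EFin \o a) /\
  forall m : R, 0 <= m -> exists s r : R -> R,
    [/\ {within `[0, T], continuous s},
        forall t, 0 <= t <= T -> s t + m * convolution a s t = 1 &
        forall t, 0 <= t <= T -> 0 <= s t] /\
    [/\ mu.-integrable `[0, T] (EFin \o r),
        {ae mu, forall t, 0 <= t <= T -> r t + m * convolution a r t = a t} &
        {ae mu, forall t, 0 <= t <= T -> 0 <= r t}].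

Definition completely_positive (a : R -> R) : Prop :=
  forall T : R, 0 < T -> completely_positive_on T a.

End CompletePositivity.

(* Main.v *)
(** Let [A] generate the semigroup [T].  For [N = n + 1] take
    [A_n = N (T (1/N) - I)] and let [r], [s] solve [r + N a * r = a] and
    [s + N a * s = 1].  The resolvent of [(A_n, a)] is the mixture
    [S_n t x = \sum_j p_j t *: T (j/N) x] with [p_0 = s] and
    [p_(j+1) = N (r * p_j)]; complete positivity of [a] makes the weights [p_j]
    nonnegative.  Their generating function [\sum_j z^j p_j] solves the scalar
    equation [u = 1 + N (z - 1) (a * u)].  If [|T t| <= M e^(w t)], then [|S_n t|] is at
    most [M] times the generating function at [z = e^(w/N)]; as [N (z - 1)] stays
    bounded, a Gronwall argument gives an exponential bound uniform in [n].

    By Bernstein approximation in the variable [e^(-t)], an orbit [T t x] is, up to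
    [e * e^((w+1) t)], a finite combination [\sum_j e^(g_j t) b_j].  Hence
    [S_n t x] is close to [\sum_j u_(n,j) t *: b_j], where [u_(n,j)] is the generating
    function at [z = e^(g_j/N)].  Since [N (z - 1)] tends to [g_j], [u_(n,j)] converges
    locally uniformly, so [S_n t x] is uniformly Cauchy on compact sets for every [x].

    The resolvent equations only involve integrals of [a (t - s) *: g s] where [g] is
    a locally uniform limit of finite combinations of fixed vectors with continuous
    scalar coefficients; there the Bochner integral reduces to scalar convolutions. *)
Require Import Defs.
From HB Require Import structures.
From mathcomp Require Import all_boot all_order all_algebra.
From mathcomp Require Import all_classical all_reals all_analysis.
From mathcomp Require Import measurable_realfun complex ring lra.
Import Order.TTheory GRing.Theory Num.Theory.
Import numFieldNormedType.Exports.
Local Open Scope classical_set_scope.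
Local Open Scope ring_scope.

(** * Reflection and double convolution *)

Section Reflection.
Context {R : realType}.
Local Notation mu := (@lebesgue_measure R).
Local Open Scope ereal_scope.

(** Two obstacles shape the proof. The kernel is only locally integrable, so nothing bounds its
    growth a priori and no Laplace transform is at hand; [exp_rate_exists] draws exponential control
    out of complete positivity itself, and uniqueness, gluing, bounds and convergence all rest on it
    through [volterra_gronwall]. Moreover complete positivity supplies [s] and [r] interval by
    interval, [r] only in L^1 and up to null sets, whereas the weights must be continuous on the
    half-line: [r * f] is continuous for continuous [f], and solutions on the intervals [[0, T]] are
    glued by uniqueness. Series are handled through their partial sums, cut at [K]; comparing the
    generating function at [z] and at [2 z] shows that the error decays like [2^-K]. Likewise orbit
    integrals are replaced by sums of the semigroup over multiples of a step, which telescope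
    exactly; one limit principle, [generator_limit], then yields closedness and density of the
    generator and the invariance of its domain under [S t]. *)

Definition reflect (c : R) : measurableTypeR R -> measurableTypeR R :=
  fun x => (c - x)%R.

Lemma measurable_reflect (c : R) : measurable_fun setT (reflect c).
Proof. by apply: measurable_funB => //; exact: measurable_id. Qed.

HB.instance Definition _ (c : R) := isMeasurableFun.Build _ _ _ _
  (reflect c) (measurable_reflect c).

(** The preimage of []a, b]] is [[c - b, c - a[], of the same length, and Lebesgue measure is
    determined by its values on half-open intervals. *)
Lemma lebesgue_measure_reflect (c : R) (A : set R) : measurable A ->
  pushforward mu (reflect c) A = mu A.
Proof.
move=> mA; apply/esym/lebesgue_measure_unique => //= _ [[a b]] _ <-.
rewrite /pushforward.
have -> : reflect c @^-1` `]a, b]%classic = `[(c - b)%R, (c - a)%R[%classic.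
  apply/seteqP; split => x; rewrite /reflect/= !in_itv /= => /andP[h1 h2];
    apply/andP; split; lra.
rewrite !lebesgue_measure_itv/= !lte_fin.
by rewrite ltrD2l ltrN2; case: ifP => // _; rewrite -!EFinB; congr EFin; ring.
Qed.

Lemma ge0_integral_reflect (c : R) (f : R -> \bar R) :
  measurable_fun setT f -> (forall x, 0 <= f x) ->
  \int[mu]_x f (c - x)%R = \int[mu]_x f x.
Proof.
move=> mf f0.
transitivity (\int[mu]_(x in reflect c @^-1` setT) (f \o reflect c) x) => //.
rewrite -(@ge0_integral_pushforward _ _ _ _ _ _ (measurable_reflect c) mu setT f)//.
apply: eq_measure_integral => //= A mA _.
exact: lebesgue_measure_reflect.
Qed.

Lemma integral_reflect (c : R) (f : R -> \bar R) : measurable_fun setT f ->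
  \int[mu]_x f (c - x)%R = \int[mu]_x f x.
Proof.
move=> mf; rewrite [LHS]integralE [RHS]integralE.
congr (_ - _).
  rewrite -(ge0_integral_reflect c (f^\+)%E)//; last exact: measurable_funepos.
  by apply: eq_integral => x _; rewrite !funeposE.
rewrite -(ge0_integral_reflect c (f^\-)%E)//; last exact: measurable_funeneg.
by apply: eq_integral => x _; rewrite !funenegE.
Qed.

Lemma patch_reflect (t : R) (f : R -> \bar R) :
  ((fun s => f (t - s)%R) \_ `[0%R, t]) =
  (fun s => (f \_ `[0%R, t]) (t - s)%R).
Proof.
apply/funext => s; rewrite !patchE.
suff -> : (s \in `[0%R, t]%classic) = ((t - s)%R \in `[0%R, t]%classic) by [].
apply/idP/idP; rewrite !inE/= !in_itv/= => /andP[h1 h2]; apply/andP; split; lra.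
Qed.

Lemma integral_itv_reflect (t : R) (f : R -> \bar R) :
  measurable_fun `[0%R, t] f ->
  \int[mu]_(s in `[0%R, t]) f (t - s)%R = \int[mu]_(s in `[0%R, t]) f s.
Proof.
move=> mf; rewrite integral_mkcond [RHS]integral_mkcond patch_reflect.
by apply: integral_reflect; apply/(measurable_restrictT _ _).1.
Qed.

Lemma measurable_itv_reflect (t : R) (f : R -> \bar R) :
  measurable_fun `[0%R, t] f -> measurable_fun `[0%R, t] (fun s => f (t - s)%R).
Proof.
move=> mf; apply/(measurable_restrictT _ _) => //; rewrite patch_reflect.
apply: (measurableT_comp _ (measurable_reflect t)).
exact/(measurable_restrictT _ _).1.
Qed.

Lemma integrable_itv_reflect (t : R) (f : R -> \bar R) :
  mu.-integrable `[0%R, t] f -> mu.-integrable `[0%R, t] (fun s => f (t - s)%R).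
Proof.
move=> /integrableP[mf fi]; apply/integrableP; split.
  exact: measurable_itv_reflect.
rewrite (integral_itv_reflect t (fun s => `|f s|))//.
exact: measurableT_comp.
Qed.

Lemma ae_reflect (t : R) (P : R -> Prop) :
  {ae mu, forall s, P s} -> {ae mu, forall s, P (t - s)%R}.
Proof.
move=> [N [mN N0 sN]].
exists (reflect t @^-1` N); split.
- by rewrite -[X in measurable X]setTI; apply: measurable_reflect.
- by have := lebesgue_measure_reflect t N mN; rewrite /pushforward N0.
- by move=> x /= Px; apply: sN.
Qed.

Lemma ae_impl (P Q : R -> Prop) : (forall s, P s -> Q s) ->
  {ae mu, forall s, P s} -> {ae mu, forall s, Q s}.
Proof. by move=> PQ; apply: negligibleS => s /= nQ Ps; exact/nQ/PQ. Qed.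

Lemma ae_impl2 (P Q S : R -> Prop) : (forall s, P s -> Q s -> S s) ->
  {ae mu, forall s, P s} -> {ae mu, forall s, Q s} -> {ae mu, forall s, S s}.
Proof.
move=> PQS hP hQ; apply: negligibleS (negligibleU hP hQ) => s /= nS.
by apply/not_andP => -[Ps Qs]; apply: nS; exact: PQS.
Qed.

(** Values in [\bar R] over the whole line let Tonelli apply to nonnegative functions at once;
    finiteness is settled afterwards by [ae_finite_econv]. *)
Definition econv (f g : R -> \bar R) (t : R) : \bar R :=
  \int[mu]_s (f (t - s)%R * g s).

Section EConv.
Variables f g h : R -> \bar R.
Hypotheses (mf : measurable_fun setT f) (f0 : forall x, 0 <= f x).
Hypotheses (mg : measurable_fun setT g) (g0 : forall x, 0 <= g x).
Hypotheses (mh : measurable_fun setT h) (h0 : forall x, 0 <= h x).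

Lemma econv_ge0 t : 0 <= econv f g t.
Proof. by apply: integral_ge0 => s _; exact: mule_ge0. Qed.

Lemma econvC t : econv f g t = econv g f t.
Proof.
rewrite /econv -(ge0_integral_reflect t (fun s => g (t - s)%R * f s)).
- by apply: eq_integral => s _; rewrite muleC subKr.
- by apply: emeasurable_funM => //; apply: (measurableT_comp mg);
    exact: measurable_reflect.
- by move=> x; exact: mule_ge0.
Qed.

Lemma measurable_econv_kernel :
  measurable_fun setT (fun z : measurableTypeR R * measurableTypeR R =>
    f (z.1 - z.2)%R * g z.2).
Proof.
apply: emeasurable_funM; last exact: (measurableT_comp mg).
apply: (measurableT_comp mf).
by apply: measurable_funB; [exact: measurable_fst|exact: measurable_snd].
Qed.

Lemma measurable_econv : measurable_fun setT (econv f g).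
Proof.
apply: (measurable_fun_fubini_tonelli_F (m2 := mu)
  (fun z : measurableTypeR R * measurableTypeR R => f (z.1 - z.2)%R * g z.2)).
- exact: measurable_econv_kernel.
- by move=> z; exact: mule_ge0.
Qed.

End EConv.

(** Tonelli exchanges the two integrals; reflecting the inner variable then exhibits the convolution
    of [g] and [f] at [t - u]. *)
Lemma econvA (f g h : R -> \bar R) (t : R) :
  measurable_fun setT f -> (forall x, 0 <= f x) ->
  measurable_fun setT g -> (forall x, 0 <= g x) ->
  measurable_fun setT h -> (forall x, 0 <= h x) ->
  econv f (econv g h) t = econv (econv f g) h t.
Proof.
move=> mf f0 mg g0 mh h0; rewrite {1}/econv.
pose K := fun z : measurableTypeR R * measurableTypeR R =>
  f (t - z.1)%R * (g (z.1 - z.2)%R * h z.2).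
have mK : measurable_fun setT K.
  apply: emeasurable_funM; last exact: measurable_econv_kernel.
  apply: (measurableT_comp mf).
  by apply: measurable_funB => //; exact: measurable_fst.
have K0 z : 0 <= K z by rewrite !mule_ge0.
transitivity (\int[mu]_s \int[mu]_u K (s, u)).
  apply: eq_integral => s _; rewrite -ge0_integralZl//.
  - apply: emeasurable_funM => //; apply: (measurableT_comp mg).
    exact: measurable_reflect.
  - by move=> u _; exact: mule_ge0.
rewrite (fubini_tonelli (m1 := mu) (m2 := mu) K)//.
apply: eq_integral => u _; rewrite /K/=.
transitivity (\int[mu]_s (f (t - s)%R * g (s - u)%R * h u)).
  by apply: eq_integral => s _; rewrite muleA.
have mgu : measurable_fun [set: R] (fun s : R => g (s - u)%R).
  apply: (measurableT_comp mg).
  by apply: measurable_funB => //; exact: measurable_id.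
rewrite ge0_integralZr//; last 2 first.
- apply: emeasurable_funM => //; apply: (measurableT_comp mf).
  exact: measurable_reflect.
- by move=> s _; exact: mule_ge0.
congr (_ * _); rewrite (econvC f g)//.
rewrite -(ge0_integral_reflect t (fun s => f (t - s)%R * g (s - u)%R))/=.
- by apply: eq_integral => s _; rewrite muleC; congr (g _ * f _); ring.
- apply: emeasurable_funM => //; apply: (measurableT_comp mf).
  exact: measurable_reflect.
- by move=> s; exact: mule_ge0.
Qed.

End Reflection.

(** * Convolution with a nonnegative kernel *)

Section Convolution.
Context {R : realType}.
Local Notation mu := (@lebesgue_measure R).

(** Nearest-point projection onto [[0, T]]: composing with it makes a function continuous on
    [[0, T]] continuous on the whole line, the form in which the convolution lemmas take their
    argument. *)
Definition clamp (T t : R) : R := Num.max 0 (Num.min T t).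

Lemma clamp_itv T t : 0 <= T -> 0 <= clamp T t <= T.
Proof. by move=> T0; rewrite /clamp le_max lexx/= ge_max T0 ge_min lexx. Qed.

Lemma clamp_id T t : 0 <= t <= T -> clamp T t = t.
Proof. by move=> /andP[t0 tT]; rewrite /clamp min_r// max_r. Qed.

Lemma clamp_continuous T : continuous (clamp T).
Proof.
move=> t; apply: continuous_max; first exact: cvg_cst.
by apply: continuous_min; [exact: cvg_cst|exact: cvg_id].
Qed.

Lemma continuous_clamp {V : topologicalType} (f : R -> V) T : 0 <= T ->
  {within `[0, T], continuous f} -> continuous (fun t => f (clamp T t)).
Proof.
move=> T0 /subspace_continuousP cf t.
have At : `[0, T]%classic (clamp T t) by rewrite /= in_itv/= clamp_itv.
move=> P /(cf _ At); rewrite /= nbhs_simpl/= /within/= => /(clamp_continuous T t).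
rewrite /= nbhs_simpl/=; apply: filterS => s; apply.
by rewrite in_itv/= clamp_itv.
Qed.

Lemma continuous_itv_bounded (f : R -> R) (u v : R) : continuous f ->
  exists2 M, 0 < M & forall s, u <= s <= v -> `|f s| <= M.
Proof.
move=> cf; have /compact_bounded[M [_ hM]] :
    compact (f @` `[u, v]).
  by apply: continuous_compact; [exact: continuous_subspaceT|exact: segment_compact].
exists (Num.max M 0 + 1) => [|s suv].
  by rewrite ltr_wpDl// le_max lexx orbT.
apply: (hM (Num.max M 0 + 1)); first by rewrite ltr_pwDr// le_max lexx.
by exists s => //; rewrite /= in_itv.
Qed.

Lemma integrable_mul_continuous (D : set (measurableTypeR R)) (g f : R -> R) (u v : R) :
  measurable D -> D `<=` `[u, v] -> continuous f ->
  mu.-integrable D (EFin \o g) ->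
  mu.-integrable D (fun s => (g s * f s)%:E).
Proof.
move=> mD Duv cf ig.
have [M M0 hM] := continuous_itv_bounded f u v cf.
have mf : measurable_fun D f.
  exact: measurable_funTS (continuous_measurable_fun cf).
have bf : [bounded f x | x in D].
  exists M; split; first exact: num_real.
  move=> x Mx y Dy /=; apply: (le_trans _ (ltW Mx)).
  by apply: hM; have := Duv _ Dy; rewrite /= in_itv.
have := integrableMl mD ig mf bf.
by apply: eq_integrable => // s _; rewrite /= EFinM.
Qed.

Lemma continuous_comp_fun (f g : R -> R) :
  continuous f -> continuous g -> continuous (fun x => g (f x)).
Proof. by move=> cf cg x; exact: (continuous_comp (cf x) (cg (f x))). Qed.

Lemma continuous_reflect (t : R) : continuous (fun s : R => t - s).
Proof. by move=> s; apply: cvgB; [exact: cvg_cst|exact: cvg_id]. Qed.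

Section Kernel.
Variables (T : R) (b : R -> R).
Hypothesis ib : mu.-integrable `[0, T] (EFin \o b).

Lemma kernel_integrableS t : t <= T -> mu.-integrable `[0, t] (EFin \o b).
Proof.
by move=> tT; apply: integrableS ib => //; apply: subset_itvl; rewrite bnd_simp.
Qed.

Lemma kernel_integrable_reflect t : t <= T ->
  mu.-integrable `[0, t] (EFin \o (fun s => b (t - s))).
Proof.
by move=> tT; have := integrable_itv_reflect t _ (kernel_integrableS t tT).
Qed.

Lemma conv_integrable t (f : R -> R) : t <= T -> continuous f ->
  mu.-integrable `[0, t] (EFin \o (fun s => b (t - s) * f s)).
Proof.
move=> tT cf; apply: (integrable_mul_continuous _ _ _ 0 t) => //.
exact: kernel_integrable_reflect.
Qed.

Lemma convD t (f g : R -> R) : t <= T -> continuous f -> continuous g ->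
  convolution b (fun s => f s + g s) t = convolution b f t + convolution b g t.
Proof.
move=> tT cf cg; rewrite /convolution -RintegralD//; try exact: conv_integrable.
by apply: eq_Rintegral => s _; rewrite mulrDr.
Qed.

Lemma convZ t c (f : R -> R) : t <= T -> continuous f ->
  convolution b (fun s => c * f s) t = c * convolution b f t.
Proof.
move=> tT cf; rewrite /convolution -RintegralZl//; last exact: conv_integrable.
by apply: eq_Rintegral => s _; rewrite mulrCA.
Qed.

Lemma eq_conv t (f g : R -> R) : (forall s, 0 <= s <= t -> f s = g s) ->
  convolution b f t = convolution b g t.
Proof.
move=> fg; apply: eq_Rintegral => s; rewrite inE/= in_itv/= => st.
by rewrite fg.
Qed.

Lemma conv_reflect t (f : R -> R) : t <= T -> continuous f ->
  convolution b f t = \int[mu]_(s in `[0, t]) (b s * f (t - s)).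
Proof.
move=> tT cf; rewrite /convolution /Rintegral; congr fine.
rewrite -(integral_itv_reflect t (fun s => (b s * f (t - s))%:E)).
  by apply: eq_integral => s _; rewrite subKr.
apply: (measurable_int mu).
apply: (integrable_mul_continuous _ b (fun s => f (t - s)) 0 t) => //.
  exact: continuous_comp_fun (continuous_reflect t) cf.
exact: kernel_integrableS.
Qed.

(** In [\int_0^t b(s) f(t - s) ds] both domain and integrand move with [t]. Replacing [f] by [g],
    which vanishes on the negative axis, fixes the domain to [[0, T]], where dominated convergence
    applies; the rest is [f 0] times the primitive of [b]. *)
Lemma conv_continuous (f : R -> R) : 0 <= T -> continuous f ->
  {within `[0, T], continuous (convolution b f)}.
Proof.
move=> T0 cf; pose g u := f (Num.max u 0) - f 0.
have cg : continuous g.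
  move=> u; apply: cvgB; last exact: cvg_cst.
  apply: (continuous_comp_fun (fun u => Num.max u 0) f) => // {}u.
  by apply: continuous_max; [exact: cvg_id|exact: cvg_cst].
have cgr t : continuous (fun s => g (t - s)).
  exact: continuous_comp_fun (continuous_reflect t) cg.
have ig t : mu.-integrable `[0, T] (EFin \o (fun s => b s * g (t - s))).
  exact: (integrable_mul_continuous _ b (fun s => g (t - s)) 0 T).
have E t : 0 <= t <= T -> convolution b f t =
    \int[mu]_(s in `[0, T]) (b s * g (t - s)) +
    f 0 * parameterized_integral mu 0 t b.
  move=> /andP[t0 tT]; rewrite conv_reflect//.
  have -> : \int[mu]_(s in `[0, T]) (b s * g (t - s)) =
      \int[mu]_(s in `[0, t]) (b s * g (t - s)).
    rewrite Rintegral_mkcond [RHS]Rintegral_mkcond; apply: eq_Rintegral => s _.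
    rewrite !patchE; case: ifPn => sT; case: ifPn => st //.
      move: sT st; rewrite notin_setE inE/= !in_itv/= => /andP[s0 sT].
      rewrite s0/= => /negP; rewrite -ltNge => ts.
      by rewrite /g max_r ?subrr ?mulr0// subr_le0 ltW.
    move: sT st; rewrite notin_setE inE/= !in_itv/= => + /andP[s0 st].
    by rewrite s0 (le_trans st tT).
  rewrite /parameterized_integral -RintegralZl//; last exact: kernel_integrableS.
  rewrite -RintegralD//; last 2 first.
  - by apply: integrableS (ig t) => //; apply: subset_itvl; rewrite bnd_simp.
  - have := kernel_integrableS t tT.
    by move=> /(integrableZl _ (f 0)); apply.
  apply: eq_Rintegral => s; rewrite inE/= in_itv/= => /andP[s0 st].
  by rewrite /g max_l ?subr_ge0//; ring.
apply: (@subspace_eq_continuous _ _ _ (fun t =>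
    \int[mu]_(s in `[0, T]) (b s * g (t - s)) +
    f 0 * parameterized_integral mu 0 t b)).
  by move=> t; rewrite inE/= in_itv/= => /E.
have c1 : {within `[0, T], continuous
    (fun t => \int[mu]_(s in `[0, T]) (b s * g (t - s)))}.
  apply: continuous_in_subspaceT => t; rewrite inE/= in_itv/= => /andP[t0 tT].
  have [M M0 hM] := continuous_itv_bounded g (- 1 - T) (T + 1) cg.
  apply: (@continuity_under_integral R _ _ mu (fun t s => b s * g (t - s))
    `[0, T] _ (- 1) (T + 1) _ _ (fun s => `|b s| * M)) => //.
  - apply: aeW => s _ x _; apply: cvgM; first exact: cvg_cst.
    apply: (continuous_comp_fun (fun x => x - s) g) => // y.
    by apply: cvgB; [exact: cvg_id|exact: cvg_cst].
  - apply: (integrable_mul_continuous _ (fun s => `|b s|) (fun=> M) 0 T) => //.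
      by move=> ?; exact: cvg_cst.
    exact: (integrable_norm ib).
  - move=> x /=; rewrite in_itv/= => /andP[x1 x2]; apply: aeW => s /=.
    rewrite in_itv/= => /andP[s0 sT].
    by rewrite normrM ler_wpM2l// hM//; apply/andP; split; lra.
  - by rewrite inE/= in_itv/=; apply/andP; split; lra.
have c2 := parameterized_integral_continuous T0 ib.
move=> t; apply: cvgD; first exact: c1.
by apply: cvgM; [exact: cvg_cst|exact: c2].
Qed.

Hypothesis b0 : {ae mu, forall s, 0 <= s <= T -> 0 <= b s}.

Lemma kernel_ge0_reflect t : t <= T ->
  {ae mu, forall s, 0 <= s <= t -> 0 <= b (t - s)}.
Proof.
move=> tT; apply: ae_impl (ae_reflect t _ b0) => s h /andP[s0 st].
by apply: h; apply/andP; split; lra.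
Qed.

(** [b] is nonnegative only almost everywhere, so the integrand is first exchanged for its absolute
    value. *)
Lemma conv_ge0 t (f : R -> R) : t <= T -> continuous f ->
  (forall s, 0 <= s <= t -> 0 <= f s) -> 0 <= convolution b f t.
Proof.
move=> tT cf f0; rewrite /convolution /Rintegral; apply: fine_ge0.
have -> : (\int[mu]_(s in `[0%R, t]) (b (t - s) * f s)%:E =
    \int[mu]_(s in `[0%R, t]) `|b (t - s) * f s|%:E)%E; last first.
  by apply: integral_ge0 => s _; rewrite lee_fin.
apply: ae_eq_integral => //.
- exact: (measurable_int mu (conv_integrable t f tT cf)).
- have := integrable_norm (conv_integrable t f tT cf).
  exact: measurable_int.
- apply: ae_impl (kernel_ge0_reflect t tT) => s h.
  rewrite /= in_itv/= => st.
  by rewrite ger0_norm// mulr_ge0 ?h ?f0.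
Qed.

Lemma conv_le t (f g : R -> R) : t <= T -> continuous f -> continuous g ->
  (forall s, 0 <= s <= t -> f s <= g s) -> convolution b f t <= convolution b g t.
Proof.
move=> tT cf cg fg; rewrite -subr_ge0.
have cNf : continuous (fun s => -1 * f s).
  by move=> s; apply: cvgM; [exact: cvg_cst|exact: cf].
have -> : convolution b g t - convolution b f t =
    convolution b (fun s => g s + -1 * f s) t.
  by rewrite convD// convZ// mulN1r.
apply: conv_ge0 => //; first by move=> s; apply: cvgD; [exact: cg|exact: cNf].
by move=> s /fg; lra.
Qed.

Lemma conv_norm t (f : R -> R) : t <= T -> continuous f ->
  `|convolution b f t| <= convolution b (fun s => `|f s|) t.
Proof.
move=> tT cf.
have cnf : continuous (fun s => `|f s|).
  by move=> s; apply: continuous_comp; [exact: cf|exact: norm_continuous].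
rewrite ler_norml; apply/andP; split.
  rewrite -mulN1r -convZ//; apply: conv_le => //.
    by move=> s; apply: cvgM; [exact: cvg_cst|exact: cnf].
  by move=> s _; rewrite mulN1r lerNl -normrN ler_norm.
by apply: conv_le => // s _; exact: ler_norm.
Qed.

End Kernel.
End Convolution.

(** * Solving Volterra equations with the resolvent kernel *)

Section ResolventKernel.
Context {R : realType}.
Local Notation mu := (@lebesgue_measure R).

(** The absolute value makes the zero extension nonnegative everywhere, as [econv] asks; for a
    kernel nonnegative almost everywhere on [[0, T]] it changes only a null set there. *)
Definition extend_norm (T : R) (b : R -> R) : R -> \bar R :=
  (fun s => `|b s|%:E) \_ `[0, T].

Lemma extend_norm_in T b s : 0 <= s <= T -> extend_norm T b s = `|b s|%:E.
Proof. by move=> sT; rewrite /extend_norm patchE ifT// inE/= in_itv. Qed.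

Lemma extend_norm_out T b s : ~~ (0 <= s <= T) -> extend_norm T b s = 0%E.
Proof.
move=> sT; rewrite /extend_norm patchE ifF//; apply/negP; rewrite inE/= in_itv/=.
exact/negP.
Qed.

Lemma extend_norm_ge0 T b s : (0 <= extend_norm T b s)%E.
Proof. by rewrite /extend_norm patchE; case: ifP => _ //; rewrite lee_fin. Qed.

Lemma measurable_extend_norm T b :
  measurable_fun (`[0, T] : set (measurableTypeR R)) b ->
  measurable_fun setT (extend_norm T b).
Proof.
move=> mb; apply/(measurable_restrictT _ _).1 => //.
by apply/measurable_EFinP; exact: measurableT_comp.
Qed.

Lemma econv_extend_norm T b g t : 0 <= t <= T ->
  econv (extend_norm T b) (extend_norm T g) t =
  (\int[mu]_(s in `[0%R, t]) (`|b (t - s)| * `|g s|)%:E)%E.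
Proof.
move=> /andP[t0 tT]; rewrite [RHS]integral_mkcond; apply: eq_integral => s _.
rewrite patchE; case: ifPn.
  rewrite inE/= in_itv/= => /andP[s0 st].
  rewrite !extend_norm_in; first by rewrite EFinM.
    by rewrite s0 (le_trans st).
  by apply/andP; split; lra.
rewrite notin_setE/= in_itv/= => /negP; rewrite negb_and -!ltNge => /orP[s0|ts].
  rewrite [X in (_ * X)%E]extend_norm_out ?mule0//.
  by rewrite negb_and -!ltNge s0.
rewrite extend_norm_out ?mul0e// negb_and -!ltNge; apply/orP; left; lra.
Qed.

Lemma econv_extend_normE T (b g : R -> R) t : 0 <= t <= T ->
  mu.-integrable `[0, T] (EFin \o b) ->
  measurable_fun (`[0, T] : set (measurableTypeR R)) g ->
  {ae mu, forall s, 0 <= s <= T -> 0 <= b s} ->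
  {ae mu, forall s, 0 <= s <= T -> 0 <= g s} ->
  econv (extend_norm T b) (extend_norm T g) t =
  (\int[mu]_(s in `[0%R, t]) (b (t - s) * g s)%:E)%E.
Proof.
move=> t0T ib mg b0 g0; have /andP[t0 tT] := t0T.
rewrite econv_extend_norm//.
have mbt : measurable_fun (`[0, t] : set (measurableTypeR R)) (fun s => b (t - s)).
  apply/measurable_EFinP.
  exact: (measurable_int mu (kernel_integrable_reflect T b ib t tT)).
have mgt : measurable_fun (`[0, t] : set (measurableTypeR R)) g.
  by apply: measurable_funS mg => //; apply: subset_itvl; rewrite bnd_simp.
apply: ae_eq_integral => //.
- by apply/measurable_EFinP; apply: measurable_funM; exact: measurableT_comp.
- by apply/measurable_EFinP; exact: measurable_funM.
- apply: ae_impl2 (kernel_ge0_reflect T b b0 t tT) g0 => s hb hg.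
  rewrite /= in_itv/= => /andP[s0 st].
  by rewrite !ger0_norm ?hb ?hg// s0 ?(le_trans st).
Qed.

Lemma econv_extend_norm_cont T b (g : R -> R) t : 0 <= t <= T ->
  mu.-integrable `[0, T] (EFin \o b) -> continuous g ->
  {ae mu, forall s, 0 <= s <= T -> 0 <= b s} ->
  (forall s, 0 <= s <= T -> 0 <= g s) ->
  econv (extend_norm T b) (extend_norm T g) t = (convolution b g t)%:E.
Proof.
move=> t0T ib cg b0 g0; have /andP[t0 tT] := t0T.
rewrite econv_extend_normE//; last 2 first.
- exact: measurable_funTS (continuous_measurable_fun cg).
- by apply: aeW.
rewrite /convolution /Rintegral fineK//.
have := conv_integrable T b ib t g tT cg.
by move/integrable_fin_num; apply.
Qed.

(** Convolving with the constant 1 returns the total integral, so by [econvA] the integral of the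
    convolution is the product of the two integrals, hence finite. *)
Lemma ae_finite_econv T (b g : R -> R) :
  mu.-integrable `[0, T] (EFin \o b) -> mu.-integrable `[0, T] (EFin \o g) ->
  {ae mu, forall t, econv (extend_norm T b) (extend_norm T g) t \is a fin_num}.
Proof.
move=> ib ig.
have mE h : mu.-integrable `[0, T] (EFin \o h) ->
    measurable_fun setT (extend_norm T h).
  move=> ih; apply: measurable_extend_norm; apply/measurable_EFinP.
  exact: (measurable_int mu ih).
have fE h : mu.-integrable `[0, T] (EFin \o h) ->
    (\int[mu]_s extend_norm T h s < +oo)%E.
  move=> /integrableP[_]; rewrite integral_mkcond; apply: le_lt_trans.
  rewrite le_eqVlt; apply/orP; left; apply/eqP; apply: eq_integral => s _.
  by rewrite /extend_norm !patchE.
have e0 h s := extend_norm_ge0 T h s.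
have one x : (0 <= cst 1 x :> \bar R)%E by rewrite lee_fin.
have int1 (h : R -> \bar R) t : measurable_fun setT h -> (forall x, 0 <= h x)%E ->
    econv h (cst 1%E) t = (\int[mu]_s h s)%E.
  move=> mh h0; rewrite -(ge0_integral_reflect t h)//.
  by apply: eq_integral => s _; rewrite mule1.
set F := econv _ _.
have mF : measurable_fun setT F.
  by apply: measurable_econv => //; exact: mE.
have F0 x : (0 <= F x)%E by apply: econv_ge0.
have Fi : mu.-integrable setT F.
  apply/integrableP; split => //.
  rewrite (_ : (\int[mu]_x `|F x|)%E = (\int[mu]_x F x)%E); last first.
    by apply: eq_integral => x _; rewrite gee0_abs.
  rewrite -(int1 _ 0 mF F0) -econvA//; [|exact: mE|exact: mE].
  have -> : econv (extend_norm T g) (cst 1%E) =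
      cst (\int[mu]_s extend_norm T g s)%E.
    by apply/funext => t; rewrite int1//; exact: mE.
  have c0 : (0 <= \int[mu]_s extend_norm T g s)%E by apply: integral_ge0.
  rewrite /econv ge0_integralZr//.
    rewrite (ge0_integral_reflect 0 (extend_norm T b))//; last exact: mE.
    apply: lte_mul_pinfty; [exact: integral_ge0| |exact: fE].
    rewrite ge0_fin_numE//; [exact: fE|exact: integral_ge0].
  by apply: (measurableT_comp (mE _ ib)); exact: measurable_reflect.
have := integrable_ae measurableT Fi.
by apply: ae_impl => s; apply.
Qed.

(** The solution is [r * f]: convolving [r + m (a * r) = a] with [f] gives its equation.
    Associativity is taken from [econvA], after passing to the nonnegative extensions. *)
Lemma resolvent_kernel_solution T m (a r f : R -> R) : 0 <= T -> 0 <= m ->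
  mu.-integrable `[0, T] (EFin \o a) -> mu.-integrable `[0, T] (EFin \o r) ->
  {ae mu, forall t, 0 <= t <= T -> 0 <= a t} ->
  {ae mu, forall t, 0 <= t <= T -> 0 <= r t} ->
  {ae mu, forall t, 0 <= t <= T -> r t + m * convolution a r t = a t} ->
  continuous f -> (forall t, 0 <= f t) ->
  exists q : R -> R, [/\ continuous q, forall t, 0 <= q t &
    forall t, 0 <= t <= T -> q t + m * convolution a q t = convolution a f t].
Proof.
move=> T0 m0 ia ir a0 r0 eqr cf f0.
pose q := fun t => convolution r f (clamp T t).
have cq : continuous q by apply: continuous_clamp => //; exact: conv_continuous.
have q0 t : 0 <= q t.
  have /andP[_ cT] := clamp_itv T t T0.
  by apply: (conv_ge0 T r).
exists q; split => // t t0T; have /andP[t0 tT] := t0T.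
apply: EFin_inj; rewrite EFinD EFinM.
have mE h : mu.-integrable `[0, T] (EFin \o h) ->
    measurable_fun setT (extend_norm T h).
  move=> ih; apply: measurable_extend_norm; apply/measurable_EFinP.
  exact: (measurable_int mu ih).
have mf : measurable_fun setT (extend_norm T f).
  apply: measurable_extend_norm.
  exact: measurable_funTS (continuous_measurable_fun cf).
have e0 h s := extend_norm_ge0 T h s.
have Erf s : 0 <= s <= T ->
    econv (extend_norm T r) (extend_norm T f) s = (q s)%:E.
  by move=> s0T; rewrite econv_extend_norm_cont// /q clamp_id.
have E0 b g s : s < 0 -> econv (extend_norm T b) (extend_norm T g) s = 0%E.
  move=> s0; rewrite /econv integral0_eq// => u _.
  have [u0|u0] := ltP u 0.
    by rewrite [X in (_ * X)%E]extend_norm_out ?mule0// negb_and -!ltNge u0.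
  rewrite extend_norm_out ?mul0e// negb_and -!ltNge; apply/orP; left; lra.
have -> : (convolution a q t)%:E = econv (extend_norm T a)
    (econv (extend_norm T r) (extend_norm T f)) t.
  rewrite -(@econv_extend_norm_cont T)//; apply: eq_integral => s _.
  have [s0|s0] := ltP s 0.
    by rewrite E0// [X in (_ * X)%E]extend_norm_out ?negb_and -?ltNge ?s0.
  have [sT|sT] := leP s T.
    by rewrite Erf ?s0// (extend_norm_in T q) ?s0// ger0_norm.
  rewrite extend_norm_out ?mul0e// negb_and -!ltNge; apply/orP; left; lra.
rewrite econvA//; [|exact: mE|exact: mE].
rewrite -(Erf t)// -(@econv_extend_norm_cont T a)//.
set Ear := econv (extend_norm T a) (extend_norm T r); rewrite /econv.
set Ea := extend_norm T a; set Er := extend_norm T r; set Ef := extend_norm T f.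
have mEa : measurable_fun setT Ea by exact: mE.
have mEr : measurable_fun setT Er by exact: mE.
have mar : measurable_fun setT Ear.
  by apply: measurable_econv => //; exact: e0.
have ar0 s : (0 <= Ear s)%E by apply: econv_ge0; exact: e0.
have mr (g : R -> \bar R) : measurable_fun setT g ->
    measurable_fun [set: R] (fun s : R => g (t - s)).
  by move=> mg; apply: (measurableT_comp mg); exact: measurable_reflect.
have mc (g : R -> \bar R) : measurable_fun setT g ->
    measurable_fun [set: R] (fun s : R => (g (t - s)%R * Ef s)%E).
  by move=> mg; apply: emeasurable_funM => //; exact: mr.
rewrite -ge0_integralZl ?lee_fin//; last 2 first.
- exact: mc.
- by move=> s _; exact: (mule_ge0 (ar0 _) (e0 _ _)).
rewrite -ge0_integralD//; last 4 first.
- by move=> s _; exact: (mule_ge0 (e0 _ _) (e0 _ _)).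
- exact: mc.
- move=> s _; apply: mule_ge0; first by rewrite lee_fin.
  exact: (mule_ge0 (ar0 _) (e0 _ _)).
- by apply: measurable_funeM; exact: mc.
apply: ae_eq_integral => //.
- apply: emeasurable_funD; first exact: mc.
  by apply: measurable_funeM; exact: mc.
- exact: mc.
(* [convolution a r] is real through [fine], so the kernel equation transfers to [econv] only where
   the extended convolution is finite, that is almost everywhere. *)
have fin := ae_reflect t _ (ae_finite_econv T a r ia ir).
have eqt := ae_reflect t _ eqr.
have at0 := ae_reflect t _ a0.
have rt0 := ae_reflect t _ r0.
have := ae_impl2 _ _ _ (fun s x y => conj x y) at0 rt0.
apply: ae_impl2 (ae_impl2 _ _ _ (fun s x y => conj x y) fin eqt).
move=> s [] {}fin {}eqt [] {}at0 {}rt0 _.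
have [ts|ts] := ltP (t - s) 0.
  by rewrite /Ear E0// /Er /Ea !extend_norm_out ?negb_and -?ltNge ?ts// !mul0e mule0 adde0.
have [s0|s0] := ltP s 0.
  by rewrite /Ef extend_norm_out ?negb_and -?ltNge ?s0// !mule0 adde0.
have tsT : 0 <= t - s <= T by apply/andP; split; lra.
move: fin; rewrite /Ear econv_extend_normE//; last first.
  by apply/measurable_EFinP; exact: (measurable_int mu ir).
move=> fin; rewrite -(fineK fin) -/(Rintegral _ _ _) -/(convolution a r (t - s)).
rewrite /Er /Ea !extend_norm_in// !ger0_norm ?at0 ?rt0//.
rewrite /Ef extend_norm_in; last by apply/andP; split; lra.
by rewrite -eqt// -!EFinM -EFinD; congr EFin; ring.
Qed.

End ResolventKernel.

(** * Scalar Volterra equations *)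

Section CompletelyPositiveKernel.
Context {R : realType}.
Local Notation mu := (@lebesgue_measure R).
Variable a : R -> R.
Hypotheses (ha : loc_integrable a) (hcp : completely_positive a).

Lemma kernel_integrable t : mu.-integrable `[0, t] (EFin \o a).
Proof.
apply: (kernel_integrableS (Num.max t 1) a); last by rewrite le_max lexx.
by apply: ha; rewrite lt_max ltr01 orbT.
Qed.

(** For the parameter 0 the equation for [r] reads [r = a] almost everywhere. *)
Lemma kernel_ae_ge0 t : {ae mu, forall s, 0 <= s <= t -> 0 <= a s}.
Proof.
have T0 : 0 < Num.max t 1 by rewrite lt_max ltr01 orbT.
have [_ /(_ 0 (lexx _))[s [r [_ [_ eqr r0]]]]] := hcp _ T0.
apply: ae_impl2 eqr r0 => u eqr r0 /andP[u0 ut].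
have uT : 0 <= u <= Num.max t 1 by rewrite u0 le_max ut.
by move: (eqr uT) (r0 uT); rewrite mul0r addr0 => ->.
Qed.

Let ia := kernel_integrable.
Let a0 := kernel_ae_ge0.

Lemma continuous_exp_rate (w : R) : continuous (fun s : R => expR (w * s)).
Proof.
apply: (continuous_comp_fun (fun s => w * s) expR) => s.
  by apply: cvgM; [exact: cvg_cst|exact: cvg_id].
exact: continuous_expR.
Qed.

Lemma continuous_normr_fun (f : R -> R) :
  continuous f -> continuous (fun s => `|f s|).
Proof. by move=> cf; apply: continuous_comp_fun => //; exact: norm_continuous. Qed.

Lemma continuousZ_fun (c : R) (f : R -> R) :
  continuous f -> continuous (fun s => c * f s).
Proof. by move=> cf s; apply: cvgM; [exact: cvg_cst|exact: cf]. Qed.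

Lemma continuousD_fun (f g : R -> R) :
  continuous f -> continuous g -> continuous (fun s => f s + g s).
Proof. by move=> cf cg s; apply: cvgD; [exact: cf|exact: cg]. Qed.

Lemma continuous_shift (d : R) (f : R -> R) :
  continuous f -> continuous (fun s => f (s + d)).
Proof.
move=> cf; apply: (continuous_comp_fun (fun s => s + d) f) => // s.
by apply: cvgD; [exact: cvg_id|exact: cvg_cst].
Qed.

(** After reflection the difference is [\int_(t-d)^t a(s) h(t - s) ds], where [t - s] runs through
    [[0, d]]: the sign of [h] on that window decides. *)
Lemma conv_tail_ge0 t d (h : R -> R) : 0 <= d <= t -> continuous h ->
  (forall v, 0 <= v <= d -> 0 <= h v) ->
  convolution a (fun s => h (s + d)) (t - d) <= convolution a h t.
Proof.
move=> /andP[d0 dt] ch h0; rewrite -subr_ge0.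
rewrite (conv_reflect t a (ia t) t h)// (conv_reflect t a (ia t) (t - d))//; last 2 first.
- lra.
- exact: continuous_shift.
have ig : mu.-integrable `[0, t] (EFin \o (fun s => a s * h (t - s))).
  apply: (integrable_mul_continuous _ a (fun s => h (t - s)) 0 t) => //.
  exact: continuous_comp_fun (continuous_reflect t) ch.
have -> : \int[mu]_(s in `[0, t - d]) (a s * h (t - d - s + d)) =
    \int[mu]_(s in `[0, t - d]) (a s * h (t - s)).
  by apply: eq_Rintegral => s _; congr (_ * h _); ring.
rewrite (Rintegral_itvB ig) ?bnd_simp; [|lra|lra].
have sub : `](t - d), t] `<=` `[0, t].
  by move=> s /=; rewrite !in_itv/= => /andP[s1 s2]; apply/andP; split; lra.
have igd : mu.-integrable `](t - d), t] (EFin \o (fun s => a s * h (t - s))).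
  exact: integrableS ig.
rewrite /Rintegral; apply: fine_ge0.
have -> : (\int[mu]_(s in `](t - d)%R, t]) (a s * h (t - s))%:E =
    \int[mu]_(s in `](t - d)%R, t]) `|a s * h (t - s)|%:E)%E; last first.
  by apply: integral_ge0 => s _; rewrite lee_fin.
apply: ae_eq_integral => //.
- exact: (measurable_int mu igd).
- exact: (measurable_int mu (integrable_norm igd)).
- apply: ae_impl (a0 t) => s h1; rewrite /= in_itv/= => /andP[s1 s2].
  by rewrite ger0_norm// mulr_ge0 ?h1 ?h0//; apply/andP; split; lra.
Qed.

Lemma conv1_small e : 0 < e -> exists2 d, 0 < d &
  forall t, 0 <= t <= d -> convolution a (fun=> 1) t <= e.
Proof.
move=> e0; have c1 : continuous (fun _ : R => 1 : R) by move=> ?; exact: cvg_cst.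
have := conv_continuous 1 a (ia 1) (fun=> 1) ler01 c1.
move/subspace_continuousP => /(_ 0); rewrite /= in_itv/= lexx ler01 => /(_ isT).
move/cvgrPdist_lt => /(_ _ e0); rewrite near_withinE => -[d /= d0 hd].
exists (Num.min (d / 2) 1) => [|t /andP[t0]]; first by rewrite lt_min ltr01 divr_gt0.
rewrite le_min => /andP[td t1].
have := hd t; rewrite /ball_/= in_itv/= t0 t1 => /(_ _ isT).
rewrite /from_subspace.
have -> : convolution a (fun=> 1) 0 = 0 by rewrite /convolution set_itv1 Rintegral_set1.
rewrite !sub0r !normrN => h; apply: ltW; apply: le_lt_trans (ler_norm _) _; apply: h.
by rewrite ger0_norm//; lra.
Qed.

(* On [0, d] the scalar solution [s] for the parameter [m = 16 c] is at least
   1/2, while [a * s <= 1/m]: every window of length [d] carries little mass. *)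
Lemma exp_rate_exists c : 0 < c -> exists2 w, 0 <= w & forall t, 0 <= t ->
  c * convolution a (fun s => expR (w * s)) t <= expR (w * t) / 2.
Proof.
(* The proof ends with [c * C t <= c * 2 * (4 / m) * expR (w * t)]; 16 brings the factor down to
   1/2. *)
move=> c0; pose m := 16 * c; have m0 : 0 < m by rewrite /m mulr_gt0.
have [d d0 hd] := conv1_small (2 * m)^-1 ltac:(by rewrite invr_gt0 mulr_gt0).
pose w := ln 2 / d; have w0 : 0 <= w by rewrite divr_ge0 ?ln_ge0 ?(ltW d0)// ler1n.
have wd : expR (w * d) = 2 by rewrite /w divfK ?gt_eqF// lnK// posrE.
have cw := continuous_exp_rate w.
have S t : 0 < t -> exists s : R -> R, [/\ continuous s,
    forall v, 0 <= v -> 0 <= s v, forall v, 0 <= v <= t -> v <= d -> 2^-1 <= s v &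
    m * convolution a s t <= 1].
  move=> t0; have [_ /(_ m (ltW m0))[s [_ [[cs eqs s0] _]]]] := hcp _ t0.
  have cs' := continuous_clamp s t (ltW t0) cs.
  have cE v : 0 <= v <= t -> convolution a (fun u => s (clamp t u)) v
      = convolution a s v.
    move=> /andP[v0 vt]; apply: eq_conv => u /andP[u0 uv].
    by rewrite clamp_id// u0 (le_trans uv).
  have s0' v : 0 <= s (clamp t v) by apply: s0; exact: clamp_itv (ltW t0).
  have conv0 v : 0 <= v <= t -> 0 <= convolution a (fun u => s (clamp t u)) v.
    by move=> /andP[v0 vt]; apply: (conv_ge0 v a).
  have eqs' v : 0 <= v <= t ->
      s (clamp t v) = 1 - m * convolution a (fun u => s (clamp t u)) v.
    by move=> v0t; rewrite cE// clamp_id// -(eqs v v0t); ring.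
  have s1 v : 0 <= v <= t -> s (clamp t v) <= 1.
    by move=> v0t; rewrite eqs'// gerBl mulr_ge0 ?conv0// ltW.
  exists (fun u => s (clamp t u)); split => //.
  - move=> v v0t vd; have /andP[v0 vt] := v0t; rewrite eqs'//.
    have : convolution a (fun u => s (clamp t u)) v <= (2 * m)^-1.
      apply: le_trans (hd v _); last by rewrite v0.
      apply: (conv_le v a) => //; first by move=> ?; exact: cvg_cst.
      by move=> u /andP[u0 uv]; apply: s1; rewrite u0 (le_trans uv).
    move=> /(ler_wpM2l (ltW m0)).
    have -> : m * (2 * m)^-1 = 2^-1 by field; rewrite gt_eqF.
    lra.
  - have tt : 0 <= t <= t by rewrite lexx ltW.
    by have := s0' t; rewrite eqs'//; lra.
pose C t := convolution a (fun s => expR (w * s)) t.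
pose k := 4 / m; have k0 : 0 < k by rewrite /k divr_gt0.
have e1 t : 0 <= t -> 1 <= expR (w * t) by move=> t0; rewrite -expR0 ler_expR mulr_ge0.
(* On the first window [expR (w * v) <= 2 <= 4 * s v], since [w] is chosen with
   [expR (w * d) = 2]. *)
have base t : 0 < t -> exists s : R -> R, [/\ continuous s,
    forall v, 0 <= v -> 0 <= s v, forall v, 0 <= v <= t -> v <= d ->
      expR (w * v) <= 4 * s v & convolution a (fun v => 4 * s v) t <= k].
  move=> t0; have [s [cs s0 s2 s1]] := S t t0; exists s; split => //.
    move=> v v0t vd; have := s2 v v0t vd.
    have : expR (w * v) <= 2 by rewrite -wd ler_expR ler_wpM2l.
    lra.
  rewrite (convZ t a)// /k ler_pdivlMr// -mulrA -[leRHS]mulr1 ler_wpM2l//.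
  by rewrite mulrC.
(* Applied to [4 s - expR (w _)], [conv_tail_ge0] gives the recurrence [C t <= k + 2 * C (t - d)];
   the summand [- k] in the claim makes it inductive. *)
have main j t : 0 <= t <= j%:R * d -> C t <= 2 * k * expR (w * t) - k.
  elim: j t => [|j IH] t.
    rewrite mul0r => h; have -> : t = 0 by apply/eqP; rewrite eq_le andbC.
    by rewrite /C /convolution set_itv1 Rintegral_set1 mulr0 expR0; lra.
  rewrite -natr1 => /andP[t0 tj].
  have kt : k <= k * expR (w * t) by rewrite ler_pMr// e1.
  move: t0; rewrite le_eqVlt => /predU1P[t0|t0].
    by rewrite /C -t0 /convolution set_itv1 Rintegral_set1 mulr0 expR0; lra.
  have [s [cs s0 s2 s1]] := base t t0.
  have [td|td] := leP t d.
    apply: (@le_trans _ _ k); last lra.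
    apply: le_trans s1; apply: (conv_le t a) => //; first exact: continuousZ_fun.
    by move=> v v0t; apply: s2 => //; case/andP: v0t => _ /le_trans; exact.
  have ctd : C (t - d) <= 2 * k * expR (w * (t - d)) - k.
    by apply: IH; apply/andP; split; lra.
  have dt : 0 <= d <= t by rewrite !ltW.
  have c4 : continuous (fun v => 4 * s v) by exact: continuousZ_fun.
  pose h v := 4 * s v + -1 * expR (w * v).
  have ch : continuous h by apply: continuousD_fun => //; exact: continuousZ_fun.
  have h0 v : 0 <= v <= d -> 0 <= h v.
    move=> /andP[v0 vd]; have := s2 v; rewrite v0 vd (le_trans vd (ltW td)).
    by move=> /(_ isT isT); rewrite /h; lra.
  have cn : continuous (fun v => -1 * expR (w * v)) by exact: continuousZ_fun.
  have cn' := continuous_shift d _ cn.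
  have c4' := continuous_shift d _ c4.
  have tdt : t - d <= t by lra.
  have cw' := continuous_shift d _ cw.
  have := conv_tail_ge0 t d h dt ch h0.
  rewrite (convD t a (ia t) t _ _ (lexx t) c4 cn).
  rewrite (convZ t a (ia t) t _ _ (lexx t) cw).
  rewrite (convD t a (ia t) (t - d) _ _ tdt c4' cn').
  rewrite (convZ t a (ia t) (t - d) _ _ tdt cw').
  have -> : convolution a (fun s0 => expR (w * (s0 + d))) (t - d) = 2 * C (t - d).
    rewrite -(convZ t a (ia t) (t - d) _ _ tdt cw); apply: eq_conv => v _.
    by rewrite mulrDr expRD wd mulrC.
  have : 0 <= convolution a (fun v => 4 * s (v + d)) (t - d).
    apply: (conv_ge0 (t - d) a) => // v /andP[v0 _].
    by rewrite mulr_ge0 ?s0// addr_ge0// ltW.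
  rewrite -/(C t) => p1 p2.
  have -> : expR (w * t) = 2 * expR (w * (t - d)).
    by rewrite -wd -expRD; congr expR; ring.
  lra.
exists w => // t t0.
have : C t <= 2 * k * expR (w * t).
  apply: (@le_trans _ _ (2 * k * expR (w * t) - k)); last lra.
  apply: (main (Num.truncn (t / d)).+1); rewrite t0 -ler_pdivrMr//.
  exact/ltW/truncnS_gt.
move=> /(ler_wpM2l (ltW c0)) /le_trans; apply.
by rewrite /k /m le_eqVlt; apply/orP; left; apply/eqP; field; rewrite gt_eqF.
Qed.

(** At a maximum of [f t * expR (- w * t)] on [[0, T]], with value [X], the two bounds give
    [X <= K + X / 2]. *)
Lemma volterra_gronwall T c K w (f : R -> R) : 0 <= c -> 0 <= T ->
  (forall t, 0 <= t -> c * convolution a (fun s => expR (w * s)) t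
     <= expR (w * t) / 2) ->
  continuous f -> (forall t, 0 <= t <= T -> 0 <= f t) ->
  (forall t, 0 <= t <= T -> f t <= K * expR (w * t) + c * convolution a f t) ->
  forall t, 0 <= t <= T -> f t <= 2 * K * expR (w * t).
Proof.
move=> c0 T0 hw cf f0 hf.
have cphi : continuous (fun s => f s * expR ((- w) * s)).
  by move=> s; apply: cvgM; [exact: cf|exact: continuous_exp_rate].
have [t0 t0T tmax] := EVT_max T0 (continuous_subspaceT cphi).
move: t0T; rewrite in_itv/= => t0T; have /andP[t00 _] := t0T.
set X := f t0 * expR (- w * t0) in tmax.
have ew s : expR (- w * s) * expR (w * s) = 1.
  by rewrite -expRD mulNr addNr expR0.
have fX s : 0 <= s <= T -> f s <= X * expR (w * s).
  move=> sT; have := tmax s; rewrite in_itv/= => /(_ sT).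
  by move=> /(ler_wpM2r (expR_ge0 (w * s))); rewrite -mulrA ew mulr1.
have ft0 : f t0 = X * expR (w * t0) by rewrite /X -mulrA ew mulr1.
have X0 : 0 <= X by rewrite /X mulr_ge0 ?f0// expR_ge0.
have XK : X <= 2 * K.
  have := hf t0 t0T; rewrite ft0.
  have : convolution a f t0 <= X * convolution a (fun s => expR (w * s)) t0.
    rewrite -(convZ t0 a)//; last exact: continuous_exp_rate.
    apply: (conv_le t0 a) => //; first exact/continuousZ_fun/continuous_exp_rate.
    by move=> s /andP[s0 st]; apply: fX; rewrite s0 (le_trans st)//; case/andP: t0T.
  move=> /(ler_wpM2l c0); rewrite mulrCA => h1.
  have h2 := ler_wpM2l X0 (hw t0 t00).
  move=> h3; have : X * expR (w * t0) <= 2 * K * expR (w * t0) by lra.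
  by rewrite ler_pM2r// expR_gt0.
by move=> t tT; apply: le_trans (fX t tT) _; rewrite ler_wpM2r// expR_ge0.
Qed.

(** This is the Gronwall bound with [K = 0] for the absolute value of the difference; [m + 1] stands
    in for [m] because [exp_rate_exists] asks for a positive constant. *)
Lemma volterra_unique T m (f g : R -> R) : 0 <= m -> 0 <= T ->
  continuous f -> continuous g ->
  (forall t, 0 <= t <= T ->
    f t + m * convolution a f t = g t + m * convolution a g t) ->
  forall t, 0 <= t <= T -> f t = g t.
Proof.
move=> m0 T0 cf cg fg t tT.
have m1 : 0 < m + 1 by rewrite ltr_wpDl.
have [w w0 hw] := exp_rate_exists (m + 1) m1.
pose d t := f t + -1 * g t.
have cNg : continuous (fun s => -1 * g s) by exact: continuousZ_fun.
have cd : continuous d by exact: continuousD_fun.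
have cnd : continuous (fun s => `|d s|) by exact: continuous_normr_fun.
have dd s : 0 <= s <= T -> `|d s| <= 0 * expR (w * s) +
    (m + 1) * convolution a (fun u => `|d u|) s.
  move=> sT; rewrite mul0r add0r.
  have -> : d s = - m * convolution a d s.
    by rewrite /d (convD s a)// (convZ s a)//; have := fg s sT; lra.
  have n0 : 0 <= convolution a (fun u => `|d u|) s by apply: (conv_ge0 s a).
  rewrite normrM normrN (ger0_norm m0) mulrDl mul1r.
  apply: ler_wpDr => //; rewrite ler_wpM2l//.
  exact: (conv_norm s a).
have := volterra_gronwall T (m + 1) 0 w _ (ltW m1) T0 hw cnd (fun _ _ => normr_ge0 _) dd t tT.
rewrite mulr0 mul0r normr_le0 => /eqP; rewrite /d; lra.
Qed.

(** Solutions on [[0, i + 1]] agree where both are defined, by [volterra_unique]; near each [t] the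
    glued function is a single one of them, hence continuous. *)
Lemma volterra_glue m (g : R -> R) : 0 <= m ->
  (forall T, 0 < T -> exists q : R -> R, [/\ continuous q, forall t, 0 <= q t &
    forall t, 0 <= t <= T -> q t + m * convolution a q t = g t]) ->
  exists q : R -> R, [/\ continuous q, forall t, 0 <= q t &
    forall t, 0 <= t -> q t + m * convolution a q t = g t].
Proof.
move=> m0 H.
have {H}/choice[Q HQ] : forall i : nat, exists q : R -> R, [/\ continuous q,
    forall t, 0 <= q t &
    forall t, 0 <= t <= i.+1%:R -> q t + m * convolution a q t = g t].
  by move=> i; apply: H; rewrite ltr0n.
have QQ i j t : 0 <= t -> t <= i.+1%:R -> t <= j.+1%:R -> Q i t = Q j t.
  move=> t0 ti tj; have [ci _ ei] := HQ i; have [cj _ ej] := HQ j.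
  apply: (volterra_unique t m) => //; last by rewrite t0 lexx.
  move=> s /andP[s0 st]; rewrite ei ?ej// s0.
    by rewrite (le_trans st tj).
  by rewrite (le_trans st ti).
pose q t := Q (Num.truncn (Num.max t 0)) (Num.max t 0).
have qE i t : t <= i.+1%:R -> q t = Q i (Num.max t 0).
  move=> ti; apply: QQ; first by rewrite le_max lexx orbT.
    exact/ltW/truncnS_gt.
  by rewrite ge_max ti ler0n.
exists q; split.
- move=> t; pose i := Num.truncn (Num.max t 0 + 1).
  have [ci _ _] := HQ i.
  have : {for t, continuous (fun s : R => Q i (Num.max s 0))}.
    apply: (continuous_comp_fun (fun u => Num.max u 0) (Q i)) => // u.
    by apply: continuous_max; [exact: cvg_id|exact: cvg_cst].
  rewrite /prop_for /continuous_at -(qE i); last first.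
    apply: le_trans (ltW (truncnS_gt _)).
    by rewrite ler_wpDr// le_max lexx.
  apply: cvg_trans; apply: near_eq_cvg.
  near=> s; rewrite (qE i)//.
  apply: le_trans (ltW (truncnS_gt _)).
  have : s <= t + 1.
    by near: s; exists 1 => //= y; rewrite /ball_/= ltr_norml => /andP[]; lra.
  move/le_trans; apply; rewrite lerD2r.
  by rewrite le_max lexx.
- by move=> t; have [_ + _] := HQ (Num.truncn (Num.max t 0)); apply.
- move=> t t0; pose i := Num.truncn t.
  have ti : t <= i.+1%:R by exact/ltW/truncnS_gt.
  have [_ _ ei] := HQ i.
  rewrite (qE i)// max_l// -ei ?t0//; congr (_ + _ * _).
  apply: eq_conv => s /andP[s0 st].
  by rewrite (qE i) ?max_l// (le_trans st).
Unshelve. all: by end_near. Qed.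

Lemma scalar_solution m : 0 <= m -> exists q : R -> R, [/\ continuous q,
  forall t, 0 <= q t & forall t, 0 <= t -> q t + m * convolution a q t = 1].
Proof.
move=> m0; apply: volterra_glue => // T T0.
have [_ /(_ m m0)[s [_ [[cs eqs s0] _]]]] := hcp _ T0.
exists (fun t => s (clamp T t)); split.
- exact: continuous_clamp (ltW T0) cs.
- by move=> t; apply: s0; exact: clamp_itv (ltW T0).
- move=> t tT; rewrite -(eqs t tT) clamp_id//; congr (_ + _ * _).
  apply: eq_conv => u /andP[u0 ut]; rewrite clamp_id// u0 (le_trans ut)//.
  by case/andP: tT.
Qed.

Lemma convolution_solution m (f : R -> R) : 0 <= m -> continuous f ->
  (forall t, 0 <= f t) -> exists q : R -> R, [/\ continuous q,
  forall t, 0 <= q t &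
  forall t, 0 <= t -> q t + m * convolution a q t = m * convolution a f t].
Proof.
move=> m0 cf f0; apply: volterra_glue => // T T0.
have [_ /(_ m m0)[_ [r [_ [ir eqr r0]]]]] := hcp _ T0.
have [q [cq q0 eqq]] := resolvent_kernel_solution T m a r f (ltW T0) m0 (ia T)
  ir (a0 T) r0 eqr cf f0.
exists (fun t => m * q t); split.
- exact: continuousZ_fun.
- by move=> t; rewrite mulr_ge0.
- by move=> t tT; rewrite (convZ t a)// -(eqq t tT) mulrDr.
Qed.

End CompletelyPositiveKernel.

(** * The weights and their generating functions *)

Section Weights.
Context {R : realType}.
Local Notation mu := (@lebesgue_measure R).
Variable a : R -> R.
Hypotheses (ha : loc_integrable a) (hcp : completely_positive a).

Let ia := kernel_integrable a ha.
Let a0 := kernel_ae_ge0 a hcp.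

(* The generating function [\sum_k z ^+ k * p k] solves
   [u = 1 + N (z - 1) (a * u)] on [0, +oo[. *)
Definition weights (N : R) (p : nat -> R -> R) : Prop :=
  [/\ forall k, continuous (p k), forall k t, 0 <= p k t,
      forall t, 0 <= t -> p 0%N t + N * convolution a (p 0%N) t = 1 &
      forall k t, 0 <= t ->
        p k.+1 t + N * convolution a (p k.+1) t = N * convolution a (p k) t].

Lemma weights_exist N : 0 <= N -> exists p, weights N p.
Proof.
move=> N0; have [q0 [cq0 q00 eq0]] := scalar_solution a ha hcp N N0.
(* Continuity and nonnegativity travel with the sequence, since both are used to solve for the next
   weight. *)
pose X := {q : R -> R | continuous q /\ forall t, 0 <= q t}.
pose S (f g : X) := forall t, 0 <= t ->
  sval g t + N * convolution a (sval g) t = N * convolution a (sval f) t.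
have step (f : X) : {g : X | S f g}.
  apply: cid; case: f => f [cf f0].
  have [q [cq q_ge0 eqq]] := convolution_solution a ha hcp N f N0 cf f0.
  by exists (exist _ q (conj cq q_ge0)).
have [p [p0 pS]] := dependent_choice step (exist _ q0 (conj cq0 q00)).
exists (fun k => sval (p k)); split.
- by move=> k; have [] := svalP (p k).
- by move=> k; have [] := svalP (p k).
- by move=> t t0; rewrite p0 eq0.
- by move=> k t t0; exact: pS.
Qed.

Definition gen_fun (p : nat -> R -> R) (z : R) (K : nat) (t : R) : R :=
  \sum_(k < K) z ^+ k * p k t.

Section GenFun.
Variables (N : R) (p : nat -> R -> R).
Hypotheses (N0 : 0 <= N) (hp : weights N p).

Lemma weights_continuous k : continuous (p k).
Proof. by have [] := hp. Qed.

Lemma weights_ge0 k t : 0 <= p k t.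
Proof. by have [] := hp. Qed.

Lemma gen_funS z K : gen_fun p z K.+1 =
  (fun t => gen_fun p z K t + z ^+ K * p K t).
Proof. by apply/funext => t; rewrite /gen_fun big_ord_recr. Qed.

Lemma gen_fun_continuous z K : continuous (gen_fun p z K).
Proof.
elim: K => [|K IH].
  rewrite (_ : gen_fun p z 0 = fun=> 0); first by move=> ?; exact: cvg_cst.
  by apply/funext => t; rewrite /gen_fun big_ord0.
rewrite gen_funS; apply: continuousD_fun => //; apply: continuousZ_fun.
exact: weights_continuous.
Qed.

Lemma gen_fun_ge0 z K t : 0 <= z -> 0 <= gen_fun p z K t.
Proof.
by move=> z0; apply: sumr_ge0 => k _; rewrite mulr_ge0 ?exprn_ge0// weights_ge0.
Qed.

(** Summed against powers of [z], the weight equations telescope up to one boundary term, which for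
    [0 <= z] has the sign that an upper bound may drop. *)
Lemma gen_fun_eq z K t : 0 <= t -> gen_fun p z K.+1 t =
  1 + N * (z - 1) * convolution a (gen_fun p z K.+1) t
    - N * z ^+ K.+1 * convolution a (p K) t.
Proof.
move=> t0; have [cp _ p0 pS] := hp.
elim: K => [|K IH].
  have -> : gen_fun p z 1 = p 0%N.
    by apply/funext => s; rewrite /gen_fun big_ord1 expr0 mul1r.
  by have := p0 t t0; rewrite expr1 => h; lra.
rewrite gen_funS (convD t a)//; last 2 first.
- exact: gen_fun_continuous.
- exact: continuousZ_fun.
rewrite (convZ t a)// {1}IH.
have -> : p K.+1 t = N * convolution a (p K) t - N * convolution a (p K.+1) t.
  by rewrite -(pS K t t0); ring.
by rewrite !exprS; ring.
Qed.

(** Without the boundary term the partial sum is a subsolution with initial value 1. [N] and [z]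
    enter only through [N * (z - 1) <= c], so one rate [w] serves all [n] and [K]. *)
Lemma gen_fun_le z c w K t : 0 <= z -> 0 <= c -> 0 <= w ->
  (forall t, 0 <= t -> c * convolution a (fun s => expR (w * s)) t
     <= expR (w * t) / 2) ->
  N * (z - 1) <= c -> 0 <= t -> gen_fun p z K t <= 2 * expR (w * t).
Proof.
move=> z0 c0 w0 hw zc t0; case: K => [|K].
  by rewrite /gen_fun big_ord0 mulr_ge0 ?expR_ge0.
have cg := gen_fun_continuous z K.+1.
have := volterra_gronwall a ha hcp t c 1 w (gen_fun p z K.+1) c0 t0 hw cg.
rewrite mulr1; apply; last by rewrite t0 lexx.
  by move=> s _; exact: gen_fun_ge0.
move=> s /andP[s0 st]; rewrite gen_fun_eq// mul1r.
have h1 : 0 <= N * z ^+ K.+1 * convolution a (p K) s.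
  rewrite !mulr_ge0 ?exprn_ge0//.
  by apply: (conv_ge0 s a) => //; [exact: weights_continuous|
    move=> u _; exact: weights_ge0].
have h2 : N * (z - 1) * convolution a (gen_fun p z K.+1) s
    <= c * convolution a (gen_fun p z K.+1) s.
  rewrite ler_wpM2r//; apply: (conv_ge0 s a) => // u _; exact: gen_fun_ge0.
have h3 : 1 <= expR (w * s) by rewrite -expR0 ler_expR mulr_ge0.
lra.
Qed.

(** The generating function at [2 z] is bounded on [[0, T]] and dominates each of its terms
    [(2 z)^k p k]; dividing by [2^k] leaves geometric decay. *)
Lemma weights_tail z T : 0 <= z -> 0 <= T -> exists2 C, 0 <= C &
  forall k t, 0 <= t <= T -> z ^+ k * p k t <= C * 2^-1 ^+ k.
Proof.
move=> z0 T0; pose c := `|N * (2 * z - 1)| + 1.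
have c0 : 0 < c by rewrite ltr_wpDl.
have [w w0 hw] := exp_rate_exists a ha hcp c c0.
exists (2 * expR (w * T)); first by rewrite mulr_ge0 ?expR_ge0.
move=> k t /andP[t0 tT].
have z20 : 0 <= 2 * z by rewrite mulr_ge0.
have h1 : (2 * z) ^+ k * p k t <= 2 * expR (w * T).
  apply: (@le_trans _ _ (gen_fun p (2 * z) k.+1 t)).
    by rewrite gen_funS lerDr gen_fun_ge0.
  apply: le_trans (gen_fun_le (2 * z) c w _ _ z20 (ltW c0) w0 hw _ t0) _.
    by rewrite (le_trans (ler_norm _))// lerDl.
  by rewrite ler_wpM2l// ler_expR ler_wpM2l.
have -> : z ^+ k * p k t = ((2 * z) ^+ k * p k t) * 2^-1 ^+ k.
  have h2 : 2 ^+ k * 2^-1 ^+ k = 1 :> R by rewrite -exprMn mulfV// expr1n.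
  have E (x y v q : R) : x * v * q * y = (x * y) * (v * q) by ring.
  by rewrite exprMn E h2 mul1r.
by rewrite ler_wpM2r// exprn_ge0// invr_ge0.
Qed.

End GenFun.

Lemma half_pow_small (D e : R) : 0 < e ->
  exists K0 : nat, forall K, (K0 <= K)%N -> D * 2^-1 ^+ K <= e.
Proof.
move=> e0; have : (2^-1 : R) ^+ n @[n --> \oo] --> 0.
  by apply: cvg_expr; rewrite ger0_norm ?invr_ge0// invf_lt1 ?ltr1n.
move/cvgrPdist_lt => /(_ (e / (`|D| + 1))) [].
  by rewrite divr_gt0// ltr_wpDl.
move=> K0 _ hK; exists K0 => K KK0.
have := hK K KK0; rewrite sub0r normrN ger0_norm ?exprn_ge0 ?invr_ge0//.
rewrite ltr_pdivlMr ?ltr_wpDl// => h.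
apply: le_trans (ltW h); rewrite [leRHS]mulrC ler_wpM2r ?exprn_ge0 ?invr_ge0//.
by rewrite (le_trans (ler_norm _))// lerDl.
Qed.

(** The difference of two partial sums solves a Volterra equation whose source consists of the
    difference of the rates [N (z - 1)] and the two boundary terms. The rates determine [n0]; the
    boundary terms vanish only as [K] grows, at a speed depending on [n] and [m], whence the inner
    [K0]. *)
Lemma gen_fun_cauchy (P : nat -> nat -> R -> R) (z : nat -> R) (g : R) :
  (forall n, weights n.+1%:R (P n)) -> (forall n, 0 <= z n) ->
  (forall e, 0 < e -> exists n0 : nat, forall n, (n0 <= n)%N ->
    `|n.+1%:R * (z n - 1) - g| <= e) ->
  forall T e, 0 <= T -> 0 < e -> exists n0 : nat, forall n m,
    (n0 <= n)%N -> (n0 <= m)%N -> exists K0 : nat, forall K t, (K0 <= K)%N ->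
    0 <= t <= T -> `|gen_fun (P n) (z n) K t - gen_fun (P m) (z m) K t| <= e.
Proof.
move=> hP z0 hz T e T0 e0.
pose c := `|g| + 1; have c1 : 1 <= c by rewrite lerDr.
have c0 : 0 < c by apply: lt_le_trans c1.
have [w w0 hw] := exp_rate_exists a ha hcp c c0.
pose E := expR (w * T); have E0 : 0 < E by exact: expR_gt0.
(* [eta <= 1] keeps both rates below [c] in absolute value; [eta <= e / (8 * E)] limits the
   contribution of their difference to [e / 2]. *)
pose eta := Num.min 1 (e / (8 * E)).
have eta0 : 0 < eta by rewrite lt_min ltr01 divr_gt0// mulr_gt0.
have [n0 hn0] := hz _ eta0; exists n0 => n m /hn0 hn /hn0 hm.
have N0 (i : nat) : 0 <= i.+1%:R :> R by [].
have cle i : `|i.+1%:R * (z i - 1) - g| <= eta -> `|i.+1%:R * (z i - 1)| <= c.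
  move=> h; rewrite -[X in `|X|](subrK g); apply: le_trans (ler_normD _ _) _.
  by rewrite addrC lerD2l (le_trans h)// ge_min lexx.
have [Cn Cn0 hCn] := weights_tail _ _ (N0 n) (hP n) (z n) T (z0 n) T0.
have [Cm Cm0 hCm] := weights_tail _ _ (N0 m) (hP m) (z m) T (z0 m) T0.
(* [D * 2^-1 ^+ K] bounds the sum of the two boundary terms, up to the factor [expR (w * s) / 2]. *)
pose D := n.+1%:R * z n * Cn + m.+1%:R * z m * Cm.
have [K0 hK0] := half_pow_small (D * E) _ (divr_gt0 e0 (ltr0n _ 2)).
exists K0.+1 => -[//|K] t; rewrite ltnS => /hK0 hK tT.
pose u := gen_fun (P n) (z n) K.+1; pose v := gen_fun (P m) (z m) K.+1.
have cu : continuous u by exact: gen_fun_continuous (hP n) _ _.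
have cv : continuous v by exact: gen_fun_continuous (hP m) _ _.
pose d s := u s + -1 * v s.
have cN : continuous (fun s => -1 * v s) by exact: continuousZ_fun.
have cd : continuous d by exact: continuousD_fun.
have cnd : continuous (fun s => `|d s|) by exact: continuous_normr_fun.
have exp0 s : 0 <= s -> convolution a (fun r => expR (w * r)) s <= expR (w * s) / 2.
  move=> s0; apply: le_trans (hw s s0); rewrite ler_peMl//.
  have := conv_ge0 s a (ia s) (a0 s) s _ (lexx s) (continuous_exp_rate w).
  by apply=> r _; exact: expR_ge0.
have rho i s : 0 <= s <= T -> forall C, 0 <= C ->
    (forall k t, 0 <= t <= T -> z i ^+ k * P i k t <= C * 2^-1 ^+ k) ->
    0 <= i.+1%:R * z i ^+ K.+1 * convolution a (P i K) s <=
      i.+1%:R * z i * C * 2^-1 ^+ K * (expR (w * s) / 2).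
  move=> /andP[s0 sT] C C0 hC.
  have cP : continuous (P i K) by have [] := hP i.
  have P0 r : 0 <= P i K r by have [_ + _ _] := hP i; apply.
  apply/andP; split.
    by rewrite !mulr_ge0 ?exprn_ge0//; apply: (conv_ge0 s a).
  rewrite exprS -!mulrA; apply: ler_wpM2l => //; apply: ler_wpM2l => //.
  rewrite -(convZ s a)// mulrA.
  apply: (@le_trans _ _ (convolution a (fun r => C * 2^-1 ^+ K * expR (w * r)) s)).
    apply: (conv_le s a) => //.
    - exact: continuousZ_fun.
    - by apply: continuousZ_fun; exact: continuous_exp_rate.
    move=> r /andP[r0 rs]; apply: le_trans (hC K r _) _; first by rewrite r0 (le_trans rs).
    rewrite ler_peMr ?mulr_ge0 ?exprn_ge0 ?invr_ge0//.
    by rewrite -expR0 ler_expR mulr_ge0.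
  rewrite (convZ s a)//; last exact: continuous_exp_rate.
  by rewrite ler_wpM2l ?exp0// mulr_ge0 ?exprn_ge0 ?invr_ge0.
pose cn := n.+1%:R * (z n - 1); pose cm := m.+1%:R * (z m - 1).
have cnm : `|cn - cm| <= 2 * eta.
  have -> : cn - cm = (cn - g) - (cm - g) by ring.
  apply: le_trans (ler_normB _ _) _.
  by rewrite (_ : 2 * eta = eta + eta) ?lerD//; ring.
pose L := 2 * eta + D * 2^-1 ^+ K / 2.
have key s : 0 <= s <= T ->
    `|d s| <= L * expR (w * s) + c * convolution a (fun r => `|d r|) s.
  move=> sT; have /andP[s0 _] := sT.
  have convd : convolution a d s = convolution a u s - convolution a v s.
    by rewrite /d (convD s a)// (convZ s a)//; ring.
  pose rn := n.+1%:R * z n ^+ K.+1 * convolution a (P n K) s.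
  pose rm := m.+1%:R * z m ^+ K.+1 * convolution a (P m K) s.
  have -> : d s = cn * convolution a d s + (cn - cm) * convolution a v s - rn + rm.
    rewrite /d /u /v (gen_fun_eq _ _ (hP n))// (gen_fun_eq _ _ (hP m))//.
    by rewrite -/u -/v -/d convd -/cn -/cm -/rn -/rm; ring.
  have [rn0 rn1] : 0 <= rn /\
      rn <= n.+1%:R * z n * Cn * 2^-1 ^+ K * (expR (w * s) / 2).
    by apply/andP; exact: rho.
  have [rm0 rm1] : 0 <= rm /\
      rm <= m.+1%:R * z m * Cm * 2^-1 ^+ K * (expR (w * s) / 2).
    by apply/andP; exact: rho.
  have h1 : `|cn * convolution a d s| <= c * convolution a (fun r => `|d r|) s.
    rewrite normrM; apply: ler_pM => //; first exact: cle.
    exact: (conv_norm s a).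
  have v0 : 0 <= convolution a v s.
    by apply: (conv_ge0 s a) => // r _; exact: gen_fun_ge0 (hP m) _ _ _ (z0 m).
  have v1 : convolution a v s <= expR (w * s).
    apply: (@le_trans _ _ (convolution a (fun r => 2 * expR (w * r)) s)).
      apply: (conv_le s a) => //; first by apply: continuousZ_fun; exact: continuous_exp_rate.
      move=> r /andP[r0 _].
      apply: (gen_fun_le _ _ (N0 m) (hP m) _ c w _ _ (z0 m) (ltW c0) w0 hw _ r0).
      by apply: le_trans (ler_norm _) _; exact: cle.
    rewrite (convZ s a)//; last exact: continuous_exp_rate.
    by have := exp0 s s0; lra.
  have h2 : `|(cn - cm) * convolution a v s| <= 2 * eta * expR (w * s).
    by rewrite normrM (ger0_norm v0); apply: ler_pM.
  have h3 := ler_normD (cn * convolution a d s + (cn - cm) * convolution a v s - rn) rm.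
  have h4 := ler_normB (cn * convolution a d s + (cn - cm) * convolution a v s) rn.
  have h5 := ler_normD (cn * convolution a d s) ((cn - cm) * convolution a v s).
  rewrite (ger0_norm rm0) in h3; rewrite (ger0_norm rn0) in h4.
  apply: (le_trans h3); rewrite /L /D.
  move: (expR (w * s)) (2^-1 ^+ K) rn1 rm1 h1 h2 => x y rn1 rm1 h1 h2.
  have -> : (2 * eta + (n.+1%:R * z n * Cn + m.+1%:R * z m * Cm) * y / 2) * x =
      2 * eta * x + n.+1%:R * z n * Cn * y * (x / 2)
      + m.+1%:R * z m * Cm * y * (x / 2) by field.
  move: rn1 rm1; move: (n.+1%:R * z n * Cn * y * (x / 2)) => A.
  move: (m.+1%:R * z m * Cm * y * (x / 2)) => B rn1 rm1.
  lra.
have := volterra_gronwall a ha hcp T c L w _ (ltW c0) T0 hw cnd (fun _ _ => normr_ge0 _) key t tT.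
have -> : d t = u t - v t by rewrite /d; ring.
move/le_trans; apply.
have L0 : 0 <= L.
  by rewrite /L addr_ge0 ?mulr_ge0 ?exprn_ge0 ?invr_ge0 ?(ltW eta0)// addr_ge0 ?mulr_ge0.
apply: (@le_trans _ _ (2 * L * E)).
  rewrite ler_wpM2l ?mulr_ge0// ler_expR ler_wpM2l//; by case/andP: tT.
have hE : eta * E <= e / 8.
  apply: (@le_trans _ _ (e / (8 * E) * E)).
    by rewrite ler_wpM2r ?(ltW E0)// ge_min lexx orbT.
  by rewrite le_eqVlt; apply/orP; left; apply/eqP; field; rewrite gt_eqF.
have -> : 2 * L * E = 4 * (eta * E) + D * E * 2^-1 ^+ K by rewrite /L; field.
lra.
Qed.

Lemma expR_sub1_le (x : R) : expR x - 1 <= x * expR x.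
Proof.
have := expR_ge1Dx (- x); move=> /(ler_wpM2r (expR_ge0 x)).
by rewrite -expRD addNr expR0; lra.
Qed.

(** With [x = g / N] the error is [N (e^x - 1 - x)], at most [2 N x^2 = 2 g^2 / N] once
    [|x| <= 1/2]; the threshold secures both this and the final tolerance. *)
Lemma exp_rate_cvg (g e : R) : 0 < e -> exists n0 : nat, forall n, (n0 <= n)%N ->
  `|n.+1%:R * (expR (g / n.+1%:R) - 1) - g| <= e.
Proof.
move=> e0; exists (Num.truncn (`|g| + 2 * g ^+ 2 / e + `|g|)) => n hn.
pose N : R := n.+1%:R; rewrite -/N; have N0 : 0 < N by rewrite ltr0n.
have Nlt : `|g| + 2 * g ^+ 2 / e + `|g| < N.
  by apply: lt_le_trans (truncnS_gt _) _; rewrite ler_nat.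
have ge0 : 0 <= 2 * g ^+ 2 / e by rewrite divr_ge0 ?(ltW e0)// mulr_ge0// sqr_ge0.
have g0 := normr_ge0 g.
pose x := g / N; have gx : g = N * x by rewrite /x mulrC divfK ?gt_eqF.
have x2 : `|x| <= 2^-1.
  by rewrite /x normrM normfV (gtr0_norm N0) ler_pdivrMr//; lra.
have h1 := expR_ge1Dx x; have h2 := expR_sub1_le x.
have h3 := ler_norm x.
have h0 : 0 <= expR x - 1 - x by lra.
have ex2 : expR x <= 2.
  have h4 : expR x * (1 - x) <= 1 by lra.
  rewrite -ler_pdivlMr in h4; last lra.
  apply: le_trans h4 _; rewrite ler_pdivrMr; lra.
have h5 : expR x - 1 - x <= 2 * x ^+ 2.
  apply: (@le_trans _ _ (x * (expR x - 1))); first lra.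
  have [x0|x0] := leP 0 x.
    rewrite expr2 mulrCA ler_wpM2l//.
    by apply: le_trans h2 _; rewrite mulrC ler_wpM2r.
  rewrite expr2 mulrCA ler_wnM2l ?(ltW x0)//; lra.
have -> : N * (expR x - 1) - g = N * (expR x - 1 - x) by rewrite {1}gx; ring.
rewrite ger0_norm; last by rewrite mulr_ge0// ltW.
apply: (@le_trans _ _ (N * (2 * x ^+ 2))); first by rewrite ler_wpM2l// ltW.
have -> : N * (2 * x ^+ 2) = 2 * g ^+ 2 / N by rewrite /x; field; rewrite gt_eqF.
have : 2 * g ^+ 2 / e < N by lra.
rewrite ltr_pdivrMr// => h6; rewrite ler_pdivrMr//; lra.
Qed.

(** From [e^x - 1 <= x e^x] at [x = g / N <= g]; the bound is uniform in [n]. *)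
Lemma exp_rate_bound (g : R) (n : nat) : 0 <= g ->
  n.+1%:R * (expR (g / n.+1%:R) - 1) <= g * expR g.
Proof.
move=> g0; pose N : R := n.+1%:R; rewrite -/N; have N0 : 0 < N by rewrite ltr0n.
apply: (@le_trans _ _ (N * (g / N * expR (g / N)))).
  by rewrite ler_wpM2l ?(ltW N0)// expR_sub1_le.
rewrite mulrA [N * _]mulrC divfK ?gt_eqF// ler_wpM2l// ler_expR.
by rewrite ler_pdivrMr// ler_peMr// ler1n.
Qed.

End Weights.

(** * Real-valued norm *)

Section RealNorm.
Context {R : realType} {k : scalar_kind}.
Local Notation "c %:K" := (ofR k c) (at level 2, format "c %:K").

Fact ofR_is_zmod_morphism : zmod_morphism (@ofR R k).
Proof. by move=> x y; case: k => //=; exact: raddfB. Qed.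

Fact ofR_is_monoid_morphism : monoid_morphism (@ofR R k).
Proof. by split; case: k => //= x y; exact: rmorphM. Qed.

HB.instance Definition _ := GRing.isZmodMorphism.Build R (scalar_field R k)
  (@ofR R k) ofR_is_zmod_morphism.
HB.instance Definition _ := GRing.isMonoidMorphism.Build R (scalar_field R k)
  (@ofR R k) ofR_is_monoid_morphism.

Lemma ofRK (c : R) : toR k c%:K = c.
Proof. by case: k. Qed.

Lemma ofR_le (c d : R) : (c%:K <= d%:K) = (c <= d).
Proof. by case: k => //=; rewrite lecR. Qed.

Lemma ofR_lt (c d : R) : (c%:K < d%:K) = (c < d).
Proof. by case: k => //=; rewrite ltcR. Qed.

Lemma ofR_toR (z : scalar_field R k) : 0 <= z -> (toR k z)%:K = z.
Proof.
case: k z => //= -[x y] /=; rewrite lecE/= => /andP[/eqP y0 _].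
by rewrite y0.
Qed.

Lemma toR_gt0 (z : scalar_field R k) : 0 < z -> 0 < toR k z.
Proof. by move=> z0; rewrite -ofR_lt ofR_toR ?ltW// rmorph0. Qed.

Lemma normr_ofR (c : R) : `|c%:K| = `|c|%:K.
Proof.
have [c0|c0] := leP 0 c.
  by rewrite !ger0_norm// -(rmorph0 (@ofR R k)) ofR_le.
rewrite (ltr0_norm c0) ltr0_norm ?rmorphN//.
by rewrite -(rmorph0 (@ofR R k)) ofR_lt.
Qed.

Variable B : completeNormedModType (scalar_field R k).
Implicit Types (x y : B) (c : R).

Lemma rnormK x : (rnorm x)%:K = `|x|.
Proof. exact: ofR_toR. Qed.

Lemma rnorm_ge0 x : 0 <= rnorm x.
Proof. by rewrite -ofR_le rnormK rmorph0. Qed.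

Lemma rnormD x y : rnorm (x + y) <= rnorm x + rnorm y.
Proof. by rewrite -ofR_le rmorphD/= !rnormK ler_normD. Qed.

Lemma rnormN x : rnorm (- x) = rnorm x.
Proof. by rewrite /rnorm normrN. Qed.

Lemma rnormB x y : rnorm (x - y) <= rnorm x + rnorm y.
Proof. by rewrite -(rnormN y) rnormD. Qed.

Lemma rnormC x y : rnorm (x - y) = rnorm (y - x).
Proof. by rewrite -rnormN opprB. Qed.

Lemma rnormZ c x : rnorm (c%:K *: x) = `|c| * rnorm x.
Proof. by rewrite -[LHS]ofRK rnormK normrZ normr_ofR -rnormK -rmorphM ofRK. Qed.

Lemma rnorm0 : rnorm (0 : B) = 0.
Proof. by rewrite -[LHS]ofRK rnormK normr0 -(rmorph0 (@ofR R k)) ofRK. Qed.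

Lemma rnorm0_eq0 x : rnorm x <= 0 -> x = 0.
Proof.
move=> x0; apply/eqP; rewrite -normr_eq0 -rnormK.
have -> : rnorm x = 0 by apply/eqP; rewrite eq_le x0 rnorm_ge0.
by rewrite rmorph0.
Qed.

Lemma rnorm_sum (I : Type) (r : seq I) (P : pred I) (F : I -> B) :
  rnorm (\sum_(i <- r | P i) F i) <= \sum_(i <- r | P i) rnorm (F i).
Proof.
elim/big_ind2 : _ => //; first by rewrite rnorm0.
by move=> x1 c1 x2 c2 h1 h2; apply: le_trans (rnormD _ _) _; exact: lerD.
Qed.

Lemma rnorm_le_add x y z : rnorm (x - z) <= rnorm (x - y) + rnorm (y - z).
Proof. by rewrite -(subrKA y x) rnormD. Qed.

Lemma rnorm_leDB x y : rnorm x <= rnorm y + rnorm (x - y).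
Proof. by rewrite -{1}(subrKC y x) rnormD. Qed.

Lemma cvg_rnormP (T : Type) (F : set_system T) (f : T -> B) y : Filter F ->
  f @ F --> y <-> forall e, 0 < e -> \forall t \near F, rnorm (f t - y) < e.
Proof.
move=> FF; split => [/cvgrPdist_lt h e e0|h].
  have : 0 < e%:K by rewrite -(rmorph0 (@ofR R k)) ofR_lt.
  move=> /h; apply: filterS => t.
  by rewrite -rnormK ofR_lt rnormC.
apply/cvgrPdist_lt => e e0; have := h _ (toR_gt0 _ e0).
by apply: filterS => t; rewrite rnormC -ofR_lt rnormK ofR_toR// ltW.
Qed.

Definition rcvg (u : nat -> B) (l : B) : Prop :=
  forall e, 0 < e -> exists n0 : nat, forall n, (n0 <= n)%N -> rnorm (u n - l) <= e.

Lemma rcvgP u l : rcvg u l <-> u @ \oo --> l.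
Proof.
split => [h|/cvg_rnormP h e /h[n0 _ hn]]; last by exists n0 => n /hn/ltW.
apply/cvg_rnormP => e e0; have [n0 hn] := h _ (divr_gt0 e0 (ltr0n _ 2)).
exists n0 => // n /= /hn h1; apply: le_lt_trans h1 _; lra.
Qed.

Lemma rcauchy_rcvg (u : nat -> B) :
  (forall e, 0 < e -> exists n0 : nat, forall n m, (n0 <= n)%N -> (n0 <= m)%N ->
    rnorm (u n - u m) <= e) -> exists l, rcvg u l.
Proof.
move=> h; suff : cvg (u @ \oo) by exists (lim (u @ \oo)); apply/rcvgP.
apply/cauchy_cvgP/cauchy_ballP => e e0.
have [n0 hn] := h _ (divr_gt0 (toR_gt0 _ e0) (ltr0n _ 2)).
exists (u @` [set n | (n0 <= n)%N], u @` [set n | (n0 <= n)%N]) => /=.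
  by split; exists n0 => // n nn0; exists n.
move=> [_ _] [/= [n h1 <-] [m h2 <-]]; rewrite -ball_normE /ball_/= -rnormK -[X in _ < X]ofR_toR ?ltW//.
rewrite ofR_lt; apply: le_lt_trans (hn n m h1 h2) _.
by rewrite ltr_pdivrMr// ltr_pMr ?ltr1n// toR_gt0.
Qed.

Lemma rcvg_le u l C n0 : rcvg u l -> (forall n, (n0 <= n)%N -> rnorm (u n) <= C) ->
  rnorm l <= C.
Proof.
move=> h hC; apply/ler_addgt0Pr => e e0; have [n1 hn] := h _ e0.
have := hn _ (leq_maxr n0 n1); have := hC _ (leq_maxl n0 n1).
have := rnorm_leDB l (u (maxn n0 n1)); rewrite (rnormC l); lra.
Qed.

Lemma rcvg_unique u l l' : rcvg u l -> rcvg u l' -> l = l'.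
Proof.
move=> h h'; apply/eqP; rewrite -subr_eq0; apply/eqP/rnorm0_eq0.
apply/ler_addgt0Pr => e e0; rewrite add0r.
have [n0 hn] := h _ (divr_gt0 e0 (ltr0n _ 2)).
have [n1 hn'] := h' _ (divr_gt0 e0 (ltr0n _ 2)).
have := hn _ (leq_maxl n0 n1); have := hn' _ (leq_maxr n0 n1).
have := rnorm_le_add l (u (maxn n0 n1)) l'.
rewrite (rnormC l (u _)); lra.
Qed.

Lemma rcvg_cst l : rcvg (fun=> l) l.
Proof. by move=> e e0; exists 0%N => n _; rewrite subrr rnorm0 ltW. Qed.

Lemma rcvgD u v l l' : rcvg u l -> rcvg v l' -> rcvg (fun n => u n + v n) (l + l').
Proof. by move=> /rcvgP h /rcvgP h'; apply/rcvgP; exact: cvgD. Qed.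

Lemma rcvgZ (c : scalar_field R k) u l : rcvg u l -> rcvg (fun n => c *: u n) (c *: l).
Proof. by move=> /rcvgP h; apply/rcvgP; exact: cvgZr. Qed.

Lemma rcvgN u l : rcvg u l -> rcvg (fun n => - u n) (- l).
Proof. by move=> /rcvgP h; apply/rcvgP; exact: cvgN. Qed.

Lemma rcvgB u v l l' : rcvg u l -> rcvg v l' -> rcvg (fun n => u n - v n) (l - l').
Proof. by move=> h h'; apply: rcvgD => //; exact: rcvgN. Qed.

Lemma rcvg_shift u l j : rcvg u l -> rcvg (fun n => u (n + j)%N) l.
Proof.
move=> h e /h[n0 hn]; exists n0 => n nn0; apply: hn.
exact: leq_trans nn0 (leq_addr _ _).
Qed.

Lemma rcvg_bounded (L : {linear B -> B}) C u l : 0 <= C ->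
  (forall x, rnorm (L x) <= C * rnorm x) ->
  rcvg u l -> rcvg (fun n => L (u n)) (L l).
Proof.
move=> C0 hL h e e0; have C1 : 0 < C + 1 by rewrite ltr_wpDl.
have [n0 hn] := h _ (divr_gt0 e0 C1); exists n0 => n /hn h1.
rewrite -linearB; apply: le_trans (hL _) _.
apply: (@le_trans _ _ ((C + 1) * (e / (C + 1)))).
  by apply: ler_pM => //; [exact: rnorm_ge0|rewrite lerDl].
by rewrite mulrC divfK// gt_eqF.
Qed.

Lemma opnorm_le (L : {linear B -> B}) C : 0 <= C ->
  (forall x, rnorm (L x) <= C * rnorm x) -> (opnorm L <= C%:E)%E.
Proof.
move=> C0 hL; apply: ge_ereal_sup => _ [x /= x1 <-]; rewrite lee_fin.
by apply: le_trans (hL x) _; rewrite ler_piMr.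
Qed.

Lemma bounded_opP (L : {linear B -> B}) : bounded_op L ->
  exists2 C, opnorm L = C%:E & 0 <= C /\ forall x, rnorm (L x) <= C * rnorm x.
Proof.
rewrite /bounded_op => Lb.
have L0 : (0 <= opnorm L)%E.
  apply: ereal_sup_ubound; exists 0; rewrite /= ?rnorm0//.
  by rewrite linear0 rnorm0.
exists (fine (opnorm L)); first by rewrite fineK// ge0_fin_numE.
split; first exact: fine_ge0.
move=> x; have [x0|x0] := leP (rnorm x) 0.
  by rewrite (rnorm0_eq0 x x0) linear0 rnorm0 mulr0.
have -> : L x = (rnorm x)%:K *: L ((rnorm x)^-1%:K *: x).
  by rewrite linearZ/= scalerA -rmorphM mulfV ?gt_eqF// rmorph1 scale1r.
rewrite rnormZ gtr0_norm// mulrC; apply: ler_wpM2r; first exact: ltW.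
rewrite -lee_fin fineK ?ge0_fin_numE//; apply: ereal_sup_ubound.
exists ((rnorm x)^-1%:K *: x) => //=.
by rewrite rnormZ gtr0_norm ?invr_gt0// mulVf// gt_eqF.
Qed.

Lemma bounded_opI (L : {linear B -> B}) C :
  (forall x, rnorm (L x) <= C * rnorm x) -> bounded_op L.
Proof.
move=> hL; apply: (@le_lt_trans _ _ (Num.max C 0)%:E); last exact: ltry.
apply: opnorm_le; first by rewrite le_max lexx orbT.
move=> x; apply: le_trans (hL x) _.
by rewrite ler_wpM2r ?rnorm_ge0// le_max lexx.
Qed.

Lemma rcvg_linear (L : nat -> {linear B -> B}) :
  (forall x, exists l, rcvg (fun n => L n x) l) ->
  exists L' : {linear B -> B}, forall x, rcvg (fun n => L n x) (L' x).
Proof.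
move=> /choice[f hf].
have lf : linear f.
  move=> c x y; apply: rcvg_unique (hf _) _.
  have := rcvgD _ _ _ _ (rcvgZ c _ _ (hf x)) (hf y).
  by congr rcvg; apply/funext => n; rewrite linearP.
pose L' : {linear B -> B} := HB.pack f (GRing.isLinear.Build _ _ _ _ f lf).
by exists L'.
Qed.

End RealNorm.

(** * Strongly continuous semigroups and their generators *)

Section Semigroup.
Context {R : realType} {k : scalar_kind}.
Variable B : completeNormedModType (scalar_field R k).
Local Notation "c %:K" := (ofR k c) (at level 2, format "c %:K").

(* Sokal's gliding hump: if [L] nearly attains its norm on [v], then one of
   [x + z], [x - z], with [z] the rescaling of [v] to length [r], is mapped far
   from the origin. *)
Lemma bounded_op_hump (L : {linear B -> B}) (b r : R) (x : B) : 0 <= r ->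
  opnorm L = b%:E -> 0 < b -> exists x', rnorm (x' - x) <= r /\
    3 / 4 * b * r <= rnorm (L x').
Proof.
move=> r0 Lb b0.
have [v hv] : exists v, 3 / 4 * b * rnorm v < rnorm (L v).
  apply: contrapT => /forallNP h.
  have : (opnorm L <= (3 / 4 * b)%:E)%E.
    apply: opnorm_le; first by rewrite mulr_ge0 ?divr_ge0 ?(ltW b0).
    by move=> v; have /negP := h v; rewrite -leNgt.
  by rewrite Lb lee_fin => ?; lra.
have v0 : 0 < rnorm v.
  rewrite lt_neqAle rnorm_ge0 andbT eq_sym; apply/eqP => v0.
  by move: hv; rewrite (rnorm0_eq0 _ v) ?v0// linear0 rnorm0 mulr0 ltxx.
pose z := (r / rnorm v)%:K *: v.
have zr : rnorm z = r.
  by rewrite rnormZ ger0_norm ?divfK ?gt_eqF// divr_ge0// ltW.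
have Lz : 3 / 4 * b * r <= rnorm (L z).
  rewrite linearZ/= rnormZ ger0_norm ?divr_ge0 ?(ltW v0)//.
  apply: (@le_trans _ _ (r / rnorm v * (3 / 4 * b * rnorm v))).
    by rewrite le_eqVlt; apply/orP; left; apply/eqP; field; rewrite gt_eqF.
  by rewrite ler_wpM2l ?divr_ge0 ?(ltW v0)// ltW.
have h2 : 2 * rnorm (L z) <= rnorm (L (x + z)) + rnorm (L (x - z)).
  rewrite -[X in X * _]ger0_norm// -rnormZ.
  apply: le_trans (rnormB _ _ _); rewrite -linearB -linearZ/=.
  rewrite opprB addrC addrA subrK rmorph_nat scaler_nat mulr2n.
  exact: lexx.
have [h|h] := leP (3 / 4 * b * r) (rnorm (L (x + z))).
  by exists (x + z); rewrite addrC addKr zr.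
exists (x - z); rewrite addrC addKr rnormN zr; split => //; lra.
Qed.

(** Gliding hump. Failing a common bound, operators of norm [b >= 6^(j+1)] are picked in turn and
    [bounded_op_hump] moves the point by at most [3^-(j+1)]. All later moves add up to at most half
    of that, so the limit point satisfies [|L x| >= (3/4 - 1/2) b 3^-(j+1) >= 2^(j+1) / 4] for every
    [j]. *)
Lemma uniform_boundedness (L : nat -> {linear B -> B}) :
  (forall n, bounded_op (L n)) ->
  (forall x, exists C, forall n, rnorm (L n x) <= C) ->
  exists2 C, 0 <= C & forall n x, rnorm (L n x) <= C * rnorm x.
Proof.
move=> bL pL; apply: contrapT => nU.
pose q : R := 3^-1; have q0 : 0 <= q by rewrite invr_ge0.
have [F hF] : exists F : nat * B -> nat * R * B, forall s,
    let: (j, x) := s in let: (n, b, x') := F s in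
    [/\ rnorm (x' - x) <= q ^+ j.+1, forall v, rnorm (L n v) <= b * rnorm v,
        6 ^+ j.+1 <= b & 3 / 4 * b * q ^+ j.+1 <= rnorm (L n x')].
  suff /choice[F hF] : forall s : nat * B, exists y : nat * R * B,
      [/\ rnorm (y.2 - s.2) <= q ^+ s.1.+1,
          forall v, rnorm (L y.1.1 v) <= y.1.2 * rnorm v,
          6 ^+ s.1.+1 <= y.1.2 &
          3 / 4 * y.1.2 * q ^+ s.1.+1 <= rnorm (L y.1.1 y.2)].
    exists F => -[j x]; have := hF (j, x); by case: (F _) => -[n b] x'.
  move=> [j x] /=.
  have [n [y hy]] : exists n y, 6 ^+ j.+1 * rnorm y < rnorm (L n y).
    apply: contrapT => h; apply: nU; exists (6 ^+ j.+1); first exact: exprn_ge0.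
    move=> n y; rewrite leNgt; apply/negP => hy; apply: h; by exists n, y.
  have [b Lb [b0 hb]] := bounded_opP _ _ (bL n).
  have b6 : 6 ^+ j.+1 <= b.
    rewrite leNgt; apply/negP => lt6.
    have := hb y; have : b * rnorm y <= 6 ^+ j.+1 * rnorm y.
      by rewrite ler_wpM2r ?rnorm_ge0// ltW.
    lra.
  have bp : 0 < b by apply: lt_le_trans b6; rewrite exprn_gt0.
  have qj : 0 <= q ^+ j.+1 by exact: exprn_ge0.
  have [x' [h1 h2]] := bounded_op_hump _ _ _ x qj Lb bp.
  by exists (n, b, x').
pose xs := fix xs j := if j is i.+1 then (F (i, xs i)).2 else 0 : B.
have hx j : exists n b, [/\ rnorm (xs j.+1 - xs j) <= q ^+ j.+1,
    forall v, rnorm (L n v) <= b * rnorm v, 6 ^+ j.+1 <= b &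
    3 / 4 * b * q ^+ j.+1 <= rnorm (L n (xs j.+1))].
  have := hF (j, xs j); rewrite /=; case: (F _) => -[n b] x' h.
  by exists n, b.
have near j i : rnorm (xs (i + j)%N - xs j) <= 2^-1 * (q ^+ j - q ^+ (i + j)).
  elim: i => [|i IH]; first by rewrite !add0n !subrr rnorm0 mulr0.
  have [n [b [h1 _ _ _]]] := hx (i + j)%N.
  apply: le_trans (rnorm_le_add _ _ (xs (i + j)%N) _) _.
  apply: le_trans (lerD h1 IH) _; rewrite addSn exprS /q.
  by move: (q ^+ j) (q ^+ (i + j)) => u v; lra.
have qpos i : 0 <= q ^+ i by exact: exprn_ge0.
have near' j i : (j <= i)%N -> rnorm (xs i - xs j) <= 2^-1 * q ^+ j.
  move=> ji; rewrite -(subnK ji); apply: le_trans (near _ _) _.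
  by rewrite ler_wpM2l// gerBl.
have [x hxl] : exists x, rcvg B xs x.
  apply: rcauchy_rcvg => e e0.
  have [K0 hK0] := half_pow_small (1 : R) e e0.
  exists K0 => n m hn hm; have := hK0 K0 (leqnn _); rewrite mul1r => hq.
  have qe : q ^+ K0 <= e.
    apply: le_trans hq; apply: lerXn2r; rewrite ?nnegrE ?invr_ge0//.
    by rewrite /q lef_pV2 ?posrE// ler_nat.
  have := near' _ _ hn; have := near' _ _ hm.
  have := rnorm_le_add _ (xs n) (xs K0) (xs m); rewrite (rnormC _ (xs K0)); lra.
have hx' j : rnorm (x - xs j) <= 2^-1 * q ^+ j.
  have := rcvgB _ _ _ _ _ hxl (rcvg_cst _ (xs j)).
  by move=> /rcvg_le; apply; exact: near'.
have [C hC] := pL x.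
have [K0 /(_ K0 (leqnn _))] := half_pow_small (4 * `|C| + 1) (1 : R) ltr01.
have [n [b [_ hb h6 h4]]] := hx K0 => hK.
have hLx := hC n; have q1 := qpos K0.+1.
have h1 : rnorm (L n (xs K0.+1 - x)) <= b * (2^-1 * q ^+ K0.+1).
  apply: le_trans (hb _) _; rewrite rnormC ler_wpM2l//.
  exact: le_trans (exprn_ge0 _ _) h6.
have h2 := rnorm_leDB _ (L n (xs K0.+1)) (L n x).
rewrite -linearB in h2.
have h3 : 2 ^+ K0.+1 <= b * q ^+ K0.+1.
  have -> : 2 ^+ K0.+1 = 6 ^+ K0.+1 * q ^+ K0.+1 :> R.
    by rewrite -exprMn; congr (_ ^+ _); rewrite /q; field.
  by rewrite ler_wpM2r.
have h5 : 2 ^+ K0.+1 <= 4 * C by lra.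
have h7 : 4 * `|C| + 1 <= 2 ^+ K0.
  have h8 : 2^-1 ^+ K0 * 2 ^+ K0 = 1 :> R by rewrite -exprMn mulVf// expr1n.
  have h9 : 0 <= 2 ^+ K0 :> R by exact: exprn_ge0.
  by have := ler_wpM2r h9 hK; rewrite -mulrA h8 mulr1 mul1r.
have h10 : 2 ^+ K0 <= 2 ^+ K0.+1 :> R by rewrite ler_eXn2l ?ltr1n.
have := ler_norm C; lra.
Qed.

Section Growth.
Variable T : R -> {linear B -> B}.
Hypothesis hT : C0_semigroup T.

Lemma semigroup_cont0 (x : B) e : 0 < e ->
  exists2 d, 0 < d & forall t, 0 <= t <= d -> rnorm (T t x - x) <= e.
Proof.
move=> e0; have [_ T0 _ /(_ x)] := hT.
move=> /subspace_continuousP/(_ 0); rewrite /= in_itv/= lexx => /(_ isT).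
move=> /cvg_rnormP/(_ e e0); rewrite near_withinE => -[d /= d0 hd].
exists (d / 2); first by rewrite divr_gt0.
move=> t /andP[t0 td]; have := hd t; rewrite /ball_/= in_itv/= t0/= /from_subspace T0.
move=> h; apply/ltW/h => //.
by rewrite sub0r normrN ger0_norm//; lra.
Qed.

(** Otherwise some [t n] tend to 0 while the norm of [T (t n)] exceeds [n + 1]; continuity at 0
    bounds every orbit along [t n], against [uniform_boundedness]. *)
Lemma semigroup_local_bound : exists d C, [/\ 0 < d, 1 <= C &
  forall t x, 0 <= t <= d -> rnorm (T t x) <= C * rnorm x].
Proof.
have [bT _ _ _] := hT; apply: contrapT => nU.
have /choice[t ht] : forall n : nat, exists t, 0 <= t <= n.+1%:R^-1 /\
    exists y, n.+1%:R * rnorm y < rnorm (T t y).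
  move=> n; apply: contrapT => h; apply: nU; exists n.+1%:R^-1, n.+1%:R.
  split; rewrite ?invr_gt0 ?ltr0n ?ler1n// => t x tn.
  by rewrite leNgt; apply/negP => hx; apply: h; exists t; split=> //; exists x.
have t0 n : 0 <= t n by have [/andP[]] := ht n.
have [C C0 hC] : exists2 C, 0 <= C & forall n x, rnorm (T (t n) x) <= C * rnorm x.
  apply: uniform_boundedness => [n|x]; first exact: bT.
  have [d d0 hd] := semigroup_cont0 x 1 ltr01.
  pose n0 := Num.truncn d^-1.
  (* The sum takes care of the finitely many indices before [t n <= d] is guaranteed. *)
  exists (rnorm x + 1 + \sum_(i < n0) rnorm (T (t i) x)) => n.
  have S0 : 0 <= \sum_(i < n0) rnorm (T (t i) x).
    by apply: sumr_ge0 => i _; exact: rnorm_ge0.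
  have x0 := rnorm_ge0 _ x.
  have [nn0|nn0] := ltnP n n0.
    rewrite (bigD1 (Ordinal nn0))//=.
    have : 0 <= \sum_(i < n0 | i != Ordinal nn0) rnorm (T (t i) x).
      by apply: sumr_ge0 => i _; exact: rnorm_ge0.
    lra.
  have tn : 0 <= t n <= d.
    rewrite t0/=; have [/andP[_ h] _] := ht n; apply: le_trans h _.
    rewrite -[leRHS]invrK lef_pV2 ?posrE ?invr_gt0//.
    by apply: le_trans (ltW (truncnS_gt _)) _; rewrite ler_nat.
  have := hd _ tn; have := rnorm_leDB _ (T (t n) x) x; lra.
have [_ [y hy]] := ht (Num.truncn C).
have := hC (Num.truncn C) y.
have : C * rnorm y <= (Num.truncn C).+1%:R * rnorm y.
  by rewrite ler_wpM2r ?rnorm_ge0// ltW// truncnS_gt.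
lra.
Qed.

Lemma semigroup_growth : exists M w, [/\ 1 <= M, 0 <= w &
  forall t x, 0 <= t -> rnorm (T t x) <= M * expR (w * t) * rnorm x].
Proof.
have [d [C [d0 C1 hC]]] := semigroup_local_bound.
have [_ T0 Tadd _] := hT; have C0 : 0 < C by apply: lt_le_trans C1.
have main j t x : 0 <= t <= j%:R * d -> rnorm (T t x) <= C ^+ j.+1 * rnorm x.
  elim: j t x => [|j IH] t x /andP[t0].
    rewrite mul0r => t1; rewrite expr1; apply: hC; rewrite t0/=.
    exact: le_trans t1 (ltW d0).
  rewrite -natr1 mulrDl mul1r => tj.
  have [td|td] := leP t d.
    apply: le_trans (hC t x _) _; first by rewrite t0.
    by rewrite ler_wpM2r ?rnorm_ge0// exprS ler_peMr ?(ltW C0)// exprn_ege1.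
  have -> : T t x = T d (T (t - d) x).
    by rewrite -Tadd ?subr_ge0 1?ltW// addrC subrK.
  apply: le_trans (hC d _ _) _; first by rewrite lexx ltW.
  rewrite exprS -mulrA ler_wpM2l ?(ltW C0)//; apply: IH.
  by apply/andP; split; lra.
(* With [j] the integer part of [t / d], [j + 1] windows cover [t] and cost [C^(j+2)]; two factors
   form the constant and [C^j <= expR (w * t)]. *)
exists (C ^+ 2), (ln C / d); split.
- exact: exprn_ege1.
- by rewrite divr_ge0 ?ln_ge0// ltW.
move=> t x t0; pose j := Num.truncn (t / d).
have td0 : 0 <= t / d by rewrite divr_ge0// ltW.
have /andP[j1 j2] := truncn_itv td0.
apply: le_trans (main j.+1 t x _) _.
  by rewrite t0/= -ler_pdivrMr// ltW.
rewrite ler_wpM2r ?rnorm_ge0// -addn2 exprD mulrC ler_wpM2l ?exprn_ge0 ?(ltW C0)//.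
rewrite -[C in leLHS]lnK ?posrE// -expRM_natl ler_expR.
by rewrite mulrC mulrAC -mulrA ler_wpM2l ?ln_ge0.
Qed.

End Growth.
End Semigroup.

(** * Closedness and density of the generator *)

Section Generator.
Context {R : realType} {k : scalar_kind}.
Variable B : completeNormedModType (scalar_field R k).
Local Notation "c %:K" := (ofR k c) (at level 2, format "c %:K").

Lemma scaler_natK (n : nat) (x : B) : n%:R%:K *: x = x *+ n.
Proof. by rewrite rmorph_nat scaler_nat. Qed.

Lemma nbhs_rnorm (x : B) (e : R) : 0 < e -> nbhs x [set y | rnorm (y - x) < e].
Proof.
move=> e0; have /cvg_rnormP := @cvg_id _ (nbhs x).
by move=> /(_ e e0).
Qed.

Lemma invS_small (e : R) : 0 < e -> exists n0 : nat, forall n, (n0 <= n)%N ->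
  n.+1%:R^-1 <= e.
Proof.
move=> e0; exists (Num.truncn e^-1) => n hn.
rewrite -[leRHS]invrK lef_pV2 ?posrE ?invr_gt0//.
by apply: le_trans (ltW (truncnS_gt _)) _; rewrite ler_nat.
Qed.

Lemma closed_opI (A : operator B) :
  (forall u x y, (forall n, op_dom A (u n)) -> rcvg B u x ->
    rcvg B (fun n => A (u n)) y -> op_dom A x /\ A x = y) -> closed_op A.
Proof.
move=> h [x y] hxy.
have /choice[u hu] : forall n : nat, exists v, op_dom A v /\
    (rnorm (v - x) < n.+1%:R^-1 /\ rnorm (A v - y) < n.+1%:R^-1).
  move=> n; pose e : R := n.+1%:R^-1; have e0 : 0 < e by rewrite invr_gt0.
  have [|[v Av] [[/= dv <-] [/= h1 h2]]] :=
      hxy [set p | rnorm (p.1 - x) < e /\ rnorm (p.2 - y) < e].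
    exists ([set v | rnorm (v - x) < e], [set v | rnorm (v - y) < e]) => //=.
    by split; exact: nbhs_rnorm.
  by exists v.
have rc (v : nat -> B) l : (forall n, rnorm (v n - l) < n.+1%:R^-1) -> rcvg B v l.
  move=> hv e /invS_small[n0 hn]; exists n0 => n /hn; exact/le_trans/ltW/hv.
apply: (h u) => [n||].
- by have [] := hu n.
- by apply: rc => n; have [_ []] := hu n.
- by apply: rc => n; have [_ []] := hu n.
Qed.

Lemma closed_everywhere_op (L : {linear B -> B}) :
  bounded_op L -> closed_op (everywhere_op L).
Proof.
move=> /bounded_opP[C _ [C0 hC]]; apply: closed_opI => u x y _ ux Luy.
by split => //; exact: rcvg_unique (rcvg_bounded B L C u x C0 hC ux) Luy.
Qed.

Lemma dense_rnorm (D : set B) :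
  (forall x e, 0 < e -> exists2 y, D y & rnorm (y - x) <= e) -> dense D.
Proof.
move=> h O [x Ox] oO.
have /choice[u hu] : forall n : nat, exists y, D y /\ rnorm (y - x) <= n.+1%:R^-1.
  by move=> n; have [|y Dy hy] := h x n.+1%:R^-1; [rewrite invr_gt0|exists y].
have : rcvg B u x.
  move=> e /invS_small[n0 hn]; exists n0 => n /hn; apply: le_trans.
  by have [] := hu n.
move=> /rcvgP /(_ O (open_nbhs_nbhs (conj oO Ox)))[n _ hn].
by exists (u n); split; [exact: hn n (leqnn n)|have [] := hu n].
Qed.

Variable T : R -> {linear B -> B}.
Hypothesis hT : C0_semigroup T.
Variables (M w : R).
Hypotheses (M1 : 1 <= M) (w0 : 0 <= w).
Hypothesis hM : forall t x, 0 <= t -> rnorm (T t x) <= M * expR (w * t) * rnorm x.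

Let M0 : 0 <= M. Proof. exact: le_trans M1. Qed.

Lemma semigroup0 x : T 0 x = x.
Proof. by have [] := hT. Qed.

Lemma semigroupD s t x : 0 <= s -> 0 <= t -> T (s + t) x = T s (T t x).
Proof. by move=> s0 t0; have [_ _ h _] := hT; exact: h. Qed.

Lemma semigroup_le t t1 x : 0 <= t <= t1 -> rnorm (T t x) <= M * expR (w * t1) * rnorm x.
Proof.
move=> /andP[t0 tt1]; apply: le_trans (hM t x t0) _.
by rewrite ler_wpM2r ?rnorm_ge0// ler_wpM2l// ler_expR ler_wpM2l.
Qed.

Lemma semigroup_increment s d x : 0 <= s -> 0 <= d ->
  rnorm (T (s + d) x - T s x) <= M * expR (w * s) * rnorm (T d x - x).
Proof. by move=> s0 d0; rewrite semigroupD// -linearB hM. Qed.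

Definition diff_quot (h : R) (x : B) : B := h^-1%:K *: (T h x - x).

(** Discrete counterpart of [T t x - x = \int_0^t T s (A x) ds], exact for every step [h]. *)
Lemma semigroup_telescope h x j : 0 < h ->
  T (j%:R * h) x - x = h%:K *: \sum_(i < j) T (i%:R * h) (diff_quot h x).
Proof.
move=> h0; elim: j => [|j IH].
  by rewrite mul0r semigroup0 subrr big_ord0 scaler0.
rewrite big_ord_recr/= scalerDr -IH /diff_quot linearZ/= scalerA -rmorphM.
rewrite mulfV ?gt_eqF// rmorph1 scale1r linearB/= -semigroupD ?mulr_ge0 ?(ltW h0)//.
by rewrite -natr1 mulrDl mul1r [RHS]addrC addrA subrK.
Qed.

(** Discrete counterpart of moving the generator under an orbit integral: [T h] commutes with the
    orbit. *)
Lemma diff_quot_orbit_sum h c x j : 0 < h ->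
  diff_quot h (c%:K *: \sum_(i < j) T (i%:R * h) x) =
  c%:K *: \sum_(i < j) T (i%:R * h) (diff_quot h x).
Proof.
move=> h0; rewrite {1}/diff_quot linearZ/= -scalerBr scalerA mulrC -scalerA.
congr (_ *: _); rewrite linear_sum/= -sumrB scaler_sumr; apply: eq_bigr => i _.
have -> : T h (T (i%:R * h) x) = T (i%:R * h) (T h x).
  by rewrite -!semigroupD ?mulr_ge0 ?(ltW h0)// addrC.
by rewrite -linearB -linearZ.
Qed.

(** Each telescoped summand differs from [z] by [T (i h) (diff_quot h y - z)], controlled by the
    growth bound, and by [T (i h) z - z]. *)
Lemma diff_quot_error h y z j e : 0 < h ->
  (forall s, 0 <= s <= j%:R * h -> rnorm (T s z - z) <= e) ->
  rnorm (T (j%:R * h) y - y - (j%:R * h)%:K *: z) <=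
  j%:R * h * (M * expR (w * (j%:R * h)) * rnorm (diff_quot h y - z) + e).
Proof.
move=> h0 he; rewrite semigroup_telescope//.
have -> : (j%:R * h)%:K *: z = h%:K *: \sum_(i < j) z.
  by rewrite sumr_const card_ord -scaler_natK scalerA -rmorphM mulrC.
rewrite -scalerBr rnormZ gtr0_norm// -sumrB.
set C := (X in _ <= _ * X); have -> : j%:R * h * C = h * (j%:R * C) by ring.
rewrite {}/C; apply: ler_wpM2l; first exact: ltW.
apply: le_trans (rnorm_sum _ _ _ _ _) _.
rewrite mulr_natl -[X in _ *+ X]card_ord -sumr_const; apply: ler_sum => i _.
have ij : 0 <= i%:R * h <= j%:R * h.
  by rewrite mulr_ge0 ?(ltW h0)//= ler_wpM2r ?(ltW h0)// ler_nat ltnW.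
apply: le_trans (rnorm_le_add _ _ (T (i%:R * h) z) _) _.
apply: lerD; last exact: he.
rewrite -linearB; exact: semigroup_le ij.
Qed.

Variable A : operator B.
Hypothesis hA : generator_of A T.

Lemma generator_diff_quot x e : op_dom A x -> 0 < e ->
  exists2 d, 0 < d & forall h, 0 < h <= d -> rnorm (diff_quot h x - A x) <= e.
Proof.
move=> dx e0; have [/(_ (conj dx erefl)) + _] := hA x (A x).
move=> /cvg_rnormP/(_ e e0); rewrite near_withinE => -[d /= d0 hd].
exists (d / 2); first by rewrite divr_gt0.
move=> h /andP[h0 hd2]; have := hd h; rewrite /ball_/=.
rewrite sub0r normrN gtr0_norm// => /(_ _ h0) h1.
rewrite /diff_quot fmorphV; apply/ltW/h1; lra.
Qed.

Lemma generatorI x y :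
  (forall e, 0 < e -> exists2 d, 0 < d &
    forall h, 0 < h <= d -> rnorm (diff_quot h x - y) <= e) ->
  op_dom A x /\ A x = y.
Proof.
move=> hxy; have [_] := hA x y; apply; apply/cvg_rnormP => e e0.
have [d d0 hd] := hxy _ (divr_gt0 e0 (ltr0n _ 2)).
rewrite near_withinE; exists d => //= h; rewrite /ball_/= sub0r normrN => hd1 h0.
rewrite -fmorphV; apply: le_lt_trans (hd h _) _; last lra.
by rewrite h0 ltW// (le_lt_trans (ler_norm h)).
Qed.

(* If [T h_m y_m = y_m + h_m z_m] with [h_m -> 0], [y_m -> y], [z_m -> z], then
   summing along the orbit gives [T t y - y = t z + o(t)]. *)
Lemma generator_limit (h : nat -> R) (u : nat -> B) y z :
  (forall n, 0 < h n <= n.+1%:R^-1) -> rcvg B u y ->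
  rcvg B (fun n => diff_quot (h n) (u n)) z -> op_dom A y /\ A y = z.
Proof.
move=> hh uy duz; apply: generatorI => e e0.
have [d d0 hd] := semigroup_cont0 B T hT z e e0.
exists d => // t /andP[t0 td].
suff main : rnorm (T t y - y - t%:K *: z) <= t * e.
  have -> : diff_quot t y - z = t^-1%:K *: (T t y - y - t%:K *: z).
    by rewrite [RHS]scalerBr scalerA -rmorphM mulVf ?gt_eqF// rmorph1 scale1r.
  rewrite rnormZ gtr0_norm ?invr_gt0//.
  by rewrite mulrC ler_pdivrMr// mulrC.
(* [s n] is the last multiple of [h n] not exceeding [t], so it tends to [t]. *)
pose j n := Num.truncn (t / h n); pose s n := (j n)%:R * h n.
have h0 n : 0 < h n by case/andP: (hh n).
have sP n : 0 <= s n /\ s n <= t < s n + h n.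
  have t1 : 0 <= t / h n by rewrite divr_ge0// ltW.
  have /andP[j1 j2] := truncn_itv t1; split.
    by rewrite mulr_ge0// ltW.
  move: j1 j2; rewrite ler_pdivlMr// ltr_pdivrMr// -natr1 mulrDl mul1r.
  by move=> -> ->.
pose E := M * expR (w * t).
have E0 : 0 <= E by rewrite mulr_ge0 ?expR_ge0.
have E1 : 0 < E + 1 by rewrite ltr_wpDl.
have sc : rcvg B (fun n => T (s n) (u n)) (T t y).
  move=> eps eps0; have q0 : 0 < eps / (2 * (E + 1)) by rewrite divr_gt0// mulr_gt0.
  have [n1 hn1] := uy _ q0.
  have [d1 d10 hd1] := semigroup_cont0 B T hT y _ q0.
  have [n2 hn2] := invS_small d1 d10.
  exists (maxn n1 n2) => n; rewrite geq_max => /andP[nn1 nn2].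
  have [s0 /andP[st ts]] := sP n.
  have e1 : rnorm (T (s n) (u n) - T (s n) y) <= E * (eps / (2 * (E + 1))).
    rewrite -linearB; apply: le_trans (semigroup_le _ t _ _) _.
      by rewrite s0.
    by rewrite ler_wpM2l// hn1.
  have e2 : rnorm (T (s n) y - T t y) <= E * (eps / (2 * (E + 1))).
    rewrite rnormC.
    have -> : T t y = T (s n + (t - s n)) y by rewrite addrC subrK.
    apply: le_trans (semigroup_increment _ _ _ s0 _) _; first by rewrite subr_ge0.
    apply: ler_pM; rewrite ?rnorm_ge0 ?mulr_ge0 ?expR_ge0//.
      by rewrite ler_wpM2l// ler_expR ler_wpM2l.
    apply: hd1; rewrite subr_ge0 st/=.
    have /andP[_ h2] := hh n; have := le_trans h2 (hn2 n nn2); lra.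
  have e3 : E * (eps / (2 * (E + 1))) <= eps / 2.
    rewrite mulrA ler_pdivrMr ?mulr_gt0//.
    have -> : eps / 2 * (2 * (E + 1)) = E * eps + eps by field.
    lra.
  have := rnorm_le_add _ (T (s n) (u n)) (T (s n) y) (T t y); lra.
have sz : rcvg B (fun n => (s n)%:K *: z) (t%:K *: z).
  move=> eps eps0; have z1 : 0 < rnorm z + 1 by rewrite ltr_wpDl ?rnorm_ge0.
  have [n0 hn0] := invS_small _ (divr_gt0 eps0 z1).
  exists n0 => n /hn0 h1; rewrite -scalerBl -rmorphB rnormZ distrC.
  have [s0 /andP[st ts]] := sP n; have /andP[_ h2] := hh n.
  have h3 := le_trans h2 h1.
  apply: (@le_trans _ _ (eps / (rnorm z + 1) * (rnorm z + 1))).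
    apply: ler_pM => //; [exact: rnorm_ge0| |by rewrite lerDl].
    rewrite ger0_norm ?subr_ge0//; lra.
  by rewrite divfK// gt_eqF.
have lim := rcvgB _ _ _ _ _ (rcvgB _ _ _ _ _ sc uy) sz.
(* [e] stays fixed; the additional [eta] pays for [diff_quot (h n) (u n) - z]. *)
apply/ler_addgt0Pr => eta eta0.
have q0 : 0 < eta / (t * (E + 1)) by rewrite divr_gt0// mulr_gt0.
have [n0 hn0] := duz _ q0.
apply: (rcvg_le _ _ _ _ n0 lim) => n nn0.
have [s0 /andP[st ts]] := sP n.
have he r : 0 <= r <= s n -> rnorm (T r z - z) <= e.
  by move=> /andP[r0 rs]; apply: hd; rewrite r0 (le_trans rs)// (le_trans st).
apply: le_trans (diff_quot_error _ _ _ _ _ (h0 n) he) _.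
apply: (@le_trans _ _ (t * (E * (eta / (t * (E + 1))) + e))).
  apply: ler_pM => //.
    rewrite addr_ge0 ?mulr_ge0 ?expR_ge0 ?rnorm_ge0//.
    by apply: le_trans (rnorm_ge0 _ _) (he 0 _); rewrite lexx.
  rewrite lerD2r; apply: ler_pM; rewrite ?mulr_ge0 ?expR_ge0 ?rnorm_ge0//.
    by rewrite ler_wpM2l// ler_expR ler_wpM2l.
  exact: hn0.
have -> : t * (E * (eta / (t * (E + 1))) + e) = eta * (E / (E + 1)) + t * e.
  by field; rewrite !gt_eqF.
rewrite addrC lerD2l ler_piMr ?(ltW eta0)//.
by rewrite ler_pdivrMr// mul1r lerDl.
Qed.

(** For each [n] the step [h n] is taken so small that the difference quotient of [u n] is within
    [1/(n+1)] of [A (u n)]; then [generator_limit] applies. *)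
Lemma generator_closed : closed_op A.
Proof.
apply: closed_opI => u x y du ux Auy.
have /choice[h hh] : forall n, exists h, 0 < h <= n.+1%:R^-1 /\
    rnorm (diff_quot h (u n) - A (u n)) <= n.+1%:R^-1.
  move=> n; have n0 : 0 < n.+1%:R^-1 :> R by rewrite invr_gt0.
  have [d d0 hd] := generator_diff_quot _ _ (du n) n0.
  exists (Num.min d n.+1%:R^-1); rewrite lt_min d0 n0 ge_min lexx orbT; split => //.
  by apply: hd; rewrite lt_min d0 n0 ge_min lexx.
apply: (generator_limit h u) => //; first by move=> n; have [] := hh n.
move=> e e0; have e2 := divr_gt0 e0 (ltr0n R 2).
have [n0 hn0] := invS_small _ e2; have [n1 hn1] := Auy _ e2.
exists (maxn n0 n1) => n; rewrite geq_max => /andP[/hn0 h0 /hn1 h1].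
have h2 := le_trans (hh n).2 h0.
have := rnorm_le_add _ (diff_quot (h n) (u n)) (A (u n)) y; lra.
Qed.

(** Riemann sum with [m + 1] nodes for [b^-1 \int_0^b T s x ds]. *)
Definition orbit_mean (b : R) (x : B) (m : nat) : B :=
  m.+1%:R^-1%:K *: \sum_(i < m.+1) T (i%:R * (b / m.+1%:R)) x.

Lemma sum_ord_mul (m n : nat) (F : nat -> B) :
  \sum_(i < m * n) F i = \sum_(i < m) \sum_(j < n) F (i * n + j)%N.
Proof.
elim: m => [|m IH]; first by rewrite mul0n !big_ord0.
rewrite big_ord_recr/= -IH mulSn addnC.
by rewrite big_split_ord.
Qed.

(** Each node of the refined grid lies at most [b / (m + 1)] to the right of its coarse node. The
    predecessor in the index compensates for the extra node of [orbit_mean]. *)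
Lemma orbit_mean_refine b x m n e d : 0 < b -> 0 <= e -> b / m.+1%:R <= d ->
  (forall s, 0 <= s <= d -> rnorm (T s x - x) <= e) ->
  rnorm (orbit_mean b x m - orbit_mean b x (m.+1 * n.+1).-1)
    <= M * expR (w * b) * e.
Proof.
move=> b0 e0 hd he; rewrite /orbit_mean prednK ?muln_gt0//.
have m0 : 0 < m.+1%:R :> R by []. have n0 : 0 < n.+1%:R :> R by [].
rewrite (sum_ord_mul _ _ (fun i => T (i%:R * (b / (m.+1 * n.+1)%:R)) x)).
have -> : \sum_(i < m.+1) T (i%:R * (b / m.+1%:R)) x =
    n.+1%:R^-1%:K *: \sum_(i < m.+1) \sum_(j < n.+1) T (i%:R * (b / m.+1%:R)) x.
  rewrite scaler_sumr; apply: eq_bigr => i _; rewrite sumr_const card_ord.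
  by rewrite -scaler_natK scalerA -rmorphM mulVf ?gt_eqF// rmorph1 scale1r.
rewrite scalerA -rmorphM -invfM -natrM -scalerBr -sumrB.
set c := (m.+1 * n.+1)%:R; have c0 : 0 < c :> R by rewrite ltr0n muln_gt0.
rewrite rnormZ gtr0_norm ?invr_gt0// mulrC ler_pdivrMr//.
apply: le_trans (rnorm_sum _ _ _ _ _) _.
have -> : M * expR (w * b) * e * c =
    \sum_(i < m.+1) \sum_(j < n.+1) M * expR (w * b) * e.
  rewrite (eq_bigr (fun=> n.+1%:R * (M * expR (w * b) * e))); last first.
    by move=> i _; rewrite sumr_const card_ord mulr_natl.
  rewrite sumr_const card_ord -[RHS]mulr_natl /c natrM.
  by move: (M * _ * e) => X; rewrite mulrA mulrC.
apply: ler_sum => i _; rewrite -sumrB; apply: le_trans (rnorm_sum _ _ _ _ _) _.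
apply: ler_sum => j _.
have cE : c = m.+1%:R * n.+1%:R by rewrite /c natrM.
pose s := i%:R * (b / m.+1%:R); pose r := j%:R * (b / c).
have s0 : 0 <= s by rewrite mulr_ge0// divr_ge0// ltW.
have r0 : 0 <= r by rewrite mulr_ge0// divr_ge0// ltW.
have -> : (i * n.+1 + j)%:R * (b / c) = s + r.
  rewrite /s /r natrD natrM mulrDl; congr (_ + _); rewrite cE.
  by field; rewrite !gt_eqF.
rewrite rnormC; apply: le_trans (semigroup_increment _ _ _ s0 r0) _.
apply: ler_pM; rewrite ?mulr_ge0 ?expR_ge0 ?rnorm_ge0//.
  rewrite ler_wpM2l// ler_expR ler_wpM2l// /s.
  rewrite mulrCA ler_piMr ?(ltW b0)// ler_pdivrMr// mul1r ler_nat; exact: ltnW.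
apply: he; rewrite r0/=; apply: le_trans hd.
have -> : r = b / m.+1%:R * (j%:R / n.+1%:R).
  by rewrite /r cE; field; rewrite !gt_eqF.
rewrite ler_piMr ?divr_ge0 ?(ltW b0)// ler_pdivrMr// mul1r ler_nat; exact: ltnW.
Qed.

(** Any two means are compared through their common refinement. *)
Lemma orbit_mean_cvg b x : 0 < b -> exists y, rcvg B (orbit_mean b x) y.
Proof.
move=> b0; apply: rcauchy_rcvg => e e0.
pose E := M * expR (w * b); have E1 : 0 < E.
  by rewrite mulr_gt0 ?expR_gt0// (lt_le_trans _ M1).
have q0 : 0 < e / (2 * E) by rewrite divr_gt0// mulr_gt0.
have [d d0 hd] := semigroup_cont0 B T hT x _ q0.
have [n0 hn0] := invS_small _ (divr_gt0 d0 b0).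
have small n : (n0 <= n)%N -> b / n.+1%:R <= d.
  by move=> /hn0; rewrite ler_pdivlMr// mulrC.
exists n0 => n m /small hn /small hm.
have h1 := orbit_mean_refine b x n m _ d b0 (ltW q0) hn hd.
have h2 := orbit_mean_refine b x m n _ d b0 (ltW q0) hm hd.
rewrite mulnC in h2; rewrite rnormC in h2.
have E2 : E * (e / (2 * E)) = e / 2 by field; rewrite gt_eqF.
rewrite -/E E2 in h1 h2.
have := rnorm_le_add _ (orbit_mean b x n) (orbit_mean b x (n.+1 * m.+1).-1)
  (orbit_mean b x m); lra.
Qed.

(** The limit of the means over [[0, b]] lies in the domain: by telescoping, the difference quotient
    of the n-th mean with step [b / (n + 1)] is [b^-1 (T b x - x)] for every [n]. It is near [x]
    because the orbit moves little on [[0, b]]. *)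
Lemma generator_dense : dense (op_dom A).
Proof.
apply: dense_rnorm => x e e0.
have [d d0 hd] := semigroup_cont0 B T hT x e e0.
(* [b <= 1] makes [b / n.+1] an admissible step for [generator_limit]. *)
pose b := Num.min d 1; have b0 : 0 < b by rewrite lt_min d0 ltr01.
have [y hy] := orbit_mean_cvg b x b0.
exists y.
  suff [] : op_dom A y /\ A y = b^-1%:K *: (T b x - x) by [].
  apply: (generator_limit (fun n => b / n.+1%:R) (orbit_mean b x)) => // [n|].
    rewrite divr_gt0//= ler_piMl ?invr_ge0// ge_min lexx orbT //.
  rewrite (_ : (fun n => _) = fun=> b^-1%:K *: (T b x - x)); first exact: rcvg_cst.
  apply/funext => n; have h0 : 0 < b / n.+1%:R by rewrite divr_gt0.
  have bE : n.+1%:R * (b / n.+1%:R) = b by rewrite mulrC divfK// gt_eqF.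
  have tel := semigroup_telescope _ x n.+1 h0; rewrite bE in tel.
  rewrite /orbit_mean diff_quot_orbit_sum// tel scalerA -rmorphM; congr (_%:K *: _).
  by rewrite mulrA mulVf ?gt_eqF// mul1r.
apply: (rcvg_le _ _ _ _ 0 (rcvgB _ _ _ _ _ hy (rcvg_cst _ x))) => n _.
have n0 : 0 < n.+1%:R :> R by [].
have -> : orbit_mean b x n - x =
    n.+1%:R^-1%:K *: \sum_(i < n.+1) (T (i%:R * (b / n.+1%:R)) x - x).
  rewrite sumrB sumr_const card_ord scalerBr -scaler_natK scalerA.
  by rewrite -rmorphM mulVf ?gt_eqF// rmorph1 scale1r.
rewrite rnormZ gtr0_norm ?invr_gt0// mulrC ler_pdivrMr//.
apply: le_trans (rnorm_sum _ _ _ _ _) _.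
rewrite mulr_natr -[X in _ <= _ *+ X]card_ord -sumr_const; apply: ler_sum => i _.
apply: hd; rewrite mulr_ge0 ?divr_ge0 ?(ltW b0)//=.
apply: (@le_trans _ _ b); last by rewrite ge_min lexx.
rewrite mulrCA ler_piMr ?(ltW b0)// ler_pdivrMr// mul1r ler_nat; exact: ltnW.
Qed.

End Generator.

(** * Approximating an orbit by exponentials *)

Section Bernstein.
Context {R : realType} {k : scalar_kind}.
Variable B : completeNormedModType (scalar_field R k).
Local Notation "c %:K" := (ofR k c) (at level 2, format "c %:K").

(** De Casteljau recursion for the mean of [g] under the binomial law with parameters [n] and [z],
    so that inductions on [n] avoid binomial coefficients. *)
Fixpoint bernstein (z : R) (n : nat) (g : nat -> B) : B :=
  if n is m.+1 then (1 - z)%:K *: bernstein z m g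
    + z%:K *: bernstein z m (fun i => g i.+1)
  else g 0%N.

Fixpoint bernstein_mean (z : R) (n : nat) (g : nat -> R) : R :=
  if n is m.+1 then (1 - z) * bernstein_mean z m g
    + z * bernstein_mean z m (fun i => g i.+1)
  else g 0%N.

Lemma bernsteinB z n g v : bernstein z n g - v = bernstein z n (fun i => g i - v).
Proof.
elim: n g => [//|n IH] g /=; rewrite -!IH !scalerBr addrACA -opprD -scalerDl.
by rewrite -rmorphD subrK rmorph1 scale1r.
Qed.

Lemma bernstein_norm z n g : 0 <= z <= 1 ->
  rnorm (bernstein z n g) <= bernstein_mean z n (fun i => rnorm (g i)).
Proof.
move=> /andP[z0 z1]; elim: n g => [//|n IH] g /=.
apply: le_trans (rnormD _ _ _) _; rewrite !rnormZ !ger0_norm ?subr_ge0//.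
by apply: lerD; rewrite ler_wpM2l ?subr_ge0.
Qed.

Lemma bernstein_mean_le z n g g' : 0 <= z <= 1 ->
  (forall i, (i <= n)%N -> g i <= g' i) ->
  bernstein_mean z n g <= bernstein_mean z n g'.
Proof.
move=> /andP[z0 z1]; elim: n g g' => [|n IH] g g' h /=; first exact: h.
apply: lerD; rewrite ler_wpM2l ?subr_ge0//; apply: IH => i ilen; apply: h => //.
exact: leqW.
Qed.

Lemma bernstein_mean_affine z n u v g :
  bernstein_mean z n (fun i => u + v * g i) = u + v * bernstein_mean z n g.
Proof. by elim: n g => [//|n IH] g /=; rewrite !IH; ring. Qed.

(** Squared bias plus variance of the binomial law; the centre [c] is left free because the
    recursion shifts it to [c - 1]. *)
Lemma bernstein_variance z n c :
  bernstein_mean z n (fun i => (i%:R - c) ^+ 2) =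
  (n%:R * z - c) ^+ 2 + n%:R * z * (1 - z).
Proof.
elim: n c => [|n IH] c /=; first by rewrite !mul0r addr0.
have -> : (fun i : nat => (i.+1%:R - c) ^+ 2) = (fun i : nat => (i%:R - (c - 1)) ^+ 2).
  by apply/funext => i; rewrite -natr1; congr (_ ^+ 2); ring.
by rewrite !IH -natr1; ring.
Qed.

Lemma bernstein_poly n g : exists b : nat -> B,
  forall z, bernstein z n g = \sum_(j < n.+1) (z ^+ j)%:K *: b j.
Proof.
elim: n g => [|n IH] g /=.
  by exists g => z; rewrite big_ord1 expr0 rmorph1 scale1r.
have [b hb] := IH g; have [b' hb'] := IH (fun i => g i.+1).
exists (fun j => (if (j <= n)%N then b j else 0)
  + (if j is i.+1 then b' i - b i else 0)) => z.
rewrite hb hb'.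
under [RHS]eq_bigr do rewrite scalerDr.
rewrite big_split/= [X in _ = X + _]big_ord_recr/= ltnn scaler0 addr0.
rewrite [X in _ = _ + X]big_ord_recl/= scaler0 add0r.
rewrite !scaler_sumr -!big_split/=; apply: eq_bigr => i _.
rewrite -ltnS ltn_ord /bump/= add1n exprS !scalerA -!rmorphM scalerBr.
rewrite mulrBl mul1r rmorphB scalerBl -!addrA; congr (_ + _).
by rewrite addrC.
Qed.

Variable T : R -> {linear B -> B}.
Hypothesis hT : C0_semigroup T.
Variables (M w : R).
Hypotheses (M1 : 1 <= M) (w0 : 0 <= w).
Hypothesis hM : forall t x, 0 <= t -> rnorm (T t x) <= M * expR (w * t) * rnorm x.

(* The orbit [t |-> e^{-(w+1)t} T t x] in the variable [z = e^{-t}], which turns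
   [0, +oo] into [0, 1] and exponentials into powers. *)
Definition orbit01 (x : B) (z : R) : B :=
  if 0 < z then (expR ((w + 1) * ln z))%:K *: T (- ln z) x else 0.

Lemma orbit01_expR x t :
  orbit01 x (expR (- t)) = (expR (- (w + 1) * t))%:K *: T t x.
Proof. by rewrite /orbit01 expR_gt0 expRK opprK mulrN mulNr. Qed.

(** The factor [expR (- (w + 1) * t)] beats the growth [expR (w * t)] and leaves [expR (- t)], so
    increments fade as [z] tends to 0. *)
Lemma orbit01_increment x t d : 0 <= t -> 0 <= d ->
  rnorm (orbit01 x (expR (- (t + d))) - orbit01 x (expR (- t))) <=
  M * expR (- t) * rnorm ((expR (- (w + 1) * d))%:K *: T d x - x).
Proof.
move=> t0 d0; rewrite !orbit01_expR mulrDr expRD rmorphM.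
have [_ _ Tadd _] := hT; rewrite Tadd// -scalerA -scalerBr rnormZ ger0_norm ?expR_ge0//.
rewrite -linearZ -linearB.
apply: (@le_trans _ _ (expR (- (w + 1) * t) * (M * expR (w * t) *
    rnorm ((expR (- (w + 1) * d))%:K *: T d x - x)))).
  by rewrite ler_wpM2l ?expR_ge0//; exact: hM.
rewrite mulrA ler_wpM2r ?rnorm_ge0// mulrCA -expRD le_eqVlt; apply/orP; left.
by apply/eqP; congr (_ * expR _); ring.
Qed.

Lemma orbit01_le x z : 0 <= z <= 1 -> rnorm (orbit01 x z) <= M * z * rnorm x.
Proof.
move=> /andP[z0 z1]; rewrite /orbit01; case: ifPn => [zp|]; last first.
  by rewrite rnorm0 !mulr_ge0 ?rnorm_ge0// (le_trans ler01 M1).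
rewrite rnormZ ger0_norm ?expR_ge0//.
have lz : 0 <= - ln z by rewrite oppr_ge0 ln_le0.
apply: (@le_trans _ _ (expR ((w + 1) * ln z) * (M * expR (w * - ln z) * rnorm x))).
  by rewrite ler_wpM2l ?expR_ge0//; exact: hM.
rewrite mulrA ler_wpM2r ?rnorm_ge0// mulrCA -expRD.
have -> : (w + 1) * ln z + w * - ln z = ln z by ring.
by rewrite lnK.
Qed.

(** Up to a threshold [z0] the factor [z] in the bounds makes both values close. Beyond it, a small
    [z - y] forces [y / z = expR (- h)] to be near 1, so [h] is small and continuity of the
    semigroup at 0 applies. *)
Lemma orbit01_unif_cont x e : 0 < e -> exists2 d, 0 < d &
  forall y z, 0 <= y -> y <= z -> z <= 1 -> z - y <= d ->
    rnorm (orbit01 x z - orbit01 x y) <= e.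
Proof.
move=> e0; have Mp : 0 < M by apply: lt_le_trans M1.
have x0 := rnorm_ge0 _ x.
pose psi h := rnorm ((expR (- (w + 1) * h))%:K *: T h x - x).
have psi_le h : 0 <= h -> psi h <= (M + 1) * rnorm x.
  move=> h0; rewrite mulrDl mul1r; apply: le_trans (rnormB _ _ _) _.
  rewrite lerD2r rnormZ ger0_norm ?expR_ge0//.
  apply: (@le_trans _ _ (expR (- (w + 1) * h) * (M * expR (w * h) * rnorm x))).
    by rewrite ler_wpM2l ?expR_ge0//; exact: hM.
  rewrite mulrA ler_wpM2r// mulrCA -expRD ger_pMr// -[leRHS]expR0 ler_expR; lra.
have [d0 d0p hd0] : exists2 d, 0 < d & forall h, 0 <= h <= d -> psi h <= e / M.
  pose q := e / M / 2; have q0 : 0 < q by rewrite !divr_gt0.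
  have [d1 d1p hd1] := semigroup_cont0 B T hT x q q0.
  have W : 0 < (w + 1) * (rnorm x + 1) by rewrite mulr_gt0 ?ltr_wpDl.
  exists (Num.min d1 (q / ((w + 1) * (rnorm x + 1)))).
    by rewrite lt_min d1p divr_gt0.
  move=> h /andP[h0]; rewrite le_min => /andP[hd hq].
  have E1 : expR (- (w + 1) * h) <= 1.
    by rewrite -[leRHS]expR0 ler_expR mulNr oppr_le0 mulr_ge0// addr_ge0.
  have E2 : 1 - (w + 1) * h <= expR (- (w + 1) * h).
    by apply: le_trans (expR_ge1Dx _); rewrite mulNr.
  have h1 : rnorm (T h x - x) <= q by apply: hd1; rewrite h0.
  have h2 : (1 - expR (- (w + 1) * h)) * rnorm x <= q.
    apply: (@le_trans _ _ (((w + 1) * h) * (rnorm x + 1))).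
      by apply: ler_pM; rewrite ?subr_ge0// ?lerDl//; lra.
    by rewrite mulrAC mulrC -ler_pdivlMr.
  have -> : psi h = rnorm ((expR (- (w + 1) * h))%:K *: (T h x - x)
      - (1 - expR (- (w + 1) * h))%:K *: x).
    congr rnorm; rewrite rmorphB rmorph1 scalerBl scale1r scalerBr opprB.
    by rewrite addrA subrK.
  apply: le_trans (rnormB _ _ _) _; rewrite !rnormZ !ger0_norm ?subr_ge0 ?expR_ge0//.
  have h3 : expR (- (w + 1) * h) * rnorm (T h x - x) <= q.
    by apply: le_trans h1; rewrite ler_piMl ?rnorm_ge0.
  have -> : e / M = q + q by rewrite /q; field; rewrite gt_eqF.
  exact: lerD.
have key y z : 0 < y -> y <= z -> z <= 1 -> exists2 h, y = z * expR (- h) &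
    0 <= h /\ rnorm (orbit01 x z - orbit01 x y) <= M * z * psi h.
  move=> y0 yz z1; have zp : 0 < z by apply: lt_le_trans yz.
  pose h := ln z - ln y; exists h.
    by rewrite /h opprB expRD expRN !lnK// mulrCA mulfV ?mulr1// gt_eqF.
  have h0 : 0 <= h by rewrite subr_ge0 ler_ln.
  have t0 : 0 <= - ln z by rewrite oppr_ge0 ln_le0.
  split => //; have := orbit01_increment x _ _ t0 h0.
  have -> : - (- ln z + h) = ln y by rewrite /h; ring.
  by rewrite opprK !lnK// rnormC.
pose X := M * ((M + 1) * rnorm x) + 1.
have X1 : 0 < X by rewrite ltr_wpDl ?mulr_ge0 ?(ltW Mp)// addr_ge0 ?(ltW Mp).
pose z0 := e / X; have z0p : 0 < z0 by rewrite divr_gt0.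
have ed : expR (- d0) < 1 by rewrite -expR0 ltr_expR oppr_lt0.
(* For [z > z0] this distance gives [y > z * expR (- d0)], that is [h < d0]. *)
exists (z0 * (1 - expR (- d0)) / 2).
  by rewrite divr_gt0// mulr_gt0// subr_gt0.
move=> y z y0 yz z1 zy; have z_ge0 := le_trans y0 yz.
have [zz0|zz0] := leP z z0.
  have zX : M * z * ((M + 1) * rnorm x) <= e.
    apply: (@le_trans _ _ (z * X)).
      by rewrite /X mulrDr mulr1 -mulrA mulrCA lerDl.
    by rewrite -ler_pdivlMr.
  have [yp|yp] := ltP 0 y.
    have [h _ [h0 hh]] := key y z yp yz z1; apply: le_trans hh _.
    apply: le_trans zX; rewrite ler_wpM2l ?mulr_ge0 ?(ltW Mp)//; exact: psi_le.
  rewrite {2}/orbit01 ltNge yp/= subr0.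
  apply: le_trans (orbit01_le x z _) _; first by rewrite z_ge0.
  apply: le_trans zX; rewrite ler_wpM2l ?mulr_ge0 ?(ltW Mp)//.
  by rewrite ler_peMl// lerDr ltW.
have zp : 0 < z by apply: lt_trans zz0.
have yl : z * expR (- d0) < y.
  have h1 : z0 * (1 - expR (- d0)) < z * (1 - expR (- d0)).
    by rewrite ltr_pM2r// subr_gt0.
  have h2 : 0 < z0 * (1 - expR (- d0)) by rewrite mulr_gt0// subr_gt0.
  lra.
have yp : 0 < y by apply: le_lt_trans yl; rewrite mulr_ge0 ?expR_ge0.
have [h yh [h0 hh]] := key y z yp yz z1; apply: le_trans hh _.
have hd : h <= d0.
  by move: yl; rewrite yh ltr_pM2l// ltr_expR ltrN2 => /ltW.
have ph : psi h <= e / M by apply: hd0; rewrite h0.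
apply: (@le_trans _ _ (M * z * (e / M))); first by rewrite ler_wpM2l ?mulr_ge0 ?(ltW Mp).
have -> : M * z * (e / M) = z * e by field; rewrite gt_eqF.
by rewrite ler_piMl// ltW.
Qed.

(** Bernstein's argument: [|F y - F z| <= e/2 + D (y - z)^2], whose binomial mean over [y = i/n] is
    at most [e/2 + D/n]. Multiplication by [expR ((w + 1) * t)] turns the powers
    [z^j = expR (- j t)] into exponentials of rate [w + 1 - j]. *)
Lemma orbit_exp_approx x e : 0 < e -> exists (J : nat) (b : nat -> B),
  forall t, 0 <= t ->
  rnorm (T t x - \sum_(j < J) (expR ((w + 1 - j%:R) * t))%:K *: b j)
    <= e * expR ((w + 1) * t).
Proof.
move=> e0; have e2 : 0 < e / 2 by rewrite divr_gt0.
have [d dp hd] := orbit01_unif_cont x _ e2.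
have Mp : 0 < M by apply: lt_le_trans M1.
pose C := M * rnorm x; have C0 : 0 <= C by rewrite mulr_ge0 ?rnorm_ge0 ?(ltW Mp).
(* Where [|y - z| > d], the trivial bound [2 * C] is at most [D * (y - z) ^+ 2]. *)
pose D := 2 * C / d ^+ 2; have D0 : 0 <= D by rewrite divr_ge0 ?sqr_ge0// mulr_ge0.
pose F := orbit01 x.
have FC z : 0 <= z <= 1 -> rnorm (F z) <= C.
  move=> z01; apply: le_trans (orbit01_le x z z01) _; have /andP[z0 z1] := z01.
  by rewrite /C ler_wpM2r ?rnorm_ge0// ler_piMr ?(ltW Mp).
have FD y z : 0 <= y <= 1 -> 0 <= z <= 1 ->
    rnorm (F y - F z) <= e / 2 + D * (y - z) ^+ 2.
  move=> y01 z01; have /andP[y0 y1] := y01; have /andP[z0 z1] := z01.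
  have Dyz : 0 <= D * (y - z) ^+ 2 by rewrite mulr_ge0// sqr_ge0.
  have [yz|yz] := leP `|y - z| d.
    apply: (@le_trans _ _ (e / 2)); last by rewrite lerDl.
    have [h|h] := leP y z.
      rewrite rnormC; apply: hd => //; rewrite -[z - y]opprB.
      by apply: le_trans yz; rewrite -normrN ler_norm.
    by apply: hd => //; [exact: ltW|apply: le_trans yz; rewrite ler_norm].
  apply: (@le_trans _ _ (2 * C)).
    by apply: le_trans (rnormB _ _ _) _; have := FC y y01; have := FC z z01; lra.
  apply: (@le_trans _ _ (D * d ^+ 2)).
    by rewrite /D divfK// gt_eqF// exprn_gt0.
  apply: ler_wpDl; first exact: ltW.
  rewrite ler_wpM2l// -[leRHS]real_normK ?num_real//.
  by apply: lerXn2r; rewrite ?nnegrE ?(ltW dp)// ltW.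
pose n := (Num.truncn (D / (e / 2))).+1.
have n0 : 0 < n%:R :> R by rewrite ltr0n.
have nD : D / n%:R <= e / 2.
  by rewrite ler_pdivrMr// mulrC -ler_pdivrMr//; exact/ltW/truncnS_gt.
have [b hb] := bernstein_poly n (fun i => F (i%:R / n%:R)).
exists n.+1, b => t t0; pose z := expR (- t).
have z01 : 0 <= z <= 1 by rewrite expR_ge0 -[X in _ <= X]expR0 ler_expR oppr_le0.
have key : rnorm (F z - \sum_(j < n.+1) (z ^+ j)%:K *: b j) <= e.
  rewrite -hb rnormC bernsteinB; apply: le_trans (bernstein_norm _ _ _ z01) _.
  apply: (@le_trans _ _ (bernstein_mean z n
      (fun i => e / 2 + D / n%:R ^+ 2 * (i%:R - n%:R * z) ^+ 2))).
    apply: bernstein_mean_le => // i ilen.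
    apply: le_trans (FD _ _ _ z01) _.
      by rewrite divr_ge0//= ler_pdivrMr// mul1r ler_nat.
    rewrite lerD2l le_eqVlt; apply/orP; left; apply/eqP.
    by field; rewrite gt_eqF.
  rewrite bernstein_mean_affine bernstein_variance subrr expr0n add0r.
  have zz : z * (1 - z) <= 1.
    by have /andP[z0 z1] := z01; apply: mulr_ile1; rewrite ?subr_ge0//; lra.
  have -> : D / n%:R ^+ 2 * (n%:R * z * (1 - z)) = D / n%:R * (z * (1 - z)).
    by field; rewrite gt_eqF.
  have : D / n%:R * (z * (1 - z)) <= D / n%:R.
    by rewrite ler_piMr// divr_ge0// ltW.
  lra.
have E : (expR ((w + 1) * t))%:K *: F z = T t x.
  rewrite /F orbit01_expR scalerA -rmorphM -expRD mulNr subrr expR0.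
  by rewrite rmorph1 scale1r.
rewrite -E.
have -> : \sum_(j < n.+1) (expR ((w + 1 - j%:R) * t))%:K *: b j =
    (expR ((w + 1) * t))%:K *: \sum_(j < n.+1) (z ^+ j)%:K *: b j.
  rewrite scaler_sumr; apply: eq_bigr => j _; rewrite scalerA -rmorphM.
  by rewrite /z -expRM_natl -expRD; congr ((expR _)%:K *: _); ring.
rewrite -scalerBr rnormZ ger0_norm ?expR_ge0// mulrC ler_wpM2r ?expR_ge0//.
Qed.

End Bernstein.

(** * Mixtures of the semigroup *)

Section Mixtures.
Context {R : realType} {k : scalar_kind}.
Variable B : completeNormedModType (scalar_field R k).
Local Notation "c %:K" := (ofR k c) (at level 2, format "c %:K").

Lemma unif_limit_continuous (f : nat -> R -> B) (g : R -> B) :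
  (forall n, {within `[0, +oo[, continuous (f n)}) ->
  (forall t1 e, 0 <= t1 -> 0 < e -> exists n, forall t, 0 <= t <= t1 ->
    rnorm (f n t - g t) <= e) ->
  {within `[0, +oo[, continuous g}.
Proof.
move=> cf fg; apply/subspace_continuousP => t0; rewrite /= in_itv/= andbT => t00.
apply/cvg_rnormP => e e0; have e4 : 0 < e / 4 by rewrite divr_gt0.
have t01 : 0 <= t0 + 1 by rewrite addr_ge0.
have [n hn] := fg _ _ t01 e4.
have /subspace_continuousP/(_ t0) := cf n; rewrite /= in_itv/= andbT.
move=> /(_ t00)/cvg_rnormP/(_ _ e4); rewrite !near_withinE.
move=> [d /= d0 hd]; exists (Num.min d 1); first by rewrite /= lt_min d0 ltr01.
move=> t; rewrite /ball_/= lt_min => /andP[td t1] t0A.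
have := hd t td t0A; rewrite /from_subspace => h1.
move: t0A; rewrite in_itv/= andbT => tp.
have h2 : rnorm (f n t - g t) <= e / 4.
  by apply: hn; rewrite tp/=; move: t1; rewrite ltr_norml => /andP[]; lra.
have h3 : rnorm (f n t0 - g t0) <= e / 4 by apply: hn; rewrite t00/=; lra.
have h4 := rnorm_le_add _ (g t) (f n t) (g t0).
have h5 := rnorm_le_add _ (f n t) (f n t0) (g t0).
rewrite rnormC in h2; lra.
Qed.

Lemma continuous_scale_cst (f : R -> R) (v : B) :
  continuous f -> continuous (fun t => (f t)%:K *: v).
Proof.
move=> cf t; apply/cvg_rnormP => e e0.
have v1 : 0 < rnorm v + 1 by rewrite ltr_wpDl ?rnorm_ge0.
have /cvgrPdist_lt /(_ _ (divr_gt0 e0 v1)) := cf t.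
apply: filterS => s h; rewrite -scalerBl -rmorphB rnormZ distrC.
apply: (@le_lt_trans _ _ (`|f t - f s| * (rnorm v + 1))).
  by rewrite ler_wpM2l// lerDl.
by rewrite -ltr_pdivlMr.
Qed.

Lemma eventually_ord (J : nat) (Q : nat -> nat -> Prop) :
  (forall j, exists n0, forall n, (n0 <= n)%N -> Q j n) ->
  exists n0, forall j n, (j < J)%N -> (n0 <= n)%N -> Q j n.
Proof.
move=> h; elim: J => [|J [n0 hn0]]; first by exists 0%N.
have [n1 hn1] := h J; exists (maxn n0 n1) => j n; rewrite geq_max ltnS leq_eqVlt.
move=> /predU1P[->|jJ] /andP[h0 h1]; first exact: hn1.
exact: hn0.
Qed.

Variable T : R -> {linear B -> B}.
Hypothesis hT : C0_semigroup T.
Variables (M w : R).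
Hypotheses (M1 : 1 <= M) (w0 : 0 <= w).
Hypothesis hM : forall t x, 0 <= t -> rnorm (T t x) <= M * expR (w * t) * rnorm x.

Let M0 : 0 <= M. Proof. exact: le_trans M1. Qed.

Definition mixture (p : nat -> R -> R) (h : R) (K : nat) (t : R) (x : B) : B :=
  \sum_(i < K) (p i t)%:K *: T (i%:R * h) x.

Lemma mixture_is_linear p h K t : linear (mixture p h K t).
Proof.
move=> c x y; rewrite /mixture scaler_sumr -big_split/=; apply: eq_bigr => i _.
by rewrite linearP scalerDr !scalerA mulrC.
Qed.

HB.instance Definition _ p h K t := GRing.isLinear.Build _ B B _ (mixture p h K t)
  (mixture_is_linear p h K t).

Lemma mixtureS p h K t x :
  mixture p h K.+1 t x = mixture p h K t x + (p K t)%:K *: T (K%:R * h) x.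
Proof. by rewrite /mixture big_ord_recr. Qed.

Lemma mixture_comm p h K t s x : 0 <= h -> 0 <= s ->
  T s (mixture p h K t x) = mixture p h K t (T s x).
Proof.
move=> h0 s0; rewrite /mixture linear_sum/=; apply: eq_bigr => i _.
have [_ _ Tadd _] := hT.
by rewrite linearZ/= -!Tadd ?mulr_ge0// addrC.
Qed.

Lemma mixture_continuous p h K x : (forall i, continuous (p i)) ->
  continuous (fun t => mixture p h K t x).
Proof.
move=> cp; elim: K => [|K IH] t.
  rewrite (_ : (fun t => _) = fun=> 0); first exact: cvg_cst.
  by apply/funext => s; rewrite /mixture big_ord0.
rewrite (_ : (fun t => _) = fun t => mixture p h K t x + (p K t)%:K *: T (K%:R * h) x).
  by apply: cvgD; [exact: IH|exact: continuous_scale_cst].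
by apply/funext => s; rewrite mixtureS.
Qed.

Variable a : R -> R.
Hypotheses (ha : loc_integrable a) (hcp : completely_positive a).

Section OneMixture.
Variables (N h : R) (p : nat -> R -> R).
Hypotheses (N0 : 0 <= N) (h0 : 0 <= h) (hp : weights a N p).

Let p0 i t : 0 <= p i t. Proof. by have [_ + _ _] := hp; apply. Qed.

Lemma mixture_le K t x :
  rnorm (mixture p h K t x) <= M * gen_fun p (expR (w * h)) K t * rnorm x.
Proof.
rewrite /gen_fun mulr_sumr mulr_suml.
apply: le_trans (rnorm_sum _ _ _ _ _) _; apply: ler_sum => i _.
rewrite rnormZ ger0_norm// [p i t]lock mulrC -expRM_natl.
have ih : 0 <= i%:R * h by rewrite mulr_ge0.
rewrite mulrA mulrAC; apply: ler_wpM2r; first by rewrite -lock.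
by apply: le_trans (hM _ x ih) _; rewrite mulrCA.
Qed.

Lemma mixture_approx J (g : nat -> R) (b : nat -> B) e v K t x :
  (forall s, 0 <= s -> rnorm (T s x - \sum_(j < J) (expR (g j * s))%:K *: b j)
     <= e * expR (v * s)) ->
  rnorm (mixture p h K t x
    - \sum_(j < J) (gen_fun p (expR (g j * h)) K t)%:K *: b j)
  <= e * gen_fun p (expR (v * h)) K t.
Proof.
move=> hb.
have -> : \sum_(j < J) (gen_fun p (expR (g j * h)) K t)%:K *: b j =
    \sum_(i < K) (p i t)%:K *: \sum_(j < J) (expR (g j * (i%:R * h)))%:K *: b j.
  under [RHS]eq_bigr do rewrite scaler_sumr.
  rewrite exchange_big/=; apply: eq_bigr => j _.
  rewrite /gen_fun rmorph_sum scaler_suml; apply: eq_bigr => i _.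
  by rewrite scalerA -rmorphM mulrC -expRM_natl mulrCA.
rewrite /mixture -sumrB /gen_fun mulr_sumr.
apply: le_trans (rnorm_sum _ _ _ _ _) _; apply: ler_sum => i _.
rewrite -scalerBr rnormZ ger0_norm//.
have ih : 0 <= i%:R * h by rewrite mulr_ge0.
apply: (@le_trans _ _ (p i t * (e * expR (v * (i%:R * h))))).
  by rewrite ler_wpM2l// hb.
by rewrite -expRM_natl [v * (_ * _)]mulrCA [leLHS]mulrC -mulrA.
Qed.

(** [weights_tail] at [z = expR (w * h)] absorbs the growth of [T (i h)], so the i-th term is at
    most a constant times [2^-i]. *)
Lemma mixture_tail t1 : 0 <= t1 -> exists2 C, 0 <= C & forall K K' t x,
  (K <= K')%N -> 0 <= t <= t1 ->
  rnorm (mixture p h K' t x - mixture p h K t x) <= C * rnorm x * 2^-1 ^+ K.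
Proof.
move=> t10; have [C C0 hC] := weights_tail a ha hcp N p N0 hp (expR (w * h)) t1
  (expR_ge0 _) t10.
exists (2 * (M * C)); first by rewrite !mulr_ge0.
move=> K K' t x KK' tt1.
have main i : rnorm (mixture p h (i + K) t x - mixture p h K t x) <=
    2 * (M * C) * rnorm x * (2^-1 ^+ K - 2^-1 ^+ (i + K)).
  elim: i => [|i IH]; first by rewrite !add0n !subrr rnorm0 mulr0.
  apply: le_trans (rnorm_le_add _ _ (mixture p h (i + K) t x) _) _.
  have -> : mixture p h (i.+1 + K) t x - mixture p h (i + K) t x =
      (p (i + K)%N t)%:K *: T ((i + K)%:R * h) x.
    by rewrite addSn mixtureS addrAC subrr add0r.
  rewrite addSn addrC.
  have h1 : rnorm ((p (i + K)%N t)%:K *: T ((i + K)%:R * h) x) <=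
      M * C * rnorm x * 2^-1 ^+ (i + K).
    rewrite rnormZ ger0_norm//.
    have ih : 0 <= (i + K)%:R * h by rewrite mulr_ge0.
    apply: le_trans (ler_wpM2l (p0 _ _) (hM _ x ih)) _.
    have := hC (i + K)%N t tt1; rewrite -expRM_natl => h2.
    have -> : p (i + K)%N t * (M * expR (w * ((i + K)%:R * h)) * rnorm x) =
        M * rnorm x * (expR ((i + K)%:R * (w * h)) * p (i + K)%N t).
      by rewrite [w * (_ * _)]mulrCA; ring.
    apply: le_trans (ler_wpM2l _ h2) _; first by rewrite mulr_ge0 ?rnorm_ge0.
    by rewrite mulrA [M * C * _]mulrAC.
  move: IH h1; rewrite exprS; move: (2^-1 ^+ (i + K)) (2^-1 ^+ K) => u v.
  move: (rnorm (_ - _)) (rnorm (_ *: _)) => r s.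
  have E : 2 * (M * C) * rnorm x * (v - 2^-1 * u) =
    2 * (M * C) * rnorm x * (v - u) + M * C * rnorm x * u by field.
  rewrite E; move: (2 * (M * C) * rnorm x * (v - u)) (M * C * rnorm x * u) => y z.
  lra.
have := main (K' - K)%N; rewrite subnK// => /le_trans; apply.
by rewrite ler_wpM2l ?gerBl ?exprn_ge0 ?invr_ge0 ?mulr_ge0 ?rnorm_ge0.
Qed.

Lemma mixture_limit : exists S : R -> {linear B -> B}, forall t1, 0 <= t1 ->
  exists2 C, 0 <= C & forall K t x, 0 <= t <= t1 ->
  rnorm (mixture p h K t x - S t x) <= C * rnorm x * 2^-1 ^+ K.
Proof.
have /choice[S hS] : forall t, exists L : {linear B -> B}, 0 <= t -> forall x,
    rcvg B (fun K => mixture p h K t x) (L x).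
  (* [T 0] is a placeholder at negative times. *)
  move=> t; have [t0|t0] := leP 0 t; last by exists (T 0) => t0'; lra.
  have [C C0 hC] := mixture_tail t t0.
  have tt : 0 <= t <= t by rewrite t0 lexx.
  have [L hL] : exists L : {linear B -> B}, forall x,
      rcvg B (fun K => mixture p h K t x) (L x).
    apply: rcvg_linear => x; apply: rcauchy_rcvg => e e0.
    have [K0 hK0] := half_pow_small (2 * (C * rnorm x)) e e0.
    exists K0 => K K' hK hK'; have h2 := hK0 K0 (leqnn _).
    have h3 := hC _ _ t x hK tt; have h4 := hC _ _ t x hK' tt.
    have := rnorm_le_add _ (mixture p h K t x) (mixture p h K0 t x) (mixture p h K' t x).
    rewrite (rnormC _ (mixture p h K0 t x)); lra.
  by exists L.
exists S => t1 t10; have [C C0 hC] := mixture_tail t1 t10.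
exists C => // K t x tt1; have t0 : 0 <= t by case/andP: tt1.
rewrite rnormC.
have lim := rcvgB _ _ _ _ _ (hS t t0 x) (rcvg_cst _ (mixture p h K t x)).
by apply: (rcvg_le _ _ _ _ K lim) => K' KK'; exact: hC.
Qed.

End OneMixture.

Variable P : nat -> nat -> R -> R.
Hypothesis hP : forall n, weights a n.+1%:R (P n).
Variable Sn : nat -> R -> {linear B -> B}.

(** The sole link between [Sn] and its construction; [C] may depend on [n] and [t1]. *)
Definition unif_mixture_limit (n : nat) : Prop :=
  forall t1, 0 <= t1 -> exists2 C, 0 <= C & forall K t x, 0 <= t <= t1 ->
  rnorm (mixture (P n) n.+1%:R^-1 K t x - Sn n t x) <= C * rnorm x * 2^-1 ^+ K.

Hypothesis hSn : forall n, unif_mixture_limit n.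

Let h0 n : 0 <= n.+1%:R^-1 :> R. Proof. by rewrite invr_ge0. Qed.
Let N0 n : 0 <= n.+1%:R :> R. Proof. by []. Qed.

Lemma unif_mixture_rcvg n t x : 0 <= t ->
  rcvg B (fun K => mixture (P n) n.+1%:R^-1 K t x) (Sn n t x).
Proof.
move=> t0 e e0; have [C C0 hC] := hSn n t t0.
have [K0 hK0] := half_pow_small (C * rnorm x) e e0.
exists K0 => K /hK0; apply: le_trans; apply: hC; by rewrite t0 lexx.
Qed.

Lemma gen_fun_exp_le g : 0 <= g -> exists2 v, 0 <= v & forall n K t, 0 <= t ->
  gen_fun (P n) (expR (g / n.+1%:R)) K t <= 2 * expR (v * t).
Proof.
move=> g0; pose c := g * expR g + 1.
have c0 : 0 < c by rewrite ltr_wpDl// mulr_ge0 ?expR_ge0.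
have [v v0 hv] := exp_rate_exists a ha hcp c c0.
exists v => // n K t t0.
apply: (gen_fun_le a ha hcp n.+1%:R (P n) (N0 n) (hP n) _ c v) => //.
- exact: ltW.
- by apply: le_trans (exp_rate_bound g n g0) _; rewrite lerDl.
Qed.

Lemma unif_mixture_bound : exists2 v, 0 <= v & forall n t x, 0 <= t ->
  rnorm (Sn n t x) <= 2 * M * expR (v * t) * rnorm x.
Proof.
have [v v0 hv] := gen_fun_exp_le w w0; exists v => // n t x t0.
apply: (rcvg_le _ _ _ _ 0 (unif_mixture_rcvg n t x t0)) => K _.
apply: le_trans (mixture_le n.+1%:R _ _ (h0 n) (hP n) K t x) _.
rewrite ler_wpM2r ?rnorm_ge0//.
have -> : 2 * M * expR (v * t) = M * (2 * expR (v * t)) by ring.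
by apply: ler_wpM2l => //; exact: hv.
Qed.

Lemma unif_mixture_continuous n x : {within `[0, +oo[, continuous (fun t => Sn n t x)}.
Proof.
apply: (@unif_limit_continuous (fun K t => mixture (P n) n.+1%:R^-1 K t x)).
  move=> K; apply: continuous_subspaceT; apply: mixture_continuous => i.
  by have [+ _ _ _] := hP n; apply.
move=> t1 e t10 e0; have [C C0 hC] := hSn n t1 t10.
have [K0 hK0] := half_pow_small (C * rnorm x) e e0.
exists K0 => t tt1; apply: le_trans (hK0 K0 (leqnn _)); exact: hC.
Qed.

Lemma unif_mixture_cauchy x t1 e : 0 <= t1 -> 0 < e -> exists n0 : nat,
  forall n m t, (n0 <= n)%N -> (n0 <= m)%N -> 0 <= t <= t1 ->
  rnorm (Sn n t x - Sn m t x) <= e.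
Proof.
move=> t10 e0.
have w1 : 0 <= w + 1 by rewrite addr_ge0.
have [v v0 hv] := gen_fun_exp_le (w + 1) w1.
pose E := 2 * expR (v * t1); have E0 : 0 < E by rewrite mulr_gt0 ?expR_gt0.
(* [E] bounds the generating function at [expR ((w + 1) / N)], so each of the two approximation
   errors is at most [e / 4]. *)
have eps0 : 0 < e / (4 * E) by rewrite divr_gt0// mulr_gt0.
have [J [b hb]] := orbit_exp_approx B T hT M w M1 w0 hM x _ eps0.
pose Q := \sum_(j < J) rnorm (b j).
have Q0 : 0 <= Q by apply: sumr_ge0 => j _; exact: rnorm_ge0.
have eta0 : 0 < e / (4 * (Q + 1)) by rewrite divr_gt0// mulr_gt0// ltr_wpDl.
pose g j : R := w + 1 - j%:R.
(* How large [K] must be depends on [n] and [m], so the truncations are compared at fixed [n] and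
   [m], and [K] is sent to infinity last. *)
pose close j n m := exists K0 : nat, forall K t, (K0 <= K)%N -> 0 <= t <= t1 ->
  `|gen_fun (P n) (expR (g j / n.+1%:R)) K t
    - gen_fun (P m) (expR (g j / m.+1%:R)) K t| <= e / (4 * (Q + 1)).
have [n0 hn0] : exists n0, forall j n1, (j < J)%N -> (n0 <= n1)%N ->
    forall n m, (n1 <= n)%N -> (n1 <= m)%N -> close j n m.
  apply: (eventually_ord J (fun j n1 => forall n m, (n1 <= n)%N -> (n1 <= m)%N ->
    close j n m)) => j.
  have [n0 hn0] := gen_fun_cauchy a ha hcp P
    (fun n => expR (g j / n.+1%:R)) (g j) hP (fun n => expR_ge0 _)
    (exp_rate_cvg (g j)) t1 _ t10 eta0.
  by exists n0 => n1 n01 n m h1 h2; apply: hn0; exact: leq_trans n01 _.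
exists n0 => n m t nn nm tt1; have t0 : 0 <= t by case/andP: tt1.
have [K0 hK0] : exists K0, forall j K, (j < J)%N -> (K0 <= K)%N ->
    `|gen_fun (P n) (expR (g j / n.+1%:R)) K t
    - gen_fun (P m) (expR (g j / m.+1%:R)) K t| <= e / (4 * (Q + 1)).
  pose Qj j K := (j < J)%N -> `|gen_fun (P n) (expR (g j / n.+1%:R)) K t
    - gen_fun (P m) (expR (g j / m.+1%:R)) K t| <= e / (4 * (Q + 1)).
  have [|K0 hK0] := eventually_ord J Qj.
    move=> j; have [jJ|jJ] := ltnP j J; last first.
      by exists 0%N => K _ jJ'; move: jJ; rewrite leqNgt jJ'.
    have [K0 hK0] := hn0 j n0 jJ (leqnn _) n m nn nm.
    by exists K0 => K hK _; exact: hK0.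
  by exists K0 => j K jJ hK; exact: hK0.
have lim := rcvgB _ _ _ _ _ (unif_mixture_rcvg n t x t0) (unif_mixture_rcvg m t x t0).
apply: (rcvg_le _ _ _ _ K0 lim) => K hK.
have app i : rnorm (mixture (P i) i.+1%:R^-1 K t x
    - \sum_(j < J) (gen_fun (P i) (expR (g j / i.+1%:R)) K t)%:K *: b j) <= e / 4.
  apply: le_trans (mixture_approx i.+1%:R _ _ (h0 i) (hP i) J g b _ _ K t x hb) _.
  apply: (@le_trans _ _ (e / (4 * E) * E)).
    rewrite ler_wpM2l ?(ltW eps0)//; apply: le_trans (hv i K t t0) _.
    by rewrite ler_wpM2l// ler_expR ler_wpM2l//; case/andP: tt1.
  by rewrite le_eqVlt; apply/orP; left; apply/eqP; field; rewrite gt_eqF.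
pose V i := \sum_(j < J) (gen_fun (P i) (expR (g j / i.+1%:R)) K t)%:K *: b j.
have hV : rnorm (V n - V m) <= e / 4.
  rewrite /V -sumrB; apply: le_trans (rnorm_sum _ _ _ _ _) _.
  apply: (@le_trans _ _ (\sum_(j < J) e / (4 * (Q + 1)) * rnorm (b j))).
    apply: ler_sum => j _; rewrite -scalerBl -rmorphB rnormZ.
    by rewrite ler_wpM2r ?rnorm_ge0//; exact: hK0.
  rewrite -mulr_sumr -/Q.
  apply: (@le_trans _ _ (e / (4 * (Q + 1)) * (Q + 1))).
    by rewrite ler_wpM2l ?(ltW eta0)// lerDl.
  rewrite le_eqVlt; apply/orP; left; apply/eqP; field.
  by rewrite gt_eqF// ltr_wpDl.
have h1 := app n; have h2 := app m; rewrite -/(V n) in h1; rewrite -/(V m) in h2.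
have := rnorm_le_add _ (mixture (P n) n.+1%:R^-1 K t x) (V n) (mixture (P m) m.+1%:R^-1 K t x).
have := rnorm_le_add _ (V n) (V m) (mixture (P m) m.+1%:R^-1 K t x).
rewrite rnormC in h2; lra.
Qed.

Lemma unif_mixture_limit_exists : exists S : R -> {linear B -> B},
  forall x t1 e, 0 <= t1 -> 0 < e -> exists n0 : nat, forall n t, (n0 <= n)%N ->
    0 <= t <= t1 -> rnorm (Sn n t x - S t x) <= e.
Proof.
have /choice[S hS] : forall t, exists L : {linear B -> B}, 0 <= t -> forall x,
    rcvg B (fun n => Sn n t x) (L x).
  move=> t; have [t0|t0] := leP 0 t; last by exists (T 0) => t0'; lra.
  have [L hL] : exists L : {linear B -> B}, forall x, rcvg B (fun n => Sn n t x) (L x).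
    apply: rcvg_linear => x; apply: rcauchy_rcvg => e e0.
    have [n0 hn0] := unif_mixture_cauchy x t e t0 e0.
    by exists n0 => n m hn hm; apply: hn0 => //; rewrite t0 lexx.
  by exists L.
exists S => x t1 e t10 e0; have [n0 hn0] := unif_mixture_cauchy x t1 e t10 e0.
exists n0 => n t nn0 tt1; have t0 : 0 <= t by case/andP: tt1.
rewrite rnormC; have := rcvgB _ _ _ _ _ (hS t t0 x) (rcvg_cst _ (Sn n t x)).
by move=> /rcvg_le; apply => m nm; apply: hn0 => //; exact: nm.
Qed.

End Mixtures.

(** * A criterion for Bochner integrals *)

Section BochnerCriterion.
Context {R : realType} {k : scalar_kind}.
Variable B : completeNormedModType (scalar_field R k).
Local Notation "c %:K" := (ofR k c) (at level 2, format "c %:K").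
Local Notation mu := (@lebesgue_measure R).
Import HBSimple.

(** The integral of a nonnegative function is a supremum over the simple functions below it, hence
    monotone for arbitrary functions; it is used for the norm of a vector-valued difference. *)
Lemma ge0_le_integral_nonmeas (D : set R) (f g : R -> \bar R) :
  (forall x, D x -> (0 <= f x)%E) -> (forall x, D x -> (f x <= g x)%E) ->
  (\int[mu]_(x in D) f x <= \int[mu]_(x in D) g x)%E.
Proof.
move=> f0 fg; have g0 x : D x -> (0 <= g x)%E.
  by move=> Dx; apply: le_trans (f0 x Dx) (fg x Dx).
rewrite !ge0_integralE//; apply: le_ereal_sup => _ [h /= hf <-].
exists h => // x; apply: le_trans (hf x) _; rewrite !patchE.
by case: ifPn => // /set_mem; exact: fg.
Qed.

Lemma ge0_cvg_to0 (u : nat -> \bar R) : (forall n, (0 <= u n)%E) ->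
  (forall e : R, 0 < e -> exists n0 : nat, forall n, (n0 <= n)%N -> (u n <= e%:E)%E) ->
  u @ \oo --> (0%E : \bar R).
Proof.
move=> u0 hu; apply/fine_cvgP; split.
  have [n0 hn0] := hu 1 ltr01; exists n0 => // n /= /hn0 h.
  by rewrite ge0_fin_numE//; apply: le_lt_trans h _; exact: ltry.
apply/cvgrPdist_lt => e e0; have [n0 hn0] := hu _ (divr_gt0 e0 (ltr0n _ 2)).
exists n0 => // n /= /hn0 h; rewrite sub0r normrN /=.
have fu : u n \is a fin_num.
  by rewrite ge0_fin_numE//; apply: le_lt_trans h _; exact: ltry.
rewrite ger0_norm ?fine_ge0//; move: h; rewrite -(fineK fu) lee_fin/=; lra.
Qed.

Definition grid (n : nat) (s : R) : R := (Num.truncn (s * n.+1%:R))%:R / n.+1%:R.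

Lemma grid_itv n s : 0 <= s -> 0 <= grid n s <= s /\ s - grid n s <= n.+1%:R^-1.
Proof.
move=> s0; have n0 : 0 < n.+1%:R :> R by [].
have /truncn_itv/andP[h1 h2] : 0 <= s * n.+1%:R by rewrite mulr_ge0.
rewrite /grid; split.
  by rewrite divr_ge0//= ler_pdivrMr.
rewrite lerBlDr -[X in X + _]mul1r -mulrDl ler_pdivlMr//.
by apply: ltW; apply: lt_le_trans h2 _; rewrite -natr1 addrC.
Qed.

(** By contradiction: a sequence of bad points clusters at some [l], its grid points follow since
    the mesh tends to 0, and [f] is continuous at [l]. *)
Lemma continuous_grid (f : R -> R) t e : continuous f -> 0 <= t -> 0 < e ->
  exists n0 : nat, forall n s, (n0 <= n)%N -> 0 <= s <= t ->
  `|f s - f (grid n s)| <= e.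
Proof.
move=> cf t0 e0; apply: contrapT => nU.
have /choice[c hc] : forall m : nat, exists c : nat * R, [/\ (m <= c.1)%N,
    0 <= c.2 <= t & e < `|f c.2 - f (grid c.1 c.2)|].
  move=> m; apply: contrapT => h; apply: nU; exists m => n s mn st.
  by rewrite leNgt; apply/negP => hs; apply: h; exists (n, s).
have [|u iu /cvg_ex[l ul]] := @bolzano_weierstrass R (fun m => (c m).2).
  exists t; split; first exact: num_real.
  move=> M tM m _; have [_ /andP[c0 ct] _] := hc m.
  by rewrite /= ger0_norm// (le_trans ct)// ltW.
have /cvgrPdist_lt /(_ _ (divr_gt0 e0 (ltr0n _ 2)))[d /= d0 hd] := cf l.
have [n1 hn1] := invS_small _ (divr_gt0 d0 (ltr0n R 2)).
have /cvgrPdist_lt /(_ _ (divr_gt0 d0 (ltr0n _ 2)))[n2 _ hn2] := ul.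
pose m := maxn n1 n2.
have um : (m <= u m)%N.
  elim: (m) => [//|i IH]; apply: (leq_ltn_trans IH).
  by have := iu i.+1 i; rewrite !leEnat ltnn ltnNge => ->.
have [mc /andP[c0 ct] ec] := hc (u m).
have hl := hn2 m (leq_maxr n1 n2); rewrite /= in hl.
have [/andP[g0 g1] g2] := grid_itv (c (u m)).1 _ c0.
have hg := hn1 (c (u m)).1 (leq_trans (leq_maxl n1 n2) (leq_trans um mc)).
have hg2 := le_trans g2 hg.
have h1 : `|f l - f (c (u m)).2| < e / 2 by apply: hd; apply: lt_trans hl _; lra.
have h2 : `|f l - f (grid (c (u m)).1 (c (u m)).2)| < e / 2.
  apply: hd; rewrite /ball_/=; move: hl; rewrite !ltr_norml => /andP[a1 a2].
  by apply/andP; split; lra.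
have := ler_distD (f l) (f (c (u m)).2) (f (grid (c (u m)).1 (c (u m)).2)).
rewrite (distrC (f (c (u m)).2) (f l)); lra.
Qed.

(** * Simple functions built from level sets and grid intervals *)

Section Cells.
Variables (t : R) (h : {sfun measurableTypeR R >-> R}) (n : nat).
Hypothesis t0 : 0 <= t.

Definition sfun_vals : seq R := finmap.enum_fset (fset_set (range h)).
Definition cell_index : finType :=
  ('I_(size sfun_vals) * 'I_(Num.truncn (t * n.+1%:R)).+1)%type.
(** Both [h] and [grid n] are constant on a cell, so [(h s)%:K *: g (grid n s)] is simple on
    [[0, t]] for any [g]. *)
Definition cell (i : cell_index) : set R :=
  (h @^-1` [set sfun_vals`_i.1]) `&` `[i.2%:R / n.+1%:R, i.2.+1%:R / n.+1%:R[.

Lemma measurable_cell i : measurable (cell i : set (measurableTypeR R)).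
Proof.
by apply: measurableI => //; rewrite -[X in measurable X]setTI.
Qed.

Lemma measurable_itv_cell i :
  measurable (`[0, t] `&` cell i : set (measurableTypeR R)).
Proof. by apply: measurableI => //; exact: measurable_cell. Qed.

Lemma finite_cell i : (mu (cell i) < +oo)%E.
Proof.
apply: (@le_lt_trans _ _ (mu `[i.2%:R / n.+1%:R, i.2.+1%:R / n.+1%:R[)).
  by apply: le_measure; [exact: (mem_set (measurable_cell i))|exact/mem_set|exact: subIsetr].
by rewrite lebesgue_measure_itv/=; case: ifP => _; rewrite -?EFinB ltry.
Qed.

(** Exactly one cell contains [s]: the value [h s] selects the level set, the integer part of
    [s * n.+1] the interval. *)
Lemma cell_sum (V : nmodType) (G : R -> nat -> V) s : 0 <= s <= t ->
  \sum_(i : cell_index) (if s \in cell i then G sfun_vals`_i.1 i.2 else 0) =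
  G (h s) (Num.truncn (s * n.+1%:R)).
Proof.
move=> /andP[s0 st]; have n0 : 0 < n.+1%:R :> R by [].
have sv : h s \in sfun_vals.
  by apply: (etrans (in_fset_set (fimfunP h) (h s))); apply/mem_set; exists s.
have iv : (index (h s) sfun_vals < size sfun_vals)%N by rewrite index_mem.
have jv : (Num.truncn (s * n.+1%:R) < (Num.truncn (t * n.+1%:R)).+1)%N.
  by rewrite ltnS le_truncn// ler_wpM2r.
have s0' : 0 <= s * n.+1%:R by rewrite mulr_ge0.
rewrite (bigD1 (Ordinal iv, Ordinal jv))//= big1 ?addr0.
  rewrite nth_index// ifT// inE; split => /=; first by rewrite nth_index.
  have /andP[h1 h2] := truncn_itv s0'.
  by rewrite in_itv/= ler_pdivrMr// h1 ltr_pdivlMr.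
move=> [i j] ij; rewrite ifF//; apply/negP; rewrite inE /cell/= => -[/= hi].
rewrite in_itv/= ler_pdivrMr// ltr_pdivlMr// => hj.
move/eqP: ij; apply; congr (_, _); apply: val_inj => /=.
  by rewrite hi index_uniq// finmap.fset_uniq.
by rewrite (truncn_def hj).
Qed.

Lemma integrable_cell i : mu.-integrable `[0, t] (fun s => (\1_(cell i) s)%:E).
Proof.
apply/integrableP; split.
  apply/measurable_EFinP; apply: measurable_funTS.
  by apply: measurable_indic; exact: measurable_cell.
have -> : (\int[mu]_(s in `[0%R, t]) `|(\1_(cell i) s)%:E| =
    \int[mu]_(s in `[0%R, t]) (\1_(cell i) s)%:E)%E.
  by apply: eq_integral => s _; rewrite gee0_abs// lee_fin.
rewrite integral_indic//; last exact: measurable_cell.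
rewrite setIC; apply: le_lt_trans (finite_cell i); apply: le_measure.
- exact: (mem_set (measurable_itv_cell i)).
- exact: (mem_set (measurable_cell i)).
- exact: subIsetr.
Qed.

Lemma Rintegral_cells (x : cell_index -> R) :
  \int[mu]_(s in `[0, t]) (\sum_(i : cell_index) x i * \1_(cell i) s) =
  \sum_(i : cell_index) x i * fine (mu (`[0, t] `&` cell i)).
Proof.
have mD : measurable (`[0, t] : set (measurableTypeR R)) by [].
rewrite /Rintegral.
have -> : (\int[mu]_(s in `[0%R, t]) (\sum_(i : cell_index) x i * \1_(cell i) s)%:E =
    \int[mu]_(s in `[0%R, t]) \sum_(i : cell_index) (x i)%:E * (\1_(cell i) s)%:E)%E.
  by apply: eq_integral => s _; rewrite -sumEFin.
rewrite integral_sum//; last first.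
  by move=> i; apply: integrableZl => //; exact: integrable_cell.
have E i : (\int[mu]_(s in `[0%R, t]) ((x i)%:E * (\1_(cell i) s)%:E) =
    (x i * fine (mu (`[0%R, t] `&` cell i)))%:E)%E.
  rewrite integralZl//; last exact: integrable_cell.
  rewrite integral_indic//; last exact: measurable_cell.
  rewrite EFinM setIC fineK// ge0_fin_numE//.
  apply: le_lt_trans (finite_cell i); apply: le_measure.
  - exact: (mem_set (measurable_itv_cell i)).
  - exact: (mem_set (measurable_cell i)).
  - exact: subIsetr.
by under eq_bigr do rewrite E; rewrite sumEFin.
Qed.

(** [psi] stands for [id] in the integral of the approximants and for [Num.norm] in the bound of the
    error. *)
Lemma cells_grid (psi : R -> R) (f : R -> R) s : 0 <= s <= t ->
  psi (h s) * f (grid n s) = \sum_(i : cell_index)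
    (psi sfun_vals`_i.1 * f (i.2%:R / n.+1%:R)) * \1_(cell i) s.
Proof.
move=> st; rewrite -(cell_sum _ (fun c j => psi c * f (j%:R / n.+1%:R)) s st).
apply: eq_bigr => i _; rewrite indicE; case: ifP => _; first by rewrite mulr1.
by rewrite mulr0.
Qed.

Lemma integrable_grid (psi : R -> R) (f : R -> R) :
  mu.-integrable `[0, t] (EFin \o (fun s => psi (h s) * f (grid n s))).
Proof.
have mD : measurable (`[0, t] : set (measurableTypeR R)) by [].
have := integrable_sum mD (index_enum cell_index) (P := xpredT)
  (fun i _ => integrableZl mD (psi sfun_vals`_i.1 * f (i.2%:R / n.+1%:R))
    (integrable_cell i)).
apply: eq_integrable => // s; rewrite inE/= in_itv/= => st.
by rewrite cells_grid// -sumEFin.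
Qed.

Lemma Rintegral_grid (psi : R -> R) (f : R -> R) :
  \int[mu]_(s in `[0, t]) (psi (h s) * f (grid n s)) =
  \sum_(i : cell_index) (psi sfun_vals`_i.1 * f (i.2%:R / n.+1%:R)) *
     fine (mu (`[0, t] `&` cell i)).
Proof.
rewrite -Rintegral_cells; apply: eq_Rintegral => s.
by rewrite inE/= in_itv/= => /cells_grid.
Qed.

Variable g : R -> B.

Definition grid_simple_fun : Defs.simple_fun B :=
  @Defs.SimpleFun R k B #|cell_index| (fun i => cell (enum_val i))
    (fun i => (sfun_vals`_(enum_val i).1)%:K *: g ((enum_val i).2%:R / n.+1%:R))
    (fun i => measurable_cell (enum_val i)) (fun i => finite_cell (enum_val i)).

Lemma grid_simple_funE s : 0 <= s <= t ->
  sf_eval grid_simple_fun s = (h s)%:K *: g (grid n s).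
Proof.
move=> st; rewrite /sf_eval/=.
rewrite -(big_enum_val (A := [pred _ : cell_index | true]) (fun i : cell_index =>
  (\1_(cell i) s)%:K *: ((sfun_vals`_i.1)%:K *: g (i.2%:R / n.+1%:R)))).
rewrite -(cell_sum _ (fun c j => c%:K *: g (j%:R / n.+1%:R)) s st).
apply: eq_bigr => i _; rewrite indicE; case: ifP => _.
  by rewrite rmorph1 scale1r.
by rewrite rmorph0 scale0r.
Qed.

Lemma grid_simple_fun_integral : sf_integral `[0, t] grid_simple_fun =
  \sum_(i : cell_index) (fine (mu (`[0, t] `&` cell i)))%:K *:
     ((sfun_vals`_i.1)%:K *: g (i.2%:R / n.+1%:R)).
Proof.
rewrite /sf_integral/=.
by rewrite -(big_enum_val (A := [pred _ : cell_index | true]) (fun i : cell_index =>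
  (fine (mu (`[0, t] `&` cell i)))%:K *: ((sfun_vals`_i.1)%:K *: g (i.2%:R / n.+1%:R)))).
Qed.

Lemma cell_grid_itv (i : cell_index) : (0 : R) <= i.2%:R / n.+1%:R <= t.
Proof.
rewrite divr_ge0//= ler_pdivrMr//; have := ltn_ord i.2; rewrite ltnS.
by rewrite truncn_ge_nat// mulr_ge0.
Qed.

(** Both vectors are sums over cells with the same coefficients, and every node lies in [[0, t]],
    where [g] is approximated. *)
Lemma grid_simple_fun_integral_approx J (phi : nat -> R -> R) (b : nat -> B) e :
  (forall s, 0 <= s <= t -> rnorm (g s - \sum_(j < J) (phi j s)%:K *: b j) <= e) ->
  rnorm (sf_integral `[0, t] grid_simple_fun -
    \sum_(j < J) (\int[mu]_(s in `[0, t]) (h s * phi j (grid n s)))%:K *: b j)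
  <= e * \int[mu]_(s in `[0, t]) `|h s|.
Proof.
move=> hg; rewrite grid_simple_fun_integral.
have -> : \sum_(j < J) (\int[mu]_(s in `[0, t]) (h s * phi j (grid n s)))%:K *: b j =
    \sum_(i : cell_index) (fine (mu (`[0, t] `&` cell i)))%:K *:
     ((sfun_vals`_i.1)%:K *: \sum_(j < J) (phi j (i.2%:R / n.+1%:R))%:K *: b j).
  under [RHS]eq_bigr do rewrite scalerA -rmorphM scaler_sumr.
  rewrite exchange_big/=; apply: eq_bigr => j _.
  rewrite (Rintegral_grid id) rmorph_sum scaler_suml; apply: eq_bigr => i _.
  by rewrite scalerA -rmorphM; congr (_%:K *: _); rewrite mulrC mulrA.
rewrite -sumrB; apply: le_trans (rnorm_sum _ _ _ _ _) _.
have -> : \int[mu]_(s in `[0, t]) `|h s| =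
    \sum_(i : cell_index) `|sfun_vals`_i.1| * fine (mu (`[0, t] `&` cell i)).
  have := Rintegral_grid Num.norm (fun=> 1).
  under eq_bigr do rewrite mulr1.
  by move=> <-; apply: eq_Rintegral => s _; rewrite mulr1.
rewrite mulr_sumr; apply: ler_sum => i _.
rewrite -!scalerBr !rnormZ (ger0_norm (fine_ge0 (measure_ge0 _ _))).
rewrite mulrCA [leRHS]mulrA [e * _]mulrC -[leRHS]mulrA; apply: ler_wpM2l => //.
rewrite mulrC ler_wpM2r ?fine_ge0//; apply: hg; exact: cell_grid_itv.
Qed.

End Cells.

Lemma eq_bochner_integral (D : set R) (f g : R -> B) v :
  (forall s, D s -> f s = g s) ->
  is_bochner_integral D f v -> is_bochner_integral D g v.
Proof.
move=> fg [s [h1 h2 h3]]; exists s; split => //.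
- by apply: ae_impl h1 => u hu Du; rewrite -fg//; exact: hu.
- rewrite (_ : (fun n => _) = (fun n =>
    (\int[mu]_(t in D) (rnorm (f t - sf_eval (s n) t))%:E)%E))//.
  by apply/funext => n; apply: eq_integral => u /set_mem Du; rewrite fg.
Qed.

Variable a : R -> R.
Hypothesis ha : loc_integrable a.

(** The approximants are [(h n s)%:K *: g (grid n s)], with simple [h n] tending to [a (t - s)]
    pointwise and in L^1. Uniform approximation by finite combinations makes [g] bounded and of
    small oscillation along the grid, and reduces the limit of the integrals to scalar
    convolutions. *)
Lemma bochner_integral_criterion t (g : R -> B) v : 0 <= t ->
  (forall e, 0 < e -> exists (J : nat) (phi : nat -> R -> R) (b : nat -> B),
    [/\ forall j, continuous (phi j),
        forall s, 0 <= s <= t -> rnorm (g s - \sum_(j < J) (phi j s)%:K *: b j) <= e &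
        rnorm (v - \sum_(j < J) (convolution a (phi j) t)%:K *: b j) <= e]) ->
  is_bochner_integral `[0, t] (fun s => (a (t - s))%:K *: g s) v.
Proof.
move=> t0 hg; pose al s := a (t - s).
have mD : measurable (`[0, t] : set (measurableTypeR R)) by [].
have ial : mu.-integrable `[0, t] (EFin \o al).
  by apply: (kernel_integrable_reflect t a) => //; exact: kernel_integrable.
have [h [ih hp hl]] := approximation_sfun_integrable mD ial.
pose L n := \int[mu]_(s in `[0, t]) `|al s - h n s|.
pose A := \int[mu]_(s in `[0, t]) `|al s|.
have idh n : mu.-integrable `[0, t] (EFin \o (fun s => al s - h n s)).
  by have := integrableB mD ial (ih n).
have A0 : 0 <= A by exact: Rintegral_ge0.
have L0 n : 0 <= L n by exact: Rintegral_ge0.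
have hL e : 0 < e -> exists n0 : nat, forall n, (n0 <= n)%N -> L n <= e.
  move=> e0; have /fine_cvgP[_ /cvgrPdist_lt /(_ _ e0)[n0 _ hn0]] := hl.
  exists n0 => n /hn0 /=; rewrite sub0r normrN => h1.
  by apply/ltW; apply: le_lt_trans h1; rewrite /L /Rintegral ler_norm.
have gosc e : 0 < e -> exists n0 : nat, forall n s, (n0 <= n)%N -> 0 <= s <= t ->
    rnorm (g s - g (grid n s)) <= e.
  move=> e0; have e3 : 0 < e / 3 by rewrite divr_gt0.
  have [J [phi [b [cphi hphi _]]]] := hg _ e3.
  pose Q := \sum_(j < J) rnorm (b j).
  have Q0 : 0 <= Q by apply: sumr_ge0 => j _; exact: rnorm_ge0.
  have q0 : 0 < e / 3 / (Q + 1) by rewrite divr_gt0// ltr_wpDl.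
  have [n0 hn0] := eventually_ord J (fun j n => forall s, 0 <= s <= t ->
      `|phi j s - phi j (grid n s)| <= e / 3 / (Q + 1))
    (fun j => let: ex_intro n1 hn1 := continuous_grid (phi j) t _ (cphi j) t0 q0 in
      ex_intro _ n1 (fun n nn s => hn1 n s nn)).
  exists n0 => n s nn st; have /andP[s0 s1] := st.
  have [/andP[g0 g1] _] := grid_itv n s s0.
  have gt : 0 <= grid n s <= t by rewrite g0 (le_trans g1).
  pose V s := \sum_(j < J) (phi j s)%:K *: b j.
  have h1 := hphi s st; have h2 := hphi _ gt.
  have h3 : rnorm (V s - V (grid n s)) <= e / 3.
    rewrite /V -sumrB; apply: le_trans (rnorm_sum _ _ _ _ _) _.
    apply: (@le_trans _ _ (\sum_(j < J) e / 3 / (Q + 1) * rnorm (b j))).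
      apply: ler_sum => j _; rewrite -scalerBl -rmorphB rnormZ.
      by rewrite ler_wpM2r ?rnorm_ge0//; exact: hn0.
    rewrite -mulr_sumr -/Q -mulrA ler_piMr ?(ltW e3)// mulrC ler_pdivrMr ?ltr_wpDl//.
    by rewrite mul1r lerDl.
  have h4 := rnorm_le_add _ (g s) (V s) (g (grid n s)).
  have h5 := rnorm_le_add _ (V s) (V (grid n s)) (g (grid n s)).
  rewrite -/(V s) in h1; rewrite -/(V (grid n s)) rnormC in h2; lra.
have [G G0 hG] : exists2 G, 0 <= G & forall s, 0 <= s <= t -> rnorm (g s) <= G.
  have [J [phi [b [cphi hphi _]]]] := hg 1 ltr01.
  have /choice[C hC] : forall j, exists C, 0 <= C /\
      forall s, 0 <= s <= t -> `|phi j s| <= C.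
    by move=> j; have [C C0 hC] := continuous_itv_bounded (phi j) 0 t (cphi j);
      exists C; split => //; exact: ltW.
  exists (1 + \sum_(j < J) C j * rnorm (b j)).
    rewrite addr_ge0// sumr_ge0// => j _; rewrite mulr_ge0 ?rnorm_ge0//.
    by have [] := hC j.
  move=> s st; apply: le_trans (rnorm_leDB _ _ (\sum_(j < J) (phi j s)%:K *: b j)) _.
  rewrite addrC; apply: lerD; first exact: hphi.
  apply: le_trans (rnorm_sum _ _ _ _ _) _; apply: ler_sum => j _.
  by rewrite rnormZ ler_wpM2r ?rnorm_ge0//; have [_] := hC j; apply.
have gridt n s : 0 <= s <= t -> 0 <= grid n s <= t.
  move=> /andP[s0 st]; have [/andP[g0 g1] _] := grid_itv n s s0.
  by rewrite g0 (le_trans g1).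
exists (fun n => grid_simple_fun t (h n) n g : Defs.simple_fun B); split.
- apply: aeW => s; rewrite /= in_itv/= => st.
  apply/rcvgP => e e0.
  have G1 : 0 < G + 1 by rewrite ltr_wpDl.
  have al1 : 0 < `|al s| + 1 by rewrite ltr_wpDl.
  have e2 : 0 < e / 2 by rewrite divr_gt0.
  have [n0 hn0] := gosc _ (divr_gt0 e2 al1).
  have := hp s; rewrite /= in_itv/= => /(_ st) /fine_cvgP[_].
  move=> /cvgrPdist_lt /(_ _ (divr_gt0 e2 G1))[n1 _ hn1].
  exists (maxn n0 n1) => n; rewrite geq_max => /andP[nn0 nn1].
  rewrite grid_simple_funE//.
  have h1 := hn0 n s nn0 st; have := hn1 n nn1; rewrite /= => h2.
  have -> : (h n s)%:K *: g (grid n s) - (a (t - s))%:K *: g s =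
      - ((al s - h n s)%:K *: g (grid n s) + (al s)%:K *: (g s - g (grid n s))).
    rewrite rmorphB scalerBl scalerBr opprD !opprB /al.
    by rewrite addrA subrK.
  rewrite rnormN; apply: le_trans (rnormD _ _ _) _; rewrite !rnormZ.
  have h3 : `|al s - h n s| * rnorm (g (grid n s)) <= e / 2.
    apply: (@le_trans _ _ (e / 2 / (G + 1) * (G + 1))); last by rewrite divfK// gt_eqF.
    apply: ler_pM; rewrite ?rnorm_ge0//; first exact: ltW.
    by apply: le_trans (hG _ (gridt n s st)) _; rewrite lerDl.
  have h4 : `|al s| * rnorm (g s - g (grid n s)) <= e / 2.
    apply: (@le_trans _ _ ((`|al s| + 1) * (e / 2 / (`|al s| + 1)))).
      by apply: ler_pM; rewrite ?rnorm_ge0// lerDl.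
    by rewrite mulrC divfK// gt_eqF.
  lra.
- apply: ge0_cvg_to0 => [n|e e0].
    by apply: integral_ge0 => s _; rewrite lee_fin rnorm_ge0.
  have e2 : 0 < e / 2 by rewrite divr_gt0.
  have A1 : 0 < A + 1 by rewrite ltr_wpDl.
  have G1 : 0 < G + 1 by rewrite ltr_wpDl.
  have [n0 hn0] := gosc _ (divr_gt0 e2 A1).
  have [n1 hn1] := hL _ (divr_gt0 e2 G1).
  exists (maxn n0 n1) => n; rewrite geq_max => /andP[nn0 nn1].
  pose q := e / 2 / (A + 1); have q0 : 0 <= q by rewrite ltW// divr_gt0.
  apply: (@le_trans _ _ (\int[mu]_(s in `[0%R, t])
      (G * `|al s - h n s| + q * `|al s|)%:E)%E).
    apply: ge0_le_integral_nonmeas => s; first by rewrite lee_fin rnorm_ge0.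
    rewrite /= in_itv/= lee_fin => st; rewrite grid_simple_funE//.
    have -> : (a (t - s))%:K *: g s - (h n s)%:K *: g (grid n s) =
        (al s - h n s)%:K *: g (grid n s) + (al s)%:K *: (g s - g (grid n s)).
      by rewrite rmorphB scalerBl scalerBr [RHS]addrC addrA subrK.
    apply: le_trans (rnormD _ _ _) _; rewrite !rnormZ [G * _]mulrC [q * _]mulrC.
    apply: lerD; rewrite ler_wpM2l//; first exact/hG/gridt.
    exact: hn0.
  have i1 : mu.-integrable `[0, t] (EFin \o (fun s => `|al s - h n s|)).
    exact: (integrable_norm (idh n)).
  have i2 : mu.-integrable `[0, t] (EFin \o (fun s => `|al s|)).
    exact: (integrable_norm ial).
  have i3 : mu.-integrable `[0, t] (EFin \o (fun s => G * `|al s - h n s|)).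
    by have := integrableZl mD G i1.
  have i4 : mu.-integrable `[0, t] (EFin \o (fun s => q * `|al s|)).
    by have := integrableZl mD q i2.
  have fi := integrable_fin_num mD (integrableD mD i3 i4).
  rewrite -(fineK fi) lee_fin.
  have -> : fine (\int[mu]_(s in `[0%R, t]) (G * `|al s - h n s| + q * `|al s|)%:E)%E
      = G * L n + q * A.
    by rewrite -[LHS]/(Rintegral _ _ _) RintegralD// !RintegralZl.
  have hn := hn1 n nn1.
  have h1 : G * L n <= e / 2.
    apply: (@le_trans _ _ ((G + 1) * (e / 2 / (G + 1)))).
      by apply: ler_pM => //; rewrite lerDl.
    by rewrite mulrC divfK// gt_eqF.
  have h2 : q * A <= e / 2.
    apply: (@le_trans _ _ (q * (A + 1))); first by rewrite ler_wpM2l// lerDl.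
    by rewrite /q divfK// gt_eqF.
  lra.
- apply/rcvgP => e e0.
  (* [A + 2] is the bound [A + 1] for the integral of [|h n|], plus 1 for the error on [v]. *)
  have W : 0 < 4 * (A + 2) by rewrite mulr_gt0// ltr_wpDl.
  have eps0 : 0 < e / (4 * (A + 2)) by rewrite divr_gt0.
  have [J [phi [b [cphi hphi hv]]]] := hg _ eps0.
  pose Q := \sum_(j < J) rnorm (b j).
  have Q0 : 0 <= Q by apply: sumr_ge0 => j _; exact: rnorm_ge0.
  have q0 : 0 < e / 2 / (Q + 1) by rewrite !divr_gt0// ltr_wpDl.
  have conv_lim j : exists n0 : nat, forall n, (n0 <= n)%N ->
      `|\int[mu]_(s in `[0, t]) (h n s * phi j (grid n s)) -
        convolution a (phi j) t| <= e / 2 / (Q + 1).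
    have [C C0 hC] := continuous_itv_bounded (phi j) 0 t (cphi j).
    pose q := e / 2 / (Q + 1) / 2; have qp : 0 < q by rewrite divr_gt0.
    have A1 : 0 < A + 1 by rewrite ltr_wpDl.
    have [n0 hn0] := continuous_grid (phi j) t _ (cphi j) t0 (divr_gt0 qp A1).
    have [n1 hn1] := hL _ (divr_gt0 qp C0).
    exists (maxn n0 n1) => n; rewrite geq_max => /andP[nn0 nn1].
    have ic : mu.-integrable `[0, t] (EFin \o (fun s => al s * phi j s)).
      by apply: (integrable_mul_continuous _ al (phi j) 0 t).
    have ig := integrable_grid t (h n) n id (phi j).
    pose q' := q / (A + 1); have q'0 : 0 <= q' by rewrite ltW// divr_gt0.
    have i1 := integrable_norm (idh n); have i2 := integrable_norm ial.
    have i3 : mu.-integrable `[0, t] (EFin \o (fun s => C * `|al s - h n s|)).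
      by have := integrableZl mD C i1.
    have i4 : mu.-integrable `[0, t] (EFin \o (fun s => q' * `|al s|)).
      by have := integrableZl mD q' i2.
    have i5 : mu.-integrable `[0, t]
        (EFin \o (fun s => h n s * phi j (grid n s) - al s * phi j s)).
      by have := integrableB mD ig ic.
    have i6 : mu.-integrable `[0, t]
        (EFin \o (fun s => C * `|al s - h n s| + q' * `|al s|)).
      by have := integrableD mD i3 i4.
    rewrite /convolution -RintegralB//.
    apply: le_trans (le_normr_Rintegral mD i5) _.
    apply: (@le_trans _ _ (\int[mu]_(s in `[0, t])
        (C * `|al s - h n s| + q' * `|al s|))).
      apply: le_Rintegral => //; first exact: (integrable_norm i5).
      move=> s; rewrite /= in_itv/= => st.
      have -> : h n s * phi j (grid n s) - al s * phi j s =
          - ((al s - h n s) * phi j (grid n s)) -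
          al s * (phi j s - phi j (grid n s)) by ring.
      apply: le_trans (ler_normB _ _) _; rewrite normrN !normrM.
      rewrite [C * _]mulrC [q' * _]mulrC; apply: lerD; rewrite ler_wpM2l//.
        exact/hC/gridt.
      exact: hn0.
    rewrite RintegralD// !RintegralZl// -/(L n) -/A.
    have -> : e / 2 / (Q + 1) = q + q by exact: splitr.
    apply: lerD.
      by have := hn1 n nn1; rewrite ler_pdivlMr// mulrC.
    apply: (@le_trans _ _ (q' * (A + 1))); first by rewrite ler_wpM2l// lerDl.
    by rewrite /q' divfK// gt_eqF.
  have [n0 hn0] := eventually_ord J _ conv_lim.
  have [n1 hn1] := hL _ ltr01.
  exists (maxn n0 n1) => n; rewrite geq_max => /andP[nn0 nn1].
  have Hn : \int[mu]_(s in `[0, t]) `|h n s| <= A + 1.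
    have i1 := integrable_norm (idh n); have i2 := integrable_norm ial.
    have i6 : mu.-integrable `[0, t] (EFin \o (fun s => `|al s| + `|al s - h n s|)).
      by have := integrableD mD i2 i1.
    apply: (@le_trans _ _ (A + L n)); last by rewrite lerD2l; exact: hn1.
    rewrite /A /L -RintegralD//; apply: le_Rintegral => //.
      exact: (integrable_norm (ih n)).
    move=> s _; have := ler_normB (al s) (al s - h n s).
    by rewrite opprB addrC subrK.
  have h1 := grid_simple_fun_integral_approx t (h n) n t0 g J phi b _ hphi.
  pose V := \sum_(j < J) (\int[mu]_(s in `[0, t]) (h n s * phi j (grid n s)))%:K *: b j.
  pose V' := \sum_(j < J) (convolution a (phi j) t)%:K *: b j.
  have h2 : rnorm (V - V') <= e / 2.
    rewrite /V /V' -sumrB; apply: le_trans (rnorm_sum _ _ _ _ _) _.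
    apply: (@le_trans _ _ (\sum_(j < J) e / 2 / (Q + 1) * rnorm (b j))).
      apply: ler_sum => j _; rewrite -scalerBl -rmorphB rnormZ.
      by rewrite ler_wpM2r ?rnorm_ge0//; exact: hn0.
    rewrite -mulr_sumr -/Q.
    apply: (@le_trans _ _ (e / 2 / (Q + 1) * (Q + 1))).
      by rewrite ler_wpM2l ?(ltW q0)// lerDl.
    by rewrite divfK// gt_eqF// ltr_wpDl.
  have h3 : e / (4 * (A + 2)) * \int[mu]_(s in `[0, t]) `|h n s| <=
      e / (4 * (A + 2)) * (A + 1) by rewrite ler_wpM2l ?(ltW eps0).
  have h4 : e / (4 * (A + 2)) * (A + 1) + e / (4 * (A + 2)) = e / 4.
    by field; rewrite gt_eqF// ltr_wpDl.
  have h5 := rnorm_le_add _ (sf_integral `[0, t] (grid_simple_fun t (h n) n g)) V v.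
  have h6 := rnorm_le_add _ V V' v.
  rewrite -/V in h1; rewrite -/V' rnormC in hv.
  have fin (x1 x2 x3 x4 x5 y1 y2 y3 : R) : x1 <= y1 -> x2 <= e / 2 -> y1 <= y2 ->
    y2 + y3 = e / 4 -> x3 <= x1 + x4 -> x4 <= x2 + x5 -> x5 <= y3 -> x3 <= e.
    by clear -e0; lra.
  exact: fin h1 h2 h3 h4 h5 h6 hv.
Qed.

End BochnerCriterion.

(** * Passage to the limit *)

Section Assembly.
Context {R : realType} {k : scalar_kind}.
Variable B : completeNormedModType (scalar_field R k).
Local Notation "c %:K" := (ofR k c) (at level 2, format "c %:K").
Variable T : R -> {linear B -> B}.
Hypothesis hT : C0_semigroup T.
Variables (M w : R).
Hypotheses (M1 : 1 <= M) (w0 : 0 <= w).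
Hypothesis hM : forall t x, 0 <= t -> rnorm (T t x) <= M * expR (w * t) * rnorm x.

Lemma diff_quot_is_linear h : linear (diff_quot B T h).
Proof.
move=> c x y; rewrite /diff_quot linearP scalerA mulrC -scalerA -scalerDr.
by congr (_ *: _); rewrite opprD addrACA scalerBr.
Qed.

HB.instance Definition _ h := GRing.isLinear.Build _ B B _ (diff_quot B T h)
  (diff_quot_is_linear h).

Lemma diff_quot_bounded h : 0 < h -> bounded_op (diff_quot B T h : {linear B -> B}).
Proof.
move=> h0; apply: (bounded_opI _ _ (h^-1 * (M * expR (w * h) + 1))) => x.
rewrite /= /diff_quot rnormZ gtr0_norm ?invr_gt0// -mulrA.
apply: ler_wpM2l; first by rewrite invr_ge0 ltW.
apply: le_trans (rnormB _ _ _) _; rewrite mulrDl mul1r lerD2r.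
by apply: hM; exact: ltW.
Qed.

Variable a : R -> R.
Hypotheses (ha : loc_integrable a) (hcp : completely_positive a).

(** Summation by parts: the difference quotient along the orbit is [N] times a difference of
    consecutive values, and the weight equations turn [N (a * p j)] back into weights. This is the
    resolvent equation of the mixture up to one boundary term. *)
Lemma mixture_conv_sum N p h K t x : 0 <= h -> N * h = 1 -> weights a N p -> 0 <= t ->
  \sum_(j < K.+1) (convolution a (p j) t)%:K *: T (j%:R * h) (diff_quot B T h x) =
  mixture B T p h K.+1 t x - x
    + (N * convolution a (p K) t)%:K *: T (K.+1%:R * h) x.
Proof.
move=> h0 Nh [_ _ p0 pS] t0; have [_ T0 Tadd _] := hT.
have hV : h^-1 = N.
  have hn : h != 0 by apply/eqP => h00; move: Nh; rewrite h00 mulr0 => /eqP; rewrite eq_sym oner_eq0.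
  by apply: (mulIf hn); rewrite Nh mulVf.
have Tj j : T (j%:R * h) (diff_quot B T h x) =
    N%:K *: (T (j.+1%:R * h) x - T (j%:R * h) x).
  rewrite /diff_quot hV linearZ/= linearB/= -Tadd ?mulr_ge0//.
  by rewrite -natr1 mulrDl mul1r.
elim: K => [|K IH].
  rewrite big_ord1 Tj /mixture big_ord1 mul0r T0 !mul1r.
  have -> : p 0%N t = 1 - N * convolution a (p 0%N) t by rewrite -(p0 t t0) addrK.
  rewrite rmorphB rmorph1 scalerBl scale1r scalerA -rmorphM mulrC scalerBr.
  by rewrite [_ - _ - x]addrAC subrr add0r addrC.
rewrite big_ord_recr/= IH Tj [in RHS]mixtureS scalerA -rmorphM [_ * N]mulrC.
have -> : p K.+1 t = N * convolution a (p K) t - N * convolution a (p K.+1) t.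
  by rewrite -(pS K t t0) addrK.
rewrite rmorphB scalerBl scalerBr !addrA.
by rewrite [LHS](ACl (1*3*5*2*4)).
Qed.

(** The decay of [p K] at [z = expR (w * h)] already includes the growth of [T (K h)], so a factor
    [2^-K] survives. *)
Lemma mixture_conv_remainder N p h t x e : 0 <= N -> 0 <= h -> weights a N p ->
  0 <= t -> 0 < e -> exists K0 : nat, forall K, (K0 <= K)%N ->
  rnorm ((N * convolution a (p K) t)%:K *: T (K.+1%:R * h) x) <= e.
Proof.
move=> N0 h0 hp t0 e0; have [cp p_ge0 _ _] := hp.
have [C C0 hC] := weights_tail a ha hcp N p N0 hp (expR (w * h)) t (expR_ge0 _) t0.
have ia := kernel_integrable a ha t; have a0 := kernel_ae_ge0 a hcp t.
have M0 : 0 <= M by exact: le_trans M1.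
pose c1 := convolution a (fun=> 1) t.
have [K0 hK0] := half_pow_small (N * C * c1 * M * expR (w * h) * rnorm x) e e0.
exists K0 => K /hK0; apply: le_trans.
pose z := expR (w * h) ^+ K; have z0 : 0 < z by rewrite exprn_gt0// expR_gt0.
have cK : 0 <= convolution a (p K) t by apply: (conv_ge0 t a).
have cz : z * convolution a (p K) t <= C * 2^-1 ^+ K * c1.
  have cc : continuous (fun _ : R => 1 : R) by move=> ?; exact: cvg_cst.
  rewrite -(convZ t a)// /c1 -(convZ t a)//.
  apply: (conv_le t a) => //; [exact: continuousZ_fun|exact: continuousZ_fun|].
  by move=> s st; rewrite mulr1; exact: hC.
rewrite rnormZ ger0_norm ?mulr_ge0//.
have Kh : 0 <= K.+1%:R * h by rewrite mulr_ge0.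
have hb := hM _ x Kh.
rewrite (_ : expR (w * (K.+1%:R * h)) = expR (w * h) * z) in hb; last first.
  by rewrite mulrCA expRM_natl exprS.
apply: (@le_trans _ _ (N * convolution a (p K) t *
    (M * (expR (w * h) * z) * rnorm x))).
  by rewrite ler_wpM2l// mulr_ge0.
have -> : N * convolution a (p K) t * (M * (expR (w * h) * z) * rnorm x) =
    N * M * expR (w * h) * rnorm x * (z * convolution a (p K) t) by ring.
have -> : N * C * c1 * M * expR (w * h) * rnorm x * 2^-1 ^+ K =
    N * M * expR (w * h) * rnorm x * (C * 2^-1 ^+ K * c1).
  by move: (2^-1 ^+ K) => u; ring.
by rewrite ler_wpM2l// !mulr_ge0 ?expR_ge0 ?rnorm_ge0.
Qed.

Variable P : nat -> nat -> R -> R.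
Hypothesis hP : forall n, weights a n.+1%:R (P n).
Variable Sn : nat -> R -> {linear B -> B}.
Hypothesis hSn : forall n, unif_mixture_limit B T P Sn n.

Let h n : R := n.+1%:R^-1.
Let h_gt0 n : 0 < h n. Proof. by rewrite invr_gt0. Qed.
Let h_ge0 n : 0 <= h n. Proof. exact: ltW. Qed.
Let N0 n : 0 <= n.+1%:R :> R. Proof. by []. Qed.
Let Nh n : n.+1%:R * h n = 1. Proof. by rewrite mulfV// pnatr_eq0. Qed.

(** [mixture_conv_sum] provides the combination that [bochner_integral_criterion] asks for, with
    coefficients [P n]. As [n] may depend on [e], this serves both a fixed [Sn n] and the limit
    [S]. *)
Lemma bochner_mixture t (Z : R -> B) x v : 0 <= t ->
  (forall e, 0 < e -> exists n K0 : nat, forall K, (K0 <= K)%N ->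
    (forall s, 0 <= s <= t -> rnorm (mixture B T (P n) (h n) K s (diff_quot B T (h n) x)
       - Z s) <= e) /\
    rnorm (mixture B T (P n) (h n) K t x - x - v) <= e) ->
  is_bochner_integral `[0, t] (fun s => (a (t - s))%:K *: Z s) v.
Proof.
move=> t0 hZ; apply: bochner_integral_criterion => // e e0.
have e2 : 0 < e / 2 by rewrite divr_gt0.
have [n [K0 hn]] := hZ _ e2.
have [K1 hK1] := mixture_conv_remainder _ _ _ t x _ (N0 n) (h_ge0 n) (hP n) t0 e2.
pose K := maxn K0 K1.
(* A mixture of [K.+1] terms leaves a remainder with the weight of index [K]. *)
have [h1 h2] := hn K.+1 (leqW (leq_maxl _ _)).
exists K.+1, (P n), (fun j => T (j%:R * h n) (diff_quot B T (h n) x)); split.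
- by have [] := hP n.
- by move=> s st; rewrite rnormC; apply: le_trans (h1 s st) _; lra.
- rewrite (mixture_conv_sum _ _ _ _ _ _ (h_ge0 n) (Nh n) (hP n) t0).
  have := hK1 K (leq_maxr _ _).
  set r := _ *: T _ x; set V := mixture _ _ _ _ _ _ _ - x => hr.
  have := rnormB _ (v - V) r; rewrite [X in rnorm X <= _](_ : _ = v - (V + r)).
    by rewrite (rnormC _ v V); rewrite -/V in h2; lra.
  by rewrite [in RHS]opprD [RHS]addrA.
Qed.

Lemma semigroup_unif_mixture_comm n t s x : 0 <= t -> 0 <= s ->
  T s (Sn n t x) = Sn n t (T s x).
Proof.
move=> t0 s0; have M0 : 0 <= M by exact: le_trans M1.
have h1 := unif_mixture_rcvg B T P Sn hSn n t (T s x) t0.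
have h2 := unif_mixture_rcvg B T P Sn hSn n t x t0.
apply: rcvg_unique h1.
have := rcvg_bounded _ (T s) (M * expR (w * s)) _ _ (mulr_ge0 M0 (expR_ge0 _))
  (fun y => hM s y s0) h2.
congr rcvg; apply/funext => K.
by rewrite (mixture_comm B T hT)// invr_ge0.
Qed.

Lemma diff_quot_unif_mixture_comm n t s x : 0 <= t -> 0 <= s ->
  diff_quot B T s (Sn n t x) = Sn n t (diff_quot B T s x).
Proof.
move=> t0 s0; rewrite /diff_quot (semigroup_unif_mixture_comm n t s x)//.
by rewrite -linearB -linearZ.
Qed.

(** At time 0 every convolution is an integral over a point, so the weight of index 0 is 1 and the
    others vanish. *)
Lemma unif_mixture_at0 n x : Sn n 0 x = x.
Proof.
have [_ _ p0 pS] := hP n; have [_ T0 _ _] := hT.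
have conv0 f : convolution a f 0 = 0.
  by rewrite /convolution set_itv1 Rintegral_set1.
have mix K : mixture B T (P n) (h n) K.+1 0 x = x.
  rewrite /mixture big_ord_recl/= mul0r T0 big1 ?addr0.
    by have := p0 0 (lexx 0); rewrite conv0 mulr0 addr0 => ->; rewrite rmorph1 scale1r.
  move=> i _; have := pS i 0 (lexx 0); rewrite !conv0 mulr0 addr0 => ->.
  by rewrite rmorph0 scale0r.
have := rcvg_shift _ _ _ 1 (unif_mixture_rcvg B T P Sn hSn n 0 x (lexx 0)).
move=> h1; apply: (rcvg_unique _ _ _ _ h1).
rewrite (_ : (fun _ => _) = fun=> x); first exact: rcvg_cst.
by apply/funext => K; rewrite addn1 mix.
Qed.

Lemma unif_mixture_resolvent n :
  resolvent (everywhere_op (diff_quot B T (h n) : {linear B -> B})) a (Sn n).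
Proof.
have [v v0 hv] := unif_mixture_bound B T M w M1 w0 hM a ha hcp P hP Sn hSn.
split; split => //.
- exact/closed_everywhere_op/diff_quot_bounded.
- by apply: dense_rnorm => x e e0; exists x => //; rewrite subrr rnorm0 ltW.
- by move=> t t0; apply: (bounded_opI _ _ (2 * M * expR (v * t))) => x; exact: hv.
- split; last exact: unif_mixture_at0.
  by move=> x; exact: (unif_mixture_continuous B T a P hP Sn hSn).
- move=> t x t0 _; split => //=.
  by rewrite (diff_quot_unif_mixture_comm n t (h n) x).
- move=> t x t0 _ /=.
  apply: (bochner_mixture t _ x) => // e e0.
  exists n; have [C C0 hC] := hSn n t t0.
  have [K0 hK0] := half_pow_small (C * rnorm (diff_quot B T (h n) x)) e e0.
  have [K1 hK1] := half_pow_small (C * rnorm x) e e0.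
  exists (maxn K0 K1) => K; rewrite geq_max => /andP[/hK0 k0 /hK1 k1].
  split=> [s st|].
    rewrite (diff_quot_unif_mixture_comm n s (h n) x)//; last by case/andP: st.
    exact: le_trans (hC K s _ st) k0.
  rewrite opprB addrA subrK; apply: le_trans k1; apply: hC.
  by rewrite t0 lexx.
Qed.

Variable A : operator B.
Hypothesis hA : generator_of A T.
Variable S : R -> {linear B -> B}.
Hypothesis hS : forall x t1 e, 0 <= t1 -> 0 < e -> exists n0 : nat, forall n t,
  (n0 <= n)%N -> 0 <= t <= t1 -> rnorm (Sn n t x - S t x) <= e.

Lemma limit_rcvg t x : 0 <= t -> rcvg B (fun n => Sn n t x) (S t x).
Proof.
move=> t0 e e0; have [n0 hn0] := hS x t e t0 e0.
by exists n0 => n nn0; apply: hn0 => //; rewrite t0 lexx.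
Qed.

Lemma limit_bound : exists2 v, 0 <= v & forall t x, 0 <= t ->
  rnorm (S t x) <= 2 * M * expR (v * t) * rnorm x.
Proof.
have [v v0 hv] := unif_mixture_bound B T M w M1 w0 hM a ha hcp P hP Sn hSn.
exists v => // t x t0; apply: (rcvg_le _ _ _ _ 0 (limit_rcvg t x t0)) => n _.
exact: hv.
Qed.

Lemma diff_quot_generator x e : op_dom A x -> 0 < e -> exists n0 : nat,
  forall n, (n0 <= n)%N -> rnorm (diff_quot B T (h n) x - A x) <= e.
Proof.
move=> dx e0; have [d d0 hd] := generator_diff_quot B T A hA x e dx e0.
have [n0 hn0] := invS_small d d0; exists n0 => n /hn0 hn.
by apply: hd; rewrite h_gt0.
Qed.

(* [T h_n x - x] over [h_n] tends to [A x] and [Sn] is locally bounded, so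
   [Sn n s (A_n x)] tends to [S s (A x)] locally uniformly. *)
Lemma limit_diff_quot x t1 e : op_dom A x -> 0 <= t1 -> 0 < e ->
  exists n0 : nat, forall n s, (n0 <= n)%N -> 0 <= s <= t1 ->
  rnorm (Sn n s (diff_quot B T (h n) x) - S s (A x)) <= e.
Proof.
move=> dx t10 e0; have e2 : 0 < e / 2 by rewrite divr_gt0.
have [v v0 hv] := unif_mixture_bound B T M w M1 w0 hM a ha hcp P hP Sn hSn.
pose E := 2 * M * expR (v * t1).
have E0 : 0 < E by rewrite !mulr_gt0 ?expR_gt0// (lt_le_trans _ M1).
have [n0 hn0] := diff_quot_generator x _ dx (divr_gt0 e2 E0).
have [n1 hn1] := hS (A x) t1 _ t10 e2.
exists (maxn n0 n1) => n s; rewrite geq_max => /andP[nn0 nn1] st.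
have /andP[s0 s1] := st.
have h1 := hn1 n s nn1 st.
have h2 : rnorm (Sn n s (diff_quot B T (h n) x) - Sn n s (A x)) <= e / 2.
  rewrite -linearB; apply: le_trans (hv n s _ s0) _.
  apply: (@le_trans _ _ (E * (e / 2 / E))); last by rewrite mulrC divfK// gt_eqF.
  have M0 : 0 <= M by exact: le_trans M1.
  apply: ler_pM; rewrite ?rnorm_ge0 ?mulr_ge0 ?expR_ge0//; last exact: hn0.
  by rewrite /E ler_wpM2l ?mulr_ge0// ler_expR ler_wpM2l.
have := rnorm_le_add _ (Sn n s (diff_quot B T (h n) x)) (Sn n s (A x)) (S s (A x)).
lra.
Qed.

(** [generator_limit] along [Sn n t x] with steps [h n]: the difference quotient commutes with
    [Sn n t], so it tends to [S t (A x)] by [limit_diff_quot]. *)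
Lemma limit_commutes t x : 0 <= t -> op_dom A x ->
  op_dom A (S t x) /\ A (S t x) = S t (A x).
Proof.
move=> t0 dx.
apply: (generator_limit B T hT M w M1 w0 hM A hA h (fun n => Sn n t x)).
- by move=> n; rewrite h_gt0 lexx.
- exact: limit_rcvg.
- move=> e e0; have [n0 hn0] := limit_diff_quot x t e dx t0 e0.
  exists n0 => n nn0; rewrite (diff_quot_unif_mixture_comm n t (h n) x)//.
  by apply: hn0; rewrite ?t0 ?lexx.
Qed.

Lemma limit_resolvent : resolvent A a S.
Proof.
have [v v0 hv] := limit_bound.
split; split => //.
- exact: (generator_closed B T hT M w M1 w0 hM A hA).
- exact: (generator_dense B T hT M w M1 w0 hM A hA).
- by move=> t t0; apply: (bounded_opI _ _ (2 * M * expR (v * t))) => x; exact: hv.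
- split => [x|x].
    apply: (unif_limit_continuous B (fun n t => Sn n t x)).
      by move=> n; exact: (unif_mixture_continuous B T a P hP Sn hSn).
    move=> t1 e t10 e0; have [n0 hn0] := hS x t1 e t10 e0.
    by exists n0 => t tt1; exact: hn0.
  have := limit_rcvg 0 x (lexx 0).
  rewrite (_ : (fun n => _) = fun=> x); last first.
    by apply/funext => n; exact: unif_mixture_at0.
  by move=> h1; apply: (rcvg_unique _ _ _ _ h1); exact: rcvg_cst.
- by move=> t x t0 dx; exact: limit_commutes.
- move=> t x t0 dx.
  (* Written as [S s (A x)], the integrand is a locally uniform limit of mixtures of difference
     quotients of [x]. *)
  apply: (eq_bochner_integral _ _ (fun s => (a (t - s))%:K *: S s (A x))).
    move=> s; rewrite /= in_itv/= => /andP[s0 _].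
    by have [_ ->] := limit_commutes s x s0 dx.
  apply: (bochner_mixture t _ x) => // e e0.
  have e2 : 0 < e / 2 by rewrite divr_gt0.
  have [n0 hn0] := limit_diff_quot x t _ dx t0 e2.
  have [n1 hn1] := hS x t _ t0 e2.
  pose n := maxn n0 n1; exists n; have [C C0 hC] := hSn n t t0.
  have [K0 hK0] := half_pow_small (C * rnorm (diff_quot B T (h n) x)) _ e2.
  have [K1 hK1] := half_pow_small (C * rnorm x) _ e2.
  exists (maxn K0 K1) => K; rewrite geq_max => /andP[/hK0 k0 /hK1 k1].
  split=> [s st|].
    have h1 := le_trans (hC K s _ st) k0.
    have h2 := hn0 n s (leq_maxl _ _) st.
    have := rnorm_le_add _ (mixture B T (P n) (h n) K s (diff_quot B T (h n) x))
      (Sn n s (diff_quot B T (h n) x)) (S s (A x)); rewrite -/(h n) in h1; lra.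
  rewrite opprB addrA subrK.
  have tt : 0 <= t <= t by rewrite t0 lexx.
  have h1 := le_trans (hC K t _ tt) k1.
  have h2 := hn1 n t (leq_maxr _ _) tt.
  have := rnorm_le_add _ (mixture B T (P n) (h n) K t x) (Sn n t x) (S t x).
  rewrite -/(h n) in h1; lra.
Qed.

Lemma limit_uniform x (K : set R) : compact K -> K `<=` `[0, +oo[ ->
  {uniform K, (fun n t => Sn n t x) @ \oo --> (fun t => S t x)}.
Proof.
move=> cK K0; have /compact_bounded[b [_ hb]] := cK.
pose t1 := Num.max b 0 + 1.
have t10 : 0 <= t1 by rewrite addr_ge0// le_max lexx orbT.
have Kt1 t : K t -> 0 <= t <= t1.
  move=> Kt; have := K0 t Kt; rewrite /= in_itv/= andbT => t0; rewrite t0/=.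
  apply: le_trans (ler_norm t) _; apply: (hb t1) => //.
  by rewrite ltr_pwDr// le_max lexx.
move=> Q /uniform_nbhs[E [entE EQ]].
have [e /= e0 eE] : exists2 e : scalar_field R k, 0 < e &
    [set xy : B * B | ball xy.1 e xy.2] `<=` E.
  by move: entE; rewrite -entourage_ballE => -[e e0 he]; exists e.
have [n0 hn0] := hS x t1 _ t10 (divr_gt0 (toR_gt0 _ e0) (ltr0n _ 2)).
exists n0 => // n /= nn0; apply: EQ => t Kt; apply: eE.
rewrite /= -ball_normE /ball_/= -rnormK -[X in _ < X]ofR_toR ?ltW// ofR_lt rnormC.
apply: le_lt_trans (hn0 n t nn0 (Kt1 t Kt)) _.
by rewrite ltr_pdivrMr// ltr_pMr ?ltr1n// toR_gt0.
Qed.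

End Assembly.

Theorem theorem1 (R : realType) (k : scalar_kind)
    (B : completeNormedModType (scalar_field R k)) (A : operator B) (a : R -> R)
    (hA : generates_C0_semigroup A)
    (ha : loc_integrable a) (hcp : completely_positive a) :
  exists S : R -> {linear B -> B},
    [/\ resolvent A a S, exp_bounded S &
      exists (An : nat -> {linear B -> B}) (Sn : nat -> R -> {linear B -> B}),
        [/\ forall n, bounded_op (An n),
            forall n, resolvent (everywhere_op (An n)) a (Sn n),
            exists M w0 : R, [/\ 1 <= M, 0 <= w0 &
              forall n t, 0 <= t ->
                (opnorm (Sn n t) <= (M * expR (w0 * t))%:E)%E],
            forall x t, 0 <= t -> Sn n t x @[n --> \oo] --> S t x &
            forall (x : B) (K : set R), compact K -> K `<=` `[0, +oo[ ->
              {uniform K, (fun n t => Sn n t x) @ \oo --> (fun t => S t x)}]].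
Proof.
have [T [hT hgen]] := hA.
have [M [w [M1 w0 hM]]] := semigroup_growth B T hT.
have /choice[P hP] : forall n : nat, exists p, weights a n.+1%:R p.
  by move=> n; exact: weights_exist.
have /choice[Sn hSn] : forall n : nat, exists S : R -> {linear B -> B},
    forall t1, 0 <= t1 -> exists2 C, 0 <= C & forall K t x, 0 <= t <= t1 ->
    rnorm (mixture B T (P n) n.+1%:R^-1 K t x - S t x) <= C * rnorm x * 2^-1 ^+ K.
  move=> n; apply: (mixture_limit B T M w M1 hM a ha hcp n.+1%:R) => //.
have [S hS] := unif_mixture_limit_exists B T hT M w M1 w0 hM a ha hcp P hP Sn hSn.
have M2 : 1 <= 2 * M by lra.
have [v v0 hv] := unif_mixture_bound B T M w M1 w0 hM a ha hcp P hP Sn hSn.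
have [u u0 hu] := limit_bound B T M w M1 w0 hM a ha hcp P hP Sn hSn S hS.
exists S; split.
- exact: (limit_resolvent B T hT M w M1 w0 hM a ha hcp P hP Sn hSn A hgen S hS).
- exists (2 * M), u; split => // t t0; apply: opnorm_le => [|x]; last exact: hu.
  by rewrite mulr_ge0 ?expR_ge0// (le_trans ler01).
exists (fun n => diff_quot B T n.+1%:R^-1 : {linear B -> B}), Sn; split.
- by move=> n; apply: (diff_quot_bounded B T M w hM); rewrite invr_gt0.
- exact: (unif_mixture_resolvent B T hT M w M1 w0 hM a ha hcp P hP Sn hSn).
- exists (2 * M), v; split => // n t t0; apply: opnorm_le => [|x]; last exact: hv.
  by rewrite mulr_ge0 ?expR_ge0// (le_trans ler01).
- by move=> x t t0; apply/rcvgP; exact: (limit_rcvg B Sn S hS).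
- by move=> x K; exact: (limit_uniform B Sn S hS).
Qed.
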